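(* Let $(X,d)=(X_1,d_1)\times(X_2,d_2)$ be a product of two proper Hadamard spaces with the standard product metric $d$, and let $G\subset Is(X_1)\times Is(X_2)$ be a group acting properly on $X$. Assume that $G$ contains two elements $g=(g_1,g_2)$ and $h=(h_1,h_2)$ such that, for each $i\in\{1,2\}$, $g_i$ and $h_i$ are independent rank one isometries of $X_i$, and that $\delta_\theta>0$ for every $\theta\in(0,\pi/2)$. If $\delta_0=\max_{\theta\in[0,\pi/2]}\delta_\theta$, then there exists a $G$-invariant $(b,0)$-density for some $b\in\mathbb{R}^2$. Respectively, if $\delta_{\pi/2}=\max_{\theta\in[0,\pi/2]}\delta_\theta$, then there exists a $G$-invariant $(b,\pi/2)$-density for some $b\in\mathbb{R}^2$.
   Context: A Hadamard space is a complete simply connected metric space of non-positive Alexandrov curvature (a complete CAT(0) space); it is proper if all balls of finite radius are compact. For $(X_1,d_1),(X_2,d_2)$ proper Hadamard spaces, $X=X_1\times X_2$ carries the metric $d=\sqrt{d_1^2+d_2^2}$; $Is(X_i)$ is the isometry group of $X_i$; $o=(o_1,o_2)\in X$ is a fixed base point. A group $G\subset Is(X_1)\times Is(X_2)$ acts properly on $X$ if $\{g\in G: d(x,gx)\le r\}$ is finite for all $x\in X$, $r>0$. An isometry of a Hadamard space is rank one if it acts as a translation on a geodesic axis which does not bound a flat half plane; it then fixes the two endpoints of its axis in the geometric boundary. Two rank one isometries are independent if their sets of fixed boundary endpoints are disjoint. Growth rate. For $g=(g_1,g_2)\in G$ with $go\ne o$ let $\theta(g)=\arctan\frac{d_2(o_2,g_2o_2)}{d_1(o_1,g_1o_1)}\in[0,\pi/2]$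 (with value $\pi/2$ if the denominator is $0$). For $\theta\in[0,\pi/2]$, $\epsilon>0$, integer $n\ge1$, put $A_{\epsilon,\theta}(o,n)=\{g\in G: go\neq o,\ n-1\le d(o,go)<n,\ |\theta(g)-\theta|\le\epsilon\}$, $\delta_{\epsilon,\theta}=\limsup_{n\to\infty}\frac{\log|A_{\epsilon,\theta}(o,n)|}{n}$ (with $\log 0=-\infty$), and $\delta_\theta=\liminf_{\epsilon\to0}\delta_{\epsilon,\theta}$. Boundary. $\partial X,\partial X_1,\partial X_2$ are the geometric boundaries (classes of asymptotic geodesic rays) with the cone topology. $\partial X_0=\partial X_1\subset\partial X$ (classes of rays $t\mapsto(\sigma_1(t),x_2)$) is the set of boundary points of slope $0$, and $\partial X_{\pi/2}=\partial X_2\subset\partial X$ (classes of rays $t\mapsto(x_1,\sigma_2(t))$) is the set of boundary points of slope $\pi/2$. $G$ acts on $\partial X$ by homeomorphisms. $L_G\subset\partial X$ is the limit set, the set of accumulation points of the orbit $Go$ in $\partial X$. For $\alpha_i\in\partial X_i$ represented by a unit speed ray $\sigma_i$, the Busemann function is $B_{\alpha_i}(x,y)=\lim_{s\to\infty}\big(d_i(x,\sigma_i(s))-d_i(y,\sigma_i(s))\big)$ for $x,y\in X_i$. Density. Let $\mathcal{M}^+(\partial X)$ be the cone of finite positive Borel measures on $\partial X$ with the weak-* topology. For $\theta\in\{0,\pi/2\}$ and $b=(b_1,b_2)\in\mathbb{R}^2$, a ($G$-invariant) $(b,\theta)$-density is a continuous map $\nu:X\to\mathcal{M}^+(\partial X)$,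 $x\mapsto\nu_x$, such that for every $x=(x_1,x_2)\in X$: (1) $\emptyset\neq supp(\nu_x)\subset L_G\cap\partial X_\theta$; (2) $g\nu_x=\nu_{gx}$ for all $g\in G$, where $g\nu_x(E)=\nu_x(g^{-1}E)$; (3) $\nu_x$ is absolutely continuous with respect to $\nu_o$ and: if $\theta=0$, then $b_2=0$ and $\frac{d\nu_x}{d\nu_o}(\alpha)=\exp\{b_1B_{\alpha_1}(o_1,x_1)\}$ for $\alpha=\alpha_1\in supp(\nu_o)$; if $\theta=\pi/2$, then $b_1=0$ and $\frac{d\nu_x}{d\nu_o}(\alpha)=\exp\{b_2B_{\alpha_2}(o_2,x_2)\}$ for $\alpha=\alpha_2\in supp(\nu_o)$.
   Formalization: The maximal exponent (δ_0, respectively δ_{π/2}) is additionally assumed to be finite; with the value +∞ allowed, the claim fails, for example for a product of a tree group of infinite critical exponent with a cocompact free group. *)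

(* Defs.v *)
From HB Require Import structures.
From mathcomp Require Import all_boot all_order all_algebra generic_quotient.
From mathcomp Require Import all_classical all_reals all_analysis.
From mathcomp Require Import ring lra.

Set Implicit Arguments.
Unset Strict Implicit.
Unset Printing Implicit Defensive.
Import Order.TTheory GRing.Theory Num.Theory.
Import numFieldNormedType.Exports.
Local Open Scope classical_set_scope.
Local Open Scope ring_scope.
Local Open Scope quotient_scope.
Local Open Scope charge_scope.

(* The Cartesian product with the metric sqrt(d1^2 + d2^2); the metric of the
   library's own product instance is the maximum of d1 and d2. *)
Definition l2prod (R : realType) (X1 X2 : metricType R) : Type :=
  (X1 * X2)%type.

Section l2prod_metric.
Context (R : realType) (X1 X2 : metricType R).

HB.instance Definition _ := Choice.copy (l2prod X1 X2) (X1 * X2)%type.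

Definition l2dist (x y : l2prod X1 X2) : R :=
  Num.sqrt (mdist x.1 y.1 ^+ 2 + mdist x.2 y.2 ^+ 2).

Let l2distxx x : l2dist x x = 0.
Proof. by rewrite /l2dist !mdistxx expr0n/= addr0 sqrtr0. Qed.

Let l2dist_positivity x y : l2dist x y = 0 -> x = y.
Proof.
case: x y => [x1 x2] [y1 y2] /eqP; rewrite /l2dist /= sqrtr_eq0 => h.
have a0 := sqr_ge0 (mdist x1 y1); have b0 := sqr_ge0 (mdist x2 y2).
have /eqP : mdist x1 y1 ^+ 2 = 0 by lra.
rewrite sqrf_eq0 => /eqP/mdist_positivity ->.
have /eqP : mdist x2 y2 ^+ 2 = 0 by lra.
by rewrite sqrf_eq0 => /eqP/mdist_positivity ->.
Qed.

Let l2dist_sym x y : l2dist x y = l2dist y x.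
Proof. by rewrite /l2dist (metric_sym x.1) (metric_sym x.2). Qed.

Let minkowski2 (a b c d : R) : Num.sqrt ((a + c) ^+ 2 + (b + d) ^+ 2) <=
  Num.sqrt (a ^+ 2 + b ^+ 2) + Num.sqrt (c ^+ 2 + d ^+ 2).
Proof.
set p := Num.sqrt (a ^+ 2 + b ^+ 2); set q := Num.sqrt (c ^+ 2 + d ^+ 2).
have p0 : 0 <= p by exact: sqrtr_ge0.
have q0 : 0 <= q by exact: sqrtr_ge0.
have p2 : p ^+ 2 = a ^+ 2 + b ^+ 2 by rewrite sqr_sqrtr// addr_ge0 ?sqr_ge0.
have q2 : q ^+ 2 = c ^+ 2 + d ^+ 2 by rewrite sqr_sqrtr// addr_ge0 ?sqr_ge0.
have cs : a * c + b * d <= p * q.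
  apply: le_trans (ler_norm _) _; rewrite -(ger0_norm (mulr_ge0 p0 q0)).
  rewrite -ler_sqr ?nnegrE ?normr_ge0// !real_normK ?num_real//.
  rewrite exprMn p2 q2; have := sqr_ge0 (a * d - b * c); nra.
rewrite -(ger0_norm (addr_ge0 p0 q0)) -sqrtr_sqr ler_sqrt ?sqr_ge0//.
by rewrite (sqrrD p) p2 q2; nra.
Qed.

Let l2dist_triangle y x z : l2dist x z <= l2dist x y + l2dist y z.
Proof.
apply: le_trans (minkowski2 _ _ _ _).
rewrite /l2dist ler_sqrt ?addr_ge0 ?sqr_ge0//.
by apply: lerD; rewrite ler_sqr ?nnegrE ?addr_ge0 ?mdist_ge0//
  metric_triangle.
Qed.

HB.instance Definition _ := isMetric.Build R (l2prod X1 X2)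
  l2distxx l2dist_positivity l2dist_sym l2dist_triangle.

Lemma l2distE (x y : l2prod X1 X2) :
  mdist x y = Num.sqrt (mdist x.1 y.1 ^+ 2 + mdist x.2 y.2 ^+ 2).
Proof. by []. Qed.

End l2prod_metric.

Definition plane (R : realType) : metricType R := l2prod (R^o : metricType R) R^o.

Section hadamard.
Context (R : realType) (X : metricType R).

Definition is_geodesic (c : R -> X) (x y : X) := [/\ c 0 = x,
  c (mdist x y) = y &
  forall s t, 0 <= s <= mdist x y -> 0 <= t <= mdist x y ->
    mdist (c s) (c t) = `|s - t|].

(* A geodesic triangle has vertices x i and sides c i from x i to x (i + 1),
   with indices in 'I_3 = Z/3; x' is the comparison triangle, and p', q' are
   the comparison points of c i s and c j t. *)
Definition cat0 :=
  (forall x y : X, exists c, is_geodesic c x y) /\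
  forall (x : 'I_3 -> X) (c : 'I_3 -> R -> X) (x' : 'I_3 -> plane R),
    (forall i, is_geodesic (c i) (x i) (x (i + 1))) ->
    (forall i j, mdist (x' i) (x' j) = mdist (x i) (x j)) ->
  forall (i j : 'I_3) (s t : R) (p' q' : plane R),
    0 <= s <= mdist (x i) (x (i + 1)) ->
    0 <= t <= mdist (x j) (x (j + 1)) ->
    mdist (x' i) p' = s ->
    mdist p' (x' (i + 1)) = mdist (x i) (x (i + 1)) - s ->
    mdist (x' j) q' = t ->
    mdist q' (x' (j + 1)) = mdist (x j) (x (j + 1)) - t ->
    mdist (c i s) (c j t) <= mdist p' q'.

Definition hadamard :=
  (forall F : set_system X, ProperFilter F -> cauchy F ->
    exists x : X, F --> x) /\ cat0.

Definition proper_space :=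
  forall (x : X) (r : R), compact [set y | mdist x y <= r].

End hadamard.
Arguments hadamard {R} X.
Arguments proper_space {R} X.

Record isom (R : realType) (X : metricType R) := Isom {
  isom_fun :> X -> X ;
  isom_inv : X -> X ;
  isom_mdist : forall x y, mdist (isom_fun x) (isom_fun y) = mdist x y ;
  isomK : cancel isom_fun isom_inv ;
  isomKV : cancel isom_inv isom_fun }.

HB.instance Definition _ R X := gen_eqMixin (@isom R X).
HB.instance Definition _ R X := gen_choiceMixin (@isom R X).

Section isom_group.
Context (R : realType) (X : metricType R).
Implicit Types g h : isom X.

Lemma isom_eq g h : g =1 h -> g = h.
Proof.
case: g h => [f f' fd fK fKV] [k k' kd kK kKV] /= /funext fk.
subst k; have kf : f' = k' by apply/funext => x; rewrite -{1}(kKV x) fK.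
by subst k'; congr Isom; exact: Prop_irrelevance.
Qed.

Definition isom1 : isom X :=
  @Isom R X id id (fun _ _ => erefl) (fun _ => erefl) (fun _ => erefl).

Lemma isomM_mdist g h x y : mdist ((g \o h) x) ((g \o h) y) = mdist x y.
Proof. by rewrite /= !isom_mdist. Qed.

Definition isomM g h : isom X := Isom (isomM_mdist g h)
  (can_comp (isomK g) (isomK h)) (can_comp (isomKV h) (isomKV g)).

Lemma isomV_mdist g x y : mdist (isom_inv g x) (isom_inv g y) = mdist x y.
Proof. by rewrite -(isom_mdist g) !isomKV. Qed.

Definition isomV g : isom X := Isom (isomV_mdist g) (isomKV g) (isomK g).

Let isomA : associative isomM. Proof. by move=> f g h; exact: isom_eq. Qed.
Let isom1M : left_id isom1 isomM. Proof. by move=> f; exact: isom_eq. Qed.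
Let isomM1 : right_id isom1 isomM. Proof. by move=> f; exact: isom_eq. Qed.
Let isomVM : left_inverse isom1 isomV isomM.
Proof. by move=> f; apply: isom_eq => x; exact: isomK. Qed.
Let isomMV : right_inverse isom1 isomV isomM.
Proof. by move=> f; apply: isom_eq => x; exact: isomKV. Qed.

HB.instance Definition _ :=
  isGroup.Build (isom X) isomA isom1M isomM1 isomVM isomMV.

End isom_group.

Section prod_isom.
Context (R : realType) (X1 X2 : metricType R) (g : isom X1 * isom X2).

Definition prod_isom_fun (x : l2prod X1 X2) : l2prod X1 X2 :=
  (g.1 x.1, g.2 x.2).
Definition prod_isom_inv (x : l2prod X1 X2) : l2prod X1 X2 :=
  (isom_inv g.1 x.1, isom_inv g.2 x.2).

Lemma prod_isom_mdist x y :
  mdist (prod_isom_fun x) (prod_isom_fun y) = mdist x y.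
Proof. by rewrite !l2distE /= !isom_mdist. Qed.

Lemma prod_isomK : cancel prod_isom_fun prod_isom_inv.
Proof. by case=> x1 x2; rewrite /prod_isom_fun /prod_isom_inv /= !isomK. Qed.

Lemma prod_isomKV : cancel prod_isom_inv prod_isom_fun.
Proof. by case=> x1 x2; rewrite /prod_isom_fun /prod_isom_inv /= !isomKV. Qed.

Definition prod_isom : isom (l2prod X1 X2) :=
  Isom prod_isom_mdist prod_isomK prod_isomKV.

End prod_isom.

(* Unit speed geodesic rays; the values at negative times are junk. *)
Record ray (R : realType) (X : metricType R) := Ray {
  ray_fun :> R -> X ;
  ray_mdist : forall s t, 0 <= s -> 0 <= t ->
    mdist (ray_fun s) (ray_fun t) = `|s - t| }.

HB.instance Definition _ R X := gen_eqMixin (@ray R X).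
HB.instance Definition _ R X := gen_choiceMixin (@ray R X).

Section boundary.
Context (R : realType) (X : metricType R).

Definition asymptotic (s t : ray X) : bool :=
  `[< exists K : R, forall u, 0 <= u -> mdist (s u) (t u) <= K >].

Lemma asymptotic_refl : reflexive asymptotic.
Proof. by move=> s; apply/asboolP; exists 0 => u _; rewrite mdistxx. Qed.

Lemma asymptotic_sym : symmetric asymptotic.
Proof.
move=> s t; apply/asboolP/asboolP => -[K sK]; exists K => u u0;
  by rewrite metric_sym sK.
Qed.

Lemma asymptotic_trans : transitive asymptotic.
Proof.
move=> t s u /asboolP[K sK] /asboolP[L tL]; apply/asboolP; exists (K + L).
by move=> v v0; rewrite (le_trans (metric_triangle _ (t v) _))// lerD ?sK ?tL.
Qed.

Canonical asymptotic_equiv :=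
  EquivRel asymptotic asymptotic_refl asymptotic_sym asymptotic_trans.

Definition bdry : Type := {eq_quot asymptotic}.
HB.instance Definition _ := Choice.on bdry.

Definition ray_end (s : ray X) : bdry := \pi_({eq_quot asymptotic}) s.
Definition bdry_ray (xi : bdry) : ray X := repr (xi : {eq_quot asymptotic}).

Definition bordification : Type := (X + bdry)%type.
HB.instance Definition _ := gen_eqMixin bordification.
HB.instance Definition _ := gen_choiceMixin bordification.

Definition cone_nbhd (s : ray X) (r e : R) : set bordification :=
  [set z | match z with
    | inl x => r < mdist (s 0) x /\
        exists2 c, is_geodesic c (s 0) x & mdist (c r) (s r) < e
    | inr xi => exists t : ray X,
        [/\ ray_end t = xi, t 0 = s 0 & mdist (t r) (s r) < e]
    end].

Definition cone_subbase : set (set bordification) :=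
  [set U | (exists x r, 0 < r /\ U = inl @` ball x r) \/
           (exists s r e, [/\ 0 < r, 0 < e & U = cone_nbhd s r e])].

(* The cone topology. One usually only takes the sets cone_nbhd s r e with s
   issuing from a fixed base point; in a complete CAT(0) space the resulting
   topology does not depend on that point, so it is also the one generated by
   all of them. *)
HB.instance Definition _ :=
  isSubBaseTopological.Build bordification cone_subbase id.

HB.instance Definition _ :=
  Topological.copy bdry (initial_topology (inr : bdry -> bordification)).

Lemma ray_isom_mdist (g : isom X) (s : ray X) u v : 0 <= u -> 0 <= v ->
  mdist ((g \o s) u) ((g \o s) v) = `|u - v|.
Proof. by move=> u0 v0; rewrite /= isom_mdist ray_mdist. Qed.

Definition ray_isom (g : isom X) (s : ray X) : ray X :=
  Ray (@ray_isom_mdist g s).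

Definition bdry_act (g : isom X) (xi : bdry) : bdry :=
  ray_end (ray_isom g (bdry_ray xi)).

Definition busemann (xi : bdry) (x y : X) : R :=
  lim ((fun s : R => mdist x (bdry_ray xi s) - mdist y (bdry_ray xi s)) @ +oo).

Definition bounds_flat_half_plane (c : R -> X) :=
  exists F : plane R -> X,
    (forall p q : plane R, 0 <= p.2 -> 0 <= q.2 -> mdist (F p) (F q) = mdist p q)
    /\ forall t, F (t, 0) = c t.

Definition rank_one_axis (g : isom X) (c : R -> X) :=
  [/\ forall s t, mdist (c s) (c t) = `|s - t|,
      exists2 l, 0 < l & forall t, g (c t) = c (t + l) &
      ~ bounds_flat_half_plane c].

Definition rank_one (g : isom X) := exists c, rank_one_axis g c.

Definition axis_ends (g : isom X) : set bdry :=
  [set xi | exists2 c, rank_one_axis g c &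
    exists2 s : ray X, ray_end s = xi &
      (forall t, s t = c t) \/ (forall t, s t = c (- t))].

Definition independent_rank_one (g h : isom X) :=
  [/\ rank_one g, rank_one h & axis_ends g `&` axis_ends h = set0].

End boundary.
Arguments bordification {R} X.

(* A measurableType of the library must be pointed, whereas the boundary may
   be empty. *)
Definition bdry_at (R : realType) (X : metricType R) (xi : bdry X) : Type :=
  bdry X.

Section boundary_measures.
Context (R : realType) (X : metricType R) (xi : bdry X).

HB.instance Definition _ := Topological.copy (bdry_at xi) (bdry X).
HB.instance Definition _ := isPointed.Build (bdry_at xi) xi.

Definition borel_bdry := g_sigma_algebraType (@open (bdry_at xi)).
HB.instance Definition _ := Measurable.on borel_bdry.

Definition fin_meas : Type := {finite_measure set borel_bdry -> \bar R}.
HB.instance Definition _ := gen_eqMixin fin_meas.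
HB.instance Definition _ := gen_choiceMixin fin_meas.

Definition integrate (mu : fin_meas) :
    {ptws continuousType (bdry_at xi) R -> R} :=
  fun f => \int[mu : {finite_measure set borel_bdry -> \bar R}]_a f a.

Definition weak_star := initial_topology integrate.
HB.instance Definition _ := Topological.on weak_star.

End boundary_measures.

Section product.
Context (R : realType) (X1 X2 : metricType R).
Local Notation X := (l2prod X1 X2).
Implicit Types (G : set (isom X1 * isom X2)) (o : X).

Definition acts_properly G := forall (x : X) (r : R), 0 < r ->
  finite_set [set g | G g /\ mdist x (prod_isom g x) <= r].

Definition slope (g : isom X1 * isom X2) o : R :=
  if mdist o.1 (g.1 o.1) == 0 then pi / 2
  else atan (mdist o.2 (g.2 o.2) / mdist o.1 (g.1 o.1)).

Definition annulus G (eps theta : R) o (n : nat) : set (isom X1 * isom X2) :=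
  [set g | [/\ G g, prod_isom g o != o,
     n%:R - 1 <= mdist o (prod_isom g o) < n%:R &
     `|slope g o - theta| <= eps]].

Definition exponent_eps G o (eps theta : R) : \bar R :=
  limn_esup (fun n : nat =>
    (lne (counting (annulus G eps theta o n)) * (n%:R^-1)%:E)%E).

Definition exponent G o (theta : R) : \bar R :=
  limf_einf (fun eps => exponent_eps G o eps theta) (0 : R)^'+.

(* The maximum is that of a real-valued function: without finiteness, a group
   acting on X1 with infinite critical exponent, times a group acting on X2,
   gives exponent +oo at 0 but has no density for that angle. *)
Definition exponent_max_at G o (theta0 : R) :=
  exponent G o theta0 \is a fin_num /\
  forall theta, 0 <= theta <= pi / 2 ->
    (exponent G o theta <= exponent G o theta0)%E.

Definition limit_set G o : set (bdry X) :=
  [set xi | limit_point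
    [set (inl (prod_isom g o) : bordification X) | g in G] (inr xi)].

Lemma ray_left_mdist (s : ray X1) (x2 : X2) u v : 0 <= u -> 0 <= v ->
  mdist ((s u, x2) : X) ((s v, x2) : X) = `|u - v|.
Proof.
by move=> u0 v0; rewrite l2distE /= mdistxx expr0n addr0 sqrtr_sqr
  ger0_norm ?mdist_ge0// ray_mdist.
Qed.

Definition ray_left (s : ray X1) (x2 : X2) : ray X :=
  @Ray R X (fun t => (s t, x2)) (@ray_left_mdist s x2).

Lemma ray_right_mdist (x1 : X1) (s : ray X2) u v : 0 <= u -> 0 <= v ->
  mdist ((x1, s u) : X) ((x1, s v) : X) = `|u - v|.
Proof.
by move=> u0 v0; rewrite l2distE /= mdistxx expr0n add0r sqrtr_sqr
  ger0_norm ?mdist_ge0// ray_mdist.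
Qed.

Definition ray_right (x1 : X1) (s : ray X2) : ray X :=
  @Ray R X (fun t => (x1, s t)) (@ray_right_mdist x1 s).

(* Only meant for theta = 0 and theta = pi / 2; empty for other values. *)
Definition bdry_slope (theta : R) : set (bdry X) :=
  [set xi | (theta = 0 /\ exists s x2, xi = ray_end (ray_left s x2)) \/
            (theta = pi / 2 /\ exists x1 s, xi = ray_end (ray_right x1 s))].

Section density.
Variable xi : bdry X.

Definition meas_of (mu : weak_star xi) :
  {finite_measure set (borel_bdry xi) -> \bar R} := mu.

Definition supp (mu : weak_star xi) : set (bdry X) :=
  [set a | forall U : set (bdry X), open U -> U a -> (0 < meas_of mu U)%E].

(* Radon-Nikodym derivatives are only defined almost everywhere. *)
Definition is_density G o (b : R * R) (theta : R) (nu : X -> weak_star xi) :=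
  continuous nu /\ forall x : X,
  [/\ supp (nu x) !=set0 /\
        supp (nu x) `<=` limit_set G o `&` bdry_slope theta,
      forall g, G g -> forall E : set (borel_bdry xi), measurable E ->
        meas_of (nu (prod_isom g x)) E =
        pushforward (meas_of (nu x))
          (bdry_act (prod_isom g) : borel_bdry xi -> borel_bdry xi) E,
      meas_of (nu x) `<< meas_of (nu o),
      theta = 0 -> b.2 = 0 /\
        {ae meas_of (nu o), forall a : borel_bdry xi,
          forall (s : ray X1) (x2 : X2), a = ray_end (ray_left s x2) ->
          supp (nu o) a ->
          ('d (charge_of_finite_measure (meas_of (nu x)))
             '/d (meas_of (nu o))) a = (expR (b.1 * busemann (ray_end s) o.1 x.1))%:E} &
      theta = pi / 2 -> b.1 = 0 /\
        {ae meas_of (nu o), forall a : borel_bdry xi,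
          forall (x1 : X1) (s : ray X2), a = ray_end (ray_right x1 s) ->
          supp (nu o) a ->
          ('d (charge_of_finite_measure (meas_of (nu x)))
             '/d (meas_of (nu o))) a = (expR (b.2 * busemann (ray_end s) o.2 x.2))%:E}].

End density.

Definition has_density G o (b : R * R) (theta : R) :=
  exists (xi : bdry X) (nu : X -> weak_star xi), is_density G o b theta nu.

End product.

(* Main.v *)
Require Import Defs.
From HB Require Import structures.
From mathcomp Require Import finmap.
From mathcomp Require Import all_boot all_order all_algebra generic_quotient.
From mathcomp Require Import all_classical all_reals all_analysis.
From mathcomp Require Import measurable_realfun.
From mathcomp Require Import ring lra.

Set Implicit Arguments.
Unset Strict Implicit.
Unset Printing Implicit Defensive.
Import Order.TTheory GRing.Theory Num.Theory.
Import numFieldNormedType.Exports.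
Local Open Scope classical_set_scope.
Local Open Scope ring_scope.
Local Open Scope charge_scope.

(** Let Y be the factor that carries the boundary points of the maximal angle
    theta, d_Y the distance of the Y-components, d the distance of the product
    and delta the exponent at theta, which is positive by comparison with any
    angle in the interior.

    Growth. By compactness of the interval of angles, the bound delta on all
    exponents makes the series of exp (- s d(o, g o)) over G converge for
    s > delta (orbit_summable). Since the exponent at theta itself is delta, the
    series diverges for s < delta even over those g whose slope is as close to
    theta as desired (sector_diverges).

    Weights. Patterson's construction is applied to the potential 2 d - d_Y
    instead of d. It exceeds d except in the direction of Y, so the critical
    exponent is still delta, while the elements whose slope stays away from
    theta contribute a convergent series even somewhat below delta. Therefore
    every limit of the normalized orbit masses is carried by sequences in the
    orbit whose slope tends to theta (patterson_family). Along such sequences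
    the gradient of d - d_Y tends to 0, and the ratio of the weights seen from x
    and from o tends to exp (delta B), where B is the Busemann function of Y at
    the limit point (pot_cvg). This is the required Radon-Nikodym derivative.

    Limits. The limit of the masses is taken for all subsets of the group at
    once along an ultrafilter. The result is a finitely additive function, which
    extends to a measure on the Stone space of ultrafilters on the group, where
    compactness gives countable additivity. An ultrafilter along which the orbit
    escapes with slope tending to theta determines a limit point in the
    boundary: the geodesics in Y from the base point to the orbit converge to a
    ray. The density is the image of the limit masses under this map. It is
    equivariant because the map commutes with translations of the group
    (limit_pt_equivariant),
    it is carried by limit points of the orbit (orbit_tends), and the limit
    point map is measurable because neighbourhoods of limit points contain
    shadows, of which there are countably many (shadow_base). Continuity in x
    for the weak-* topology follows from the Lipschitz bound on Busemann
    functions (weak_star_continuous).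

    The geometry of nonpositive curvature enters through Stewart's inequality,
    which passes from the factors to the product, and the two angles differ by
    an exchange of the factors (l2_splitting). *)

(** * Stewart's inequality in CAT(0) spaces and in products *)

Section stewart.
Context (R : realType).

Definition between (M : metricType R) (l : R) (x y p : M) :=
  [/\ 0 <= l <= 1, mdist x p = l * mdist x y &
      mdist p y = (1 - l) * mdist x y].

(** The CAT(0) inequality for a vertex and a point of the opposite side, with
    the comparison distance computed by Stewart's theorem. It speaks of points
    only, so it passes to products by adding the two inequalities; it is the
    only form in which curvature enters below. *)
Definition stewart (M : metricType R) :=
  forall (l : R) (x y p q : M), between l x y p ->
  mdist q p ^+ 2 <= (1 - l) * mdist q x ^+ 2 + l * mdist q y ^+ 2
                    - l * (1 - l) * mdist x y ^+ 2.

Definition geodesic_space (M : metricType R) :=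
  forall x y : M, exists c, is_geodesic c x y.

Lemma planeE (x y : plane R) :
  mdist x y = Num.sqrt ((x.1 - y.1) ^+ 2 + (x.2 - y.2) ^+ 2).
Proof.
have E (u v : R^o) : mdist u v = `|v - u| by [].
by rewrite l2distE !E !real_normK ?num_real// -(sqrrN (y.1 - _)) -(sqrrN (y.2 - _)) !opprB.
Qed.

Lemma geodesic_between (M : metricType R) (c : R -> M) x y (l : R) :
  is_geodesic c x y -> 0 <= l <= 1 -> between l x y (c (l * mdist x y)).
Proof.
move=> [c0 cL cd] /andP[l0 l1]; have L0 := mdist_ge0 x y.
have r : 0 <= l * mdist x y <= mdist x y.
  by rewrite mulr_ge0//= ler_piMl.
split; first by rewrite l0.
- by rewrite -{1}c0 cd ?lexx ?L0// sub0r normrN ger0_norm// mulr_ge0.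
- rewrite -{2}cL cd ?lexx ?L0// distrC ger0_norm.
    by rewrite mulrBl mul1r.
  by rewrite subr_ge0; case/andP: r.
Qed.

(** The comparison triangle is placed with x at the origin and y on the first
    axis; (u, v) is the vertex for q, found by the law of cosines. *)
Lemma cat0_stewart_geodesic (M : metricType R) (x y q : M) (c : R -> M) (s : R) :
  cat0 M -> is_geodesic c x y -> 0 <= s <= mdist x y ->
  mdist q (c s) ^+ 2 * mdist x y <= (mdist x y - s) * mdist q x ^+ 2
     + s * mdist q y ^+ 2 - s * (mdist x y - s) * mdist x y.
Proof.
move=> [geo cmp] cg /andP[s0 sL].
have [L0|L0] := eqVneq (mdist x y) 0.
  have s00 : s = 0 by apply/eqP; rewrite eq_le s0 andbT -L0.
  by rewrite L0 s00; lra.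
have {}L0 : 0 < mdist x y by rewrite lt_neqAle eq_sym L0 mdist_ge0.
set L := mdist x y in L0 sL *; set a := mdist q x; set b := mdist q y.
have a0 : 0 <= a := mdist_ge0 _ _; have b0 : 0 <= b := mdist_ge0 _ _.
have t1 : L <= a + b by rewrite /a (metric_sym q x) metric_triangle.
have t2 : a <= b + L by rewrite /L (metric_sym x y) metric_triangle.
have t3 : b <= a + L by rewrite metric_triangle.
have [c1 c1g] := geo y q; have [c2 c2g] := geo q x.
pose u : R := (a ^+ 2 + L ^+ 2 - b ^+ 2) / (2 * L).
have uL : u * (2 * L) = a ^+ 2 + L ^+ 2 - b ^+ 2.
  by rewrite mulfVK// mulf_neq0 ?pnatr_eq0// gt_eqF.
have u2 : u ^+ 2 <= a ^+ 2.
  have : (u * (2 * L)) ^+ 2 <= (a * (2 * L)) ^+ 2.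
    rewrite uL -subr_ge0.
    have -> : (a * (2 * L)) ^+ 2 - (a ^+ 2 + L ^+ 2 - b ^+ 2) ^+ 2 =
      ((a + L - b) * (a + L + b)) * ((a + b - L) * (b + L - a)) by ring.
    by rewrite !mulr_ge0//; lra.
  by rewrite !exprMn ler_pM2r// -exprMn exprn_gt0// mulr_gt0.
pose v : R := Num.sqrt (a ^+ 2 - u ^+ 2).
have v2 : v ^+ 2 = a ^+ 2 - u ^+ 2 by rewrite sqr_sqrtr// subr_ge0.
pose X (i : 'I_3) : M := match val i with 0 => x | 1 => y | _ => q end.
pose C (i : 'I_3) : R -> M := match val i with 0 => c | 1 => c1 | _ => c2 end.
pose X' (i : 'I_3) : plane R :=
  match val i with 0 => (0, 0) | 1 => (L, 0) | _ => (u, v) end.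
have sqr (w z : R) : 0 <= z -> w = z ^+ 2 -> Num.sqrt w = z.
  by move=> z0 ->; rewrite sqrtr_sqr ger0_norm.
have X'd i j : mdist (X' i) (X' j) = mdist (X i) (X j).
  have xy : mdist ((0, 0) : plane R) ((L, 0) : plane R) = L.
    by rewrite planeE/=; apply: sqr; [exact: ltW|ring].
  have xq : mdist ((0, 0) : plane R) ((u, v) : plane R) = mdist x q.
    by rewrite planeE/= metric_sym -/a; apply: sqr => //; rewrite !sub0r !sqrrN v2; ring.
  have yq : mdist ((L, 0) : plane R) ((u, v) : plane R) = mdist y q.
    rewrite planeE/= metric_sym -/b; apply: sqr => //; rewrite sub0r sqrrN v2 sqrrB.
    by rewrite -mulr_natr -mulrA [L * (u * _)]mulrC -mulrA uL; ring.
  case: i => -[|[|[|//]]] ?; case: j => -[|[|[|//]]] ?;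
    rewrite /X' /X /= ?mdistxx//.
  - by rewrite metric_sym xy /L metric_sym.
  - by rewrite metric_sym xq metric_sym.
  - by rewrite metric_sym yq metric_sym.
have Cg i : is_geodesic (C i) (X i) (X (i + 1)).
  by case: i => -[|[|[|//]]] ?.
pose i0 : 'I_3 := Ordinal (isT : (0 < 3)%N).
pose i2 : 'I_3 := Ordinal (isT : (2 < 3)%N).
have := @cmp X C X' Cg X'd i0 i2 s 0 (s, 0) (u, v).
rewrite s0 sL lexx mdist_ge0 => /(_ isT isT).
have sqE : Num.sqrt (s ^+ 2) = s by rewrite sqrtr_sqr ger0_norm.
have -> : mdist (X' i0) (s, 0) = s.
  by rewrite planeE/=; apply: sqr => //; ring.
have -> : mdist ((s, 0) : plane R) (X' (i0 + 1)) = L - s.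
  by rewrite planeE/=; apply: sqr; [rewrite subr_ge0|ring].
have <- : mdist (X' i2) (X' (i2 + 1)) = mdist (X i2) (X (i2 + 1)) by rewrite X'd.
have E : mdist ((u, v) : plane R) (X' (i2 + 1)) = mdist (X' i2) (X' (i2 + 1)) - 0.
  by rewrite subr0.
move=> /(_ erefl erefl (mdistxx _) E).
rewrite /C /=; case: c2g => -> _ _; rewrite metric_sym planeE/= sub0r => H.
have {}H : mdist q (c s) ^+ 2 <= (s - u) ^+ 2 + (- v) ^+ 2.
  rewrite -[leRHS]sqr_sqrtr ?addr_ge0 ?sqr_ge0//.
  by rewrite ler_sqr ?nnegrE ?mdist_ge0 ?sqrtr_ge0.
apply: le_trans (ler_wpM2r (ltW L0) H) _; rewrite sqrrN v2.
rewrite le_eqVlt; apply/orP; left; apply/eqP.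
transitivity (s ^+ 2 * L - s * (u * (2 * L)) + a ^+ 2 * L); first by ring.
by rewrite uL; ring.
Qed.

(** The inequality for the point of the geodesic at the same parameter, applied
    with p in the place of q, forces p to be that point. *)
Lemma cat0_stewart (M : metricType R) : cat0 M -> stewart M.
Proof.
move=> Mc l x y p q [l01 xp py]; have /andP[l0 l1] := l01.
have L0 := mdist_ge0 x y.
have r : 0 <= l * mdist x y <= mdist x y.
  by rewrite mulr_ge0//= ler_piMl.
have [c cg] := Mc.1 x y.
have [cl0 cl1 cl2] := geodesic_between cg l01.
have [{}L0|{}L0] := eqVneq (mdist x y) 0.
  move: xp; rewrite L0 mulr0 => /mdist_positivity <-.
  rewrite (mdist_positivity _ _ L0) expr0n/= mulr0 subr0.
  by rewrite -mulrDl subrK mul1r.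
have {}L0 : 0 < mdist x y by rewrite lt_neqAle eq_sym L0 mdist_ge0.
have H (z : M) : mdist z (c (l * mdist x y)) ^+ 2 <=
   (1 - l) * mdist z x ^+ 2 + l * mdist z y ^+ 2 - l * (1 - l) * mdist x y ^+ 2.
  have := @cat0_stewart_geodesic _ _ _ z _ _ Mc cg r.
  set L := mdist x y in L0 * => H0; rewrite -(ler_pM2r L0); apply: le_trans H0 _.
  by rewrite le_eqVlt; apply/orP; left; apply/eqP; ring.
suff -> : p = c (l * mdist x y) by [].
have := H p; rewrite py (metric_sym p x) xp; set L := mdist x y in L0 *.
set t := mdist p _ => Ht.
have {}Ht : t ^+ 2 <= 0 by apply: le_trans Ht _; rewrite le_eqVlt; apply/orP; left; apply/eqP; ring.
by apply/mdist_positivity/eqP; rewrite -sqrf_eq0 eq_le Ht sqr_ge0.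
Qed.

End stewart.

(** A record, rather than the product type itself, lets the two factors
    exchange their roles. *)
Record l2_splitting (R : realType) (Y Z X : metricType R) := L2Splitting {
  prY : X -> Y ;
  prZ : X -> Z ;
  pair_of : Y -> Z -> X ;
  prY_pair : forall y z, prY (pair_of y z) = y ;
  prZ_pair : forall y z, prZ (pair_of y z) = z ;
  pair_pr : forall x, pair_of (prY x) (prZ x) = x ;
  mdist_split : forall x x' : X,
    mdist x x' ^+ 2 = mdist (prY x) (prY x') ^+ 2 + mdist (prZ x) (prZ x') ^+ 2
}.

Section splitting.
Context (R : realType) (Y Z X : metricType R) (S : l2_splitting Y Z X).
Local Notation pY := (prY S).
Local Notation pZ := (prZ S).
Local Notation pr := (pair_of S).

Lemma mdist_prY x x' : mdist (pY x) (pY x') <= mdist x x'.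
Proof.
rewrite -ler_sqr ?nnegrE ?mdist_ge0// (mdist_split S).
by rewrite lerDl sqr_ge0.
Qed.

Lemma mdist_prZ x x' : mdist (pZ x) (pZ x') <= mdist x x'.
Proof.
rewrite -ler_sqr ?nnegrE ?mdist_ge0// (mdist_split S).
by rewrite lerDr sqr_ge0.
Qed.

Lemma mdist_le_add x x' : mdist x x' <= mdist (pY x) (pY x') + mdist (pZ x) (pZ x').
Proof.
rewrite -ler_sqr ?nnegrE ?addr_ge0 ?mdist_ge0// (mdist_split S) sqrrD.
by rewrite -addrA [leRHS]addrA addrAC lerDl mulrn_wge0// mulr_ge0 ?mdist_ge0.
Qed.

(** Equality in the Minkowski inequality: a point that divides a segment of the
    product in the ratio l has components that do so in each factor. *)
Lemma between_split l x y p : between l x y p ->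
  between l (pY x) (pY y) (pY p) /\ between l (pZ x) (pZ y) (pZ p).
Proof.
move=> [l01 xp py]; have /andP[l0 l1] := l01.
have e1 := mdist_split S x p; have e2 := mdist_split S p y.
have e3 := mdist_split S x y; rewrite xp in e1; rewrite py in e2.
have t1 := metric_triangle (pY x) (pY p) (pY y).
have t2 := metric_triangle (pZ x) (pZ p) (pZ y).
have := mdist_ge0 (pY x) (pY p); have := mdist_ge0 (pY p) (pY y).
have := mdist_ge0 (pZ x) (pZ p); have := mdist_ge0 (pZ p) (pZ y).
have := mdist_ge0 (pY x) (pY y); have := mdist_ge0 (pZ x) (pZ y).
rewrite /between; move: e1 e2 e3 t1 t2.
set a1 := mdist (pY x) (pY p); set b1 := mdist (pY p) (pY y).
set a2 := mdist (pZ x) (pZ p); set b2 := mdist (pZ p) (pZ y).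
set L1 := mdist (pY x) (pY y); set L2 := mdist (pZ x) (pZ y).
set L := mdist x y => e1 e2 e3 t1 t2 L20 L10 b20 a20 b10 a10.
have s1 : L1 ^+ 2 <= (a1 + b1) ^+ 2 by rewrite ler_sqr ?nnegrE ?addr_ge0.
have s2 : L2 ^+ 2 <= (a2 + b2) ^+ 2 by rewrite ler_sqr ?nnegrE ?addr_ge0.
have dotge : l * (1 - l) * L ^+ 2 <= a1 * b1 + a2 * b2.
  by rewrite -subr_ge0; move: s1 s2 e1 e2; rewrite e3; nra.
have key : ((1 - l) * a1 - l * b1) ^+ 2 + ((1 - l) * a2 - l * b2) ^+ 2 <= 0.
  have -> : ((1 - l) * a1 - l * b1) ^+ 2 + ((1 - l) * a2 - l * b2) ^+ 2 =
    (1 - l) ^+ 2 * (a1 ^+ 2 + a2 ^+ 2) + l ^+ 2 * (b1 ^+ 2 + b2 ^+ 2)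
     - 2 * (l * (1 - l)) * (a1 * b1 + a2 * b2) by ring.
  rewrite -e1 -e2.
  have : 2 * (l * (1 - l)) * (l * (1 - l) * L ^+ 2) <= 2 * (l * (1 - l)) * (a1 * b1 + a2 * b2).
    by rewrite ler_wpM2l// !mulr_ge0// subr_ge0.
  by lra.
have q1 := sqr_ge0 ((1 - l) * a1 - l * b1); have q2 := sqr_ge0 ((1 - l) * a2 - l * b2).
have k1 : (1 - l) * a1 = l * b1.
  by apply/eqP; rewrite -subr_eq0 -sqrf_eq0 eq_le q1 andbT; lra.
have k2 : (1 - l) * a2 = l * b2.
  by apply/eqP; rewrite -subr_eq0 -sqrf_eq0 eq_le q2 andbT; lra.
have f1 : (a1 + b1) ^+ 2 + (a2 + b2) ^+ 2 = L1 ^+ 2 + L2 ^+ 2.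
  have a1E : a1 = l * (a1 + b1) by rewrite mulrDr -k1; ring.
  have a2E : a2 = l * (a2 + b2) by rewrite mulrDr -k2; ring.
  have b1E : b1 = (1 - l) * (a1 + b1) by rewrite mulrDr k1; ring.
  have b2E : b2 = (1 - l) * (a2 + b2) by rewrite mulrDr k2; ring.
  set u := a1 + b1 in a1E b1E *; set v := a2 + b2 in a2E b2E *.
  have e1' : (l * L) ^+ 2 = l ^+ 2 * (u ^+ 2 + v ^+ 2) by rewrite e1 {1}a1E {1}a2E; ring.
  have e2' : ((1 - l) * L) ^+ 2 = (1 - l) ^+ 2 * (u ^+ 2 + v ^+ 2) by rewrite e2 {1}b1E {1}b2E; ring.
  have : (l ^+ 2 + (1 - l) ^+ 2) * (u ^+ 2 + v ^+ 2 - (L1 ^+ 2 + L2 ^+ 2)) = 0.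
    by rewrite -e3 mulrBr mulrDl -e1' -e2'; ring.
  move/eqP; rewrite mulf_eq0 => /orP[/eqP|/eqP]; last by lra.
  by nra.
have g1 : L1 = a1 + b1.
  apply/eqP; rewrite eq_le t1 /= -ler_sqr ?nnegrE ?addr_ge0//; lra.
have g2 : L2 = a2 + b2.
  apply/eqP; rewrite eq_le t2 /= -ler_sqr ?nnegrE ?addr_ge0//; lra.
rewrite g1 g2; split; split=> //.
- by rewrite mulrDr -k1; ring.
- by rewrite mulrDr k1; ring.
- by rewrite mulrDr -k2; ring.
- by rewrite mulrDr k2; ring.
Qed.

Lemma stewart_split : stewart Y -> stewart Z -> stewart X.
Proof.
move=> hY hZ l x y p q /between_split[bY bZ].
have := hY _ _ _ _ (pY q) bY; have := hZ _ _ _ _ (pZ q) bZ.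
by rewrite !(mdist_split S); lra.
Qed.

Lemma geodesic_split : geodesic_space Y -> geodesic_space Z -> geodesic_space X.
Proof.
move=> hY hZ x y.
have [c1 [c10 c1L c1d]] := hY (pY x) (pY y).
have [c2 [c20 c2L c2d]] := hZ (pZ x) (pZ y).
have [L0|L0] := eqVneq (mdist x y) 0.
  exists (fun=> x); split => //; first exact: mdist_positivity.
  move=> s t; rewrite L0 => hs ht.
  have -> : s = 0 by apply/eqP; rewrite eq_le andbC.
  have -> : t = 0 by apply/eqP; rewrite eq_le andbC.
  by rewrite subrr normr0 mdistxx.
have {}L0 : 0 < mdist x y by rewrite lt_neqAle eq_sym L0 mdist_ge0.
have e3 := mdist_split S x y.
set L := mdist x y in L0 e3 *; set L1 := mdist (pY x) (pY y) in e3 c1L c1d.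
set L2 := mdist (pZ x) (pZ y) in e3 c2L c2d.
have L10 : 0 <= L1 := mdist_ge0 _ _; have L20 : 0 <= L2 := mdist_ge0 _ _.
exists (fun t => pr (c1 (t / L * L1)) (c2 (t / L * L2))); split.
- by rewrite !mul0r c10 c20 pair_pr.
- by rewrite divff ?gt_eqF// !mul1r c1L c2L pair_pr.
move=> s t /andP[s0 sL] /andP[t0 tL].
have r (u M : R) : 0 <= u -> u <= L -> 0 <= M -> 0 <= u / L * M <= M.
  move=> u0 uL M0; rewrite mulr_ge0 ?divr_ge0 ?(ltW L0)//=.
  by rewrite ler_piMl// ler_pdivrMr// mul1r.
apply/eqP; rewrite -(eqrXn2 (isT : (0 < 2)%N)) ?mdist_ge0// (mdist_split S).
rewrite !prY_pair !prZ_pair c1d ?c2d ?r// -!mulrBl !normrM.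
rewrite (ger0_norm L10) (ger0_norm L20) !exprMn -mulrDr -e3 -!exprMn.
by rewrite normfV (gtr0_norm L0) mulfVK ?(gt_eqF L0).
Qed.

End splitting.

(** * Comparison of segments and rays, Busemann functions *)

Section comparison.
Context (R : realType) (M : metricType R).
Hypothesis SM : stewart M.
Implicit Types (x y p q u v : M) (r : R).

Definition on_segment p y u r :=
  [/\ 0 <= r, mdist p u = r & mdist u y = mdist p y - r].

Lemma on_segment_le p y u r : on_segment p y u r -> r <= mdist p y.
Proof. by move=> [_ _ h]; rewrite -subr_ge0 -h mdist_ge0. Qed.

Lemma geodesic_on_segment (c : R -> M) x y r : is_geodesic c x y ->
  0 <= r <= mdist x y -> on_segment x y (c r) r.
Proof.
move=> [c0 cL cd] /andP[r0 rL]; split => //.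
- by rewrite -{1}c0 cd ?lexx ?r0 ?rL ?mdist_ge0// sub0r normrN ger0_norm.
- by rewrite -{1}cL cd ?lexx ?r0 ?rL ?mdist_ge0// distrC ger0_norm// subr_ge0.
Qed.

Lemma ray_on_segment (s : ray M) r N : 0 <= r <= N ->
  on_segment (s 0) (s N) (s r) r.
Proof.
move=> /andP[r0 rN]; have N0 := le_trans r0 rN.
split=> //; first by rewrite ray_mdist// sub0r normrN ger0_norm.
by rewrite !ray_mdist// distrC sub0r normrN !ger0_norm// subr_ge0.
Qed.

Lemma on_segment_sym p y u r : on_segment p y u r ->
  on_segment y p u (mdist p y - r).
Proof.
move=> h; have := on_segment_le h; case: h => r0 h1 h2 rL.
split; first by rewrite subr_ge0.
  by rewrite metric_sym.
by rewrite metric_sym h1 (metric_sym y p); lra.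
Qed.

Lemma stewart_segment p y u q r : on_segment p y u r ->
  mdist q u ^+ 2 * mdist p y <= (mdist p y - r) * mdist q p ^+ 2
     + r * mdist q y ^+ 2 - r * (mdist p y - r) * mdist p y.
Proof.
move=> h; have rL := on_segment_le h; case: h => r0 h1 h2.
have [L0|L0] := eqVneq (mdist p y) 0.
  have -> : r = 0 by apply/eqP; rewrite eq_le r0 andbT -L0.
  by rewrite L0; lra.
have {}L0 : 0 < mdist p y by rewrite lt_neqAle eq_sym L0 mdist_ge0.
set L := mdist p y in rL h2 L0 *.
have rE : r = r / L * L by rewrite mulfVK// gt_eqF.
have b : between (r / L) p y u.
  split; first by rewrite divr_ge0 ?(ltW L0)//= ler_pdivrMr// mul1r.
    by rewrite -/L -rE.
  by rewrite -/L mulrBl mul1r -rE.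
have := ler_wpM2r (ltW L0) (SM q b); rewrite -/L => /le_trans; apply.
rewrite le_eqVlt; apply/orP; left; apply/eqP.
by move: rE; move: (r / L) => l rE; rewrite rE; ring.
Qed.

(** Two applications of Stewart's inequality, one on each segment. If
    [p, y] and [p, y'] are long with respect to the distance of y and y', they
    remain close for a long time. *)
Lemma fellow_travel p y y' u v r :
  on_segment p y u r -> on_segment p y' v r ->
  0 < mdist p y -> 0 < mdist p y' ->
  mdist u v ^+ 2 * (mdist p y * mdist p y') <=
    r ^+ 2 * (mdist y y' ^+ 2 - (mdist p y - mdist p y') ^+ 2).
Proof.
move=> hu hv a0 b0; have ra := on_segment_le hu; have rb := on_segment_le hv.
have := stewart_segment v hu; have := stewart_segment y hv.
case: hu => r0 u1 u2; case: hv => _ v1 v2.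
rewrite (metric_sym v p) v1 (metric_sym v u) (metric_sym y p) (metric_sym y v).
set a := mdist p y in a0 ra *; set b := mdist p y' in b0 rb *.
set c := mdist y y'; set d := mdist v y; set e := mdist u v => H1 H2.
have H3 := ler_wpM2l r0 H1; have H4 := ler_wpM2r (ltW b0) H2.
rewrite -(ler_pM2r a0) in H4.
by nra.
Qed.

(** If going from p to y' through y is a detour of at most E, then [p, y] and
    [p, y'] stay close at time r when d(p, y) is large. *)
Lemma fellow_travel_excess p y y' u v r E :
  on_segment p y u r -> on_segment p y' v r ->
  0 < mdist p y' ->
  mdist y y' <= mdist p y' - mdist p y + E ->
  mdist u v ^+ 2 * mdist p y <= 2 * r ^+ 2 * E.
Proof.
move=> hu hv b0 hE.
have E0 : 0 <= E.
  by have := metric_triangle p y y'; lra.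
have [a0|a0] := eqVneq (mdist p y) 0.
  by rewrite a0 mulr0 mulr_ge0// pmulr_rge0// sqr_ge0.
have {}a0 : 0 < mdist p y by rewrite lt_neqAle eq_sym a0 mdist_ge0.
have := fellow_travel hu hv a0 b0.
have t1 := metric_triangle p y y'; have t2 := metric_triangle p y' y.
have t3 : mdist y y' <= mdist p y + mdist p y'.
  by rewrite (metric_sym p y) metric_triangle.
rewrite (metric_sym y' y) in t2.
move: t1 t2 t3 hE a0 b0; set a := mdist p y; set b := mdist p y'.
set c := mdist y y' => t1 t2 t3 hE a0 b0 H.
rewrite -(ler_pM2r b0) -mulrA; apply: le_trans H _.
have -> : 2 * r ^+ 2 * E * b = r ^+ 2 * (E * (2 * b)) by ring.
rewrite ler_wpM2l ?sqr_ge0//.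
have -> : c ^+ 2 - (a - b) ^+ 2 = (c - (b - a)) * (c + (b - a)) by ring.
by apply: ler_pM; lra.
Qed.

Lemma fellow_travel_le p y y' u v r :
  on_segment p y u r -> on_segment p y' v r -> mdist u v <= mdist y y'.
Proof.
move=> hu hv; have ra := on_segment_le hu; have rb := on_segment_le hv.
have [r0 u1 u2] := hu; have [_ v1 v2] := hv.
have [re|re] := eqVneq r 0.
  move: u1 v1; rewrite re => /mdist_positivity <- /mdist_positivity <-.
  by rewrite mdistxx mdist_ge0.
have {}re : 0 < r by rewrite lt_neqAle eq_sym re.
have a0 := lt_le_trans re ra; have b0 := lt_le_trans re rb.
have := fellow_travel hu hv a0 b0.
have ab0 : 0 < mdist p y * mdist p y' by rewrite mulr_gt0.
move=> H; rewrite -ler_sqr ?nnegrE ?mdist_ge0// -(ler_pM2r ab0).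
apply: le_trans H _; rewrite mulrC.
apply: ler_pM; rewrite ?sqr_ge0//.
- rewrite subr_ge0 -[leLHS]real_normK ?num_real//.
  rewrite ler_sqr ?nnegrE ?mdist_ge0//.
  have t1 := metric_triangle p y y'; have t2 := metric_triangle p y' y.
  rewrite (metric_sym y' y) in t2.
  by rewrite ler_norml; lra.
- by rewrite lerBlDr lerDl sqr_ge0.
- by rewrite expr2; apply: ler_pM.
Qed.

(** Both segments end at y, so they are compared backwards from y, at equal
    distances from it; the difference of their lengths, at most d(p, p'), is
    paid once more for the change of parameter. *)
Lemma fellow_travel_end p p' y (c c' : R -> M) r :
  is_geodesic c p y -> is_geodesic c' p' y ->
  0 <= r <= mdist p y -> r <= mdist p' y ->
  mdist (c r) (c' r) <= 2 * mdist p p'.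
Proof.
wlog ab : p p' c c' / mdist p y <= mdist p' y.
  move=> H cg cg' /andP[r0 ra] rb.
  have /orP[|] := le_total (mdist p y) (mdist p' y) => ab.
    by apply: H => //; rewrite r0.
  by rewrite metric_sym (metric_sym p) H// r0.
move=> cg cg' /andP[r0 ra] rb.
have t1 := metric_triangle p' p y; rewrite (metric_sym p' p) in t1.
set a := mdist p y in ab ra t1; set b := mdist p' y in ab rb t1.
have ha : 0 <= r <= a by rewrite r0.
have hb : 0 <= b - (a - r) <= b by apply/andP; split; lra.
have hb2 : 0 <= r <= b by rewrite r0.
have hu := on_segment_sym (geodesic_on_segment cg ha).
have hv := on_segment_sym (geodesic_on_segment cg' hb).
have e : mdist p' y - (b - (a - r)) = mdist p y - r by rewrite -/a -/b; lra.
rewrite e in hv.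
have := fellow_travel_le hu hv.
have [_ _ cd'] := cg'.
have : mdist (c' (b - (a - r))) (c' r) = b - a.
  by rewrite cd'// (_ : _ - r = b - a) ?ger0_norm//; lra.
have := metric_triangle (c r) (c' (b - (a - r))) (c' r).
by lra.
Qed.

(** Replacing the far end z of the segment [o, z] by a point at distance N from
    o changes the difference of the distances to o and to x by at most a
    multiple of 1 / N, uniformly in z: Busemann functions are uniform limits on
    bounded sets. *)
Lemma busemann_excess (o x z z' : M) N :
  on_segment o z z' N -> mdist o x < N ->
  0 <= (mdist o z - mdist x z) - (N - mdist x z') <=
     mdist o x ^+ 2 / (2 * (N - mdist o x)).
Proof.
move=> hz DN; have NL := on_segment_le hz; have [N0 z1 z2] := hz.
have H := stewart_segment x hz; rewrite (metric_sym x o) in H.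
have t0 := metric_triangle x z' z; rewrite z2 in t0.
have t1 := metric_triangle o x z'; rewrite z1 in t1.
have t2 := metric_triangle o x z.
have t3 := metric_triangle x o z; rewrite (metric_sym x o) in t3.
have D0 := mdist_ge0 o x; have a0 := mdist_ge0 x z'; have b0 := mdist_ge0 x z.
move: H t0 t1 t2 t3 D0 DN NL a0 b0; set D := mdist o x; set L := mdist o z.
set a := mdist x z'; set b := mdist x z => H t0 t1 t2 t3 D0 DN NL a0 b0.
apply/andP; split; first by lra.
rewrite ler_pdivlMr; last by lra.
have L0 : 0 < L by lra.
have e1 : (a - (b - (L - N))) * (a + (b - (L - N))) <= D ^+ 2.
  rewrite -(ler_pM2r L0).
  have : (L - N) * (D ^+ 2 - (b - L) ^+ 2) <= L * D ^+ 2.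
    apply: (@le_trans _ _ ((L - N) * D ^+ 2)).
      by rewrite ler_wpM2l ?subr_ge0// lerBlDr lerDl sqr_ge0.
    by rewrite ler_wpM2r ?sqr_ge0//; lra.
  by nra.
have -> : L - b - (N - a) = a - (b - (L - N)) by ring.
apply: le_trans e1; rewrite ler_wpM2l//; lra.
Qed.

End comparison.

Section rays.
Context (R : realType) (M : metricType R).
Hypothesis SM : stewart M.
Hypothesis GM : geodesic_space M.
Implicit Types (x y p q : M) (r : R) (s t : ray M).

Lemma le0_of_bounded_multiples (x C N0 : R) :
  (forall N, N0 <= N -> x * N <= C) -> x <= 0.
Proof.
move=> H; rewrite leNgt; apply/negP => x0.
have := H (Num.max N0 ((`|C| + 1) / x)); rewrite le_max lexx => /(_ isT).
apply/negP; rewrite -ltNge.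
apply: (@lt_le_trans _ _ (`|C| + 1)).
  by rewrite (le_lt_trans (ler_norm _))// ltrDl.
by rewrite mulrC -ler_pdivrMr// le_max lexx orbT.
Qed.

Lemma ray_endP s t : ray_end s = ray_end t <->
  exists K : R, forall u, 0 <= u -> mdist (s u) (t u) <= K.
Proof.
rewrite /ray_end; split.
  by move=> /eqP; rewrite eqmodE => /asboolP.
by move=> h; apply/eqP; rewrite eqmodE; apply/asboolP.
Qed.

Lemma bdry_rayK (xi : bdry M) : ray_end (bdry_ray xi) = xi.
Proof. exact: reprK. Qed.

Lemma ray_mdist0 s r : 0 <= r -> mdist (s 0) (s r) = r.
Proof. by move=> r0; rewrite ray_mdist// sub0r normrN ger0_norm. Qed.

(** With a bound K on the distance of the rays, the fellow-travelling estimate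
    at time N is of order r K / N. *)
Lemma asymptotic_ray_unique s t : s 0 = t 0 -> ray_end s = ray_end t ->
  forall r, 0 <= r -> s r = t r.
Proof.
move=> st0 /ray_endP[K sK] r r0; apply: mdist_positivity; apply/eqP.
have K0 : 0 <= K by rewrite (le_trans _ (sK 0 (lexx _)))// mdist_ge0.
rewrite -sqrf_eq0 eq_le sqr_ge0 andbT.
apply: (@le0_of_bounded_multiples _ (r ^+ 2 * K ^+ 2) (r + 1)) => N rN.
have N0 : 0 < N by lra.
have h : 0 <= r <= N by apply/andP; split; lra.
have hs := ray_on_segment s h; have := ray_on_segment t h; rewrite -st0 => ht.
have e1 : mdist (s 0) (s N) = N by rewrite ray_mdist0// ltW.
have e2 : mdist (s 0) (t N) = N by rewrite st0 ray_mdist0// ltW.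
have := fellow_travel SM hs ht; rewrite e1 e2 => /(_ N0 N0).
rewrite subrr expr0n/= subr0 => H.
suff : mdist (s r) (t r) ^+ 2 * (N * N) <= (r ^+ 2 * K ^+ 2) * N.
  by rewrite mulrA ler_pM2r.
apply: le_trans H _.
apply: (@le_trans _ _ (r ^+ 2 * K ^+ 2)).
  rewrite ler_wpM2l ?sqr_ge0// ler_sqr ?nnegrE ?mdist_ge0//.
  by apply: sK; lra.
by rewrite ler_peMr ?mulr_ge0 ?sqr_ge0//; lra.
Qed.

(** The function N |-> N - d(x, s N) is nondecreasing, and its limit is the
    value of the Busemann function of s, here read along s itself instead of
    along a chosen representative of its end. *)
Definition busemann_ray s x := sup [set N - mdist x (s N) | N in [set N | 0 <= N]].

Lemma busemann_ray_excess s x N N' : mdist (s 0) x < N -> N <= N' ->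
  0 <= (N' - mdist x (s N')) - (N - mdist x (s N)) <=
     mdist (s 0) x ^+ 2 / (2 * (N - mdist (s 0) x)).
Proof.
move=> DN NN'; have N0 : 0 <= N by rewrite ltW// (le_lt_trans (mdist_ge0 _ _) DN).
have h : 0 <= N <= N' by rewrite N0.
have := busemann_excess SM (ray_on_segment s h) DN.
by rewrite ray_mdist0// (le_trans N0).
Qed.

Lemma busemann_ray_approx s x N : mdist (s 0) x < N ->
  0 <= busemann_ray s x - (N - mdist x (s N)) <=
     mdist (s 0) x ^+ 2 / (2 * (N - mdist (s 0) x)).
Proof.
move=> DN; have N0 : 0 <= N by rewrite ltW// (le_lt_trans (mdist_ge0 _ _) DN).
set A := [set N - mdist x (s N) | N in [set N | 0 <= N]].
have A0 : A !=set0 by exists (N - mdist x (s N)); exists N.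
have ub : ubound A (N - mdist x (s N) + mdist (s 0) x ^+ 2 / (2 * (N - mdist (s 0) x))).
  move=> _ [N' N'0 <-].
  have [NN'|/ltW N'N] := leP N N'.
    by have /andP[_] := busemann_ray_excess DN NN'; rewrite lerBlDl.
  apply: (@le_trans _ _ (N - mdist x (s N))).
    have := metric_triangle x (s N') (s N).
    by rewrite ray_mdist// distrC ger0_norm ?subr_ge0//; lra.
  by rewrite lerDl divr_ge0 ?sqr_ge0// mulr_ge0// subr_ge0 ltW.
apply/andP; split.
  rewrite subr_ge0; apply: ub_le_sup; last by exists N.
  by eexists; exact: ub.
by rewrite lerBlDl; apply: ge_sup.
Qed.

Lemma excess_small (D e : R) : 0 < e -> exists N0, forall N, N0 <= N ->
  D < N /\ D ^+ 2 / (2 * (N - D)) < e.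
Proof.
move=> e0; exists (D + 1 + D ^+ 2 / e) => N hN.
have q0 : 0 <= D ^+ 2 / e by rewrite divr_ge0 ?sqr_ge0// ltW.
have DN : D < N by lra.
split=> //; rewrite ltr_pdivrMr; last by lra.
have qe : D ^+ 2 = e * (D ^+ 2 / e) by rewrite mulrC mulfVK// gt_eqF.
rewrite {1}qe ltr_pM2l//; lra.
Qed.

(** The representative rho of the end of s need not start at s 0. The segment
    from s 0 to a far point of rho fellow-travels with s up to time N0, after
    which both sides are known up to the error of busemann_excess. *)
Lemma busemann_rayE s x : busemann (ray_end s) (s 0) x = busemann_ray s x.
Proof.
rewrite /busemann; set rho := bdry_ray _.
have [K sK] : exists K : R, forall u, 0 <= u -> mdist (s u) (rho u) <= K.
  by apply/ray_endP; rewrite bdry_rayK.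
have K0 : 0 <= K by rewrite (le_trans _ (sK 0 (lexx _)))// mdist_ge0.
apply/cvg_lim => //; apply/cvgrPdist_lt => e e0.
have e3 : 0 < e / 3 by rewrite divr_gt0.
have [N0 /(_ _ (lexx _))[DN exN]] := excess_small (mdist (s 0) x) e3.
have N0p : 0 < N0 by rewrite (le_lt_trans _ DN)// mdist_ge0.
exists (K + 1 + N0 + (N0 ^+ 2 * K ^+ 2) / (e / 3) ^+ 2).
split; [exact: num_real|move=> u hu].
have q0 : 0 <= (N0 ^+ 2 * K ^+ 2) / (e / 3) ^+ 2 by rewrite -exprMn divr_ge0 ?sqr_ge0.
have u0 : 0 <= u by lra.
have uK : mdist (s u) (rho u) <= K by exact: sK.
have bu : u - K <= mdist (s 0) (rho u).
  have := metric_triangle (s 0) (rho u) (s u).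
  by rewrite (metric_sym (rho u)) ray_mdist0//; lra.
have [c cg] := GM (s 0) (rho u).
have hz : on_segment (s 0) (rho u) (c N0) N0.
  by apply: geodesic_on_segment => //; apply/andP; split; lra.
have hs : on_segment (s 0) (s u) (s N0) N0.
  by apply: ray_on_segment; apply/andP; split; lra.
have b0 : 0 < mdist (s 0) (rho u) by lra.
have := fellow_travel SM hz hs b0; rewrite ray_mdist0// => /(_ ltac:(lra)) F.
have dsm : mdist (c N0) (s N0) < e / 3.
  rewrite -ltr_sqr ?nnegrE ?mdist_ge0 ?ltW//.
  have bb : u <= mdist (s 0) (rho u) * u by rewrite ler_peMl//; lra.
  have F2 : mdist (c N0) (s N0) ^+ 2 * u <= N0 ^+ 2 * K ^+ 2.
    apply: (@le_trans _ _ (mdist (c N0) (s N0) ^+ 2 * (mdist (s 0) (rho u) * u))).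
      by rewrite ler_wpM2l ?sqr_ge0.
    apply: le_trans F _; rewrite ler_wpM2l ?sqr_ge0//.
    apply: (@le_trans _ _ (mdist (rho u) (s u) ^+ 2)).
      by rewrite lerBlDr lerDl sqr_ge0.
    by rewrite ler_sqr ?nnegrE ?mdist_ge0// metric_sym.
  have up : 0 < u by lra.
  rewrite -(ltr_pM2r up); apply: le_lt_trans F2 _.
  by rewrite [ltRHS]mulrC -ltr_pdivrMr ?exprn_gt0//; lra.
have /andP[h1 h2] := busemann_excess SM hz DN.
have /andP[h3 h4] := busemann_ray_approx DN.
have t1 := metric_triangle x (c N0) (s N0).
have t2 := metric_triangle x (s N0) (c N0); rewrite (metric_sym (s N0)) in t2.
by rewrite ltr_norml; apply/andP; split; lra.
Qed.

End rays.

(** * Limits of geodesics and neighbourhoods of boundary points *)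

Section ultrafilters.

Lemma ultra_fmap (I T : Type) (f : I -> T) (U : set_system I) :
  UltraFilter U -> UltraFilter (f @ U).
Proof.
move=> UU; split=> [|G GF FG]; first exact: fmap_proper_filter.
rewrite predeqE => A; split; last exact: FG.
move=> GA; have [//|UA] := in_ultra_setVsetC (f @^-1` A) UU.
have GA' : G (~` A) by exact: FG.
by exfalso; apply: (@filter_not_empty _ G); rewrite -(setICr A); exact: filterI.
Qed.

Lemma ultra_cvg_compact (I : Type) (T : topologicalType) (K : set T)
    (f : I -> T) (U : set_system I) : UltraFilter U -> compact K ->
  (\forall i \near U, K (f i)) -> exists l : T, f @ U --> l.
Proof.
move=> UU; rewrite compact_ultra => cK UK.
by have [l [_ fl]] := cK _ (ultra_fmap f UU) UK; exists l.
Qed.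

Context (R : realType) (M : metricType R) (I : Type) (F : set_system I).
Context {FF : ProperFilter F}.
Implicit Types (f g : I -> M) (l m : M).

Lemma cvg_mdist f l : f @ F --> l ->
  forall e, 0 < e -> \forall i \near F, mdist (f i) l < e.
Proof.
move=> fl e e0; have : \forall i \near F, mdist l (f i) < e.
  exact: metricType_numDomainType.cvgr_dist_lt.
by apply: filterS => i; rewrite metric_sym.
Qed.

Lemma cvg_mdist_le f g l m (K : R) : f @ F --> l -> g @ F --> m ->
  (\forall i \near F, mdist (f i) (g i) <= K) -> mdist l m <= K.
Proof.
move=> fl gm H; apply/ler_addgt0Pl => e e0.
have e2 : 0 < e / 2 by rewrite divr_gt0.
have [i [[h1 h2] h3]] := filter_ex (filterI (filterI (cvg_mdist fl e2) (cvg_mdist gm e2)) H).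
have := metric_triangle l (f i) m; have := metric_triangle (f i) (g i) m.
by rewrite (metric_sym l (f i)); lra.
Qed.

Lemma cvg_mdist_ge f g l m (K : R) : f @ F --> l -> g @ F --> m ->
  (\forall i \near F, K <= mdist (f i) (g i)) -> K <= mdist l m.
Proof.
move=> fl gm H; apply/ler_addgt0Pl => e e0.
have e2 : 0 < e / 2 by rewrite divr_gt0.
have [i [[h1 h2] h3]] := filter_ex (filterI (filterI (cvg_mdist fl e2) (cvg_mdist gm e2)) H).
have := metric_triangle (f i) l (g i); have := metric_triangle l m (g i).
by rewrite (metric_sym m (g i)); lra.
Qed.

End ultrafilters.

Section limits_of_geodesics.
Context (R : realType) (M : metricType R).
Hypothesis PM : proper_space M.

(** Along an ultrafilter no subsequence has to be extracted: bounded sets are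
    relatively compact, so the geodesics converge at every time. *)
Lemma geodesics_subconverge (I : Type) (U : set_system I) (p : M)
    (c : I -> R -> M) (y : I -> M) : UltraFilter U ->
  (forall i, is_geodesic (c i) p (y i)) ->
  (forall N : R, \forall i \near U, N <= mdist p (y i)) ->
  exists s : ray M, s 0 = p /\
    forall t, 0 <= t -> (fun i => c i t) @ U --> s t.
Proof.
move=> UU cg yfar.
have limt (t : R) : 0 <= t -> exists l : M, (fun i => c i t) @ U --> l.
  move=> t0; have cK : compact [set y | mdist p y <= t] by exact: PM.
apply: (ultra_cvg_compact UU cK).
  apply: filterS (yfar t) => i ti /=; case: (cg i) => c0 _ cd.
  by rewrite -{1}c0 cd ?lexx ?mdist_ge0 ?t0// sub0r normrN ger0_norm.
pose s t : M := if pselect (0 <= t) is left h then sval (cid (limt t h)) else p.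
have sP t : 0 <= t -> (fun i => c i t) @ U --> s t.
  by move=> t0; rewrite /s; case: pselect => // h; case: (cid _).
have sr u v : 0 <= u -> 0 <= v -> mdist (s u) (s v) = `|u - v|.
  move=> u0 v0.
  have H : \forall i \near U, mdist (c i u) (c i v) = `|u - v|.
    apply: filterS2 (yfar u) (yfar v) => i ui vi.
    by case: (cg i) => _ _ ->//; rewrite ?u0 ?v0.
  apply/eqP; rewrite eq_le; apply/andP; split.
    by apply: (cvg_mdist_le (sP u u0) (sP v v0)); apply: filterS H => i ->.
  by apply: (cvg_mdist_ge (sP u u0) (sP v v0)); apply: filterS H => i ->.
exists (Ray sr); split=> //=.
apply: mdist_positivity; apply/eqP; rewrite eq_le mdist_ge0 andbT.
have pc : (fun=> p) @ U --> p by exact: cvg_cst.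
apply: (cvg_mdist_le (sP 0 (lexx _)) pc).
by apply: nearW => i; case: (cg i) => -> _ _; rewrite mdistxx.
Qed.

Lemma ray_geodesic (s : ray M) N : 0 <= N -> is_geodesic s (s 0) (s N).
Proof.
move=> N0; split=> //; first by rewrite ray_mdist0.
by move=> u v /andP[u0 _] /andP[v0 _]; exact: ray_mdist.
Qed.

(** The rays from which an asymptotic ray issues at every point, at uniformly
    bounded distance. A ray in a slice of a product inherits this property from
    the factor. *)
Definition movable (s : ray M) := forall p, exists t : ray M,
  t 0 = p /\ forall u, 0 <= u -> mdist (t u) (s u) <= 2 * mdist p (s 0).

Hypothesis SM : stewart M.
Hypothesis GM : geodesic_space M.

Lemma ray_movable (s : ray M) : movable s.
Proof.
move=> p; have [U [UU noU]] := ultraFilterLemma eventually_filter.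
pose c (n : nat) := sval (cid (GM p (s n%:R))).
have cg n : is_geodesic (c n) p (s n%:R) by rewrite /c; case: cid.
have far (N : R) : \forall n \near U, N <= mdist p (s n%:R).
  apply: noU; near=> n.
  have := metric_triangle (s 0) p (s n%:R); rewrite ray_mdist0//.
  have : N + mdist p (s 0) <= n%:R by near: n; exact: nbhs_infty_ger.
  by rewrite (metric_sym (s 0) p); lra.
have [t [t0 tP]] := geodesics_subconverge UU cg far.
exists t; split=> // u u0.
have pc : (fun=> s u) @ U --> s u by exact: cvg_cst.
apply: (cvg_mdist_le (tP u u0) pc).
have fu : \forall n \near U, u <= n%:R by apply: noU; exact: nbhs_infty_ger.
apply: filterS2 (far u) fu => n un un'.
apply: (fellow_travel_end SM (cg n) (ray_geodesic s (ler0n _ _))).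
  by rewrite u0.
by rewrite ray_mdist0.
Unshelve. all: by end_near. Qed.

End limits_of_geodesics.

Section cone_topology.
Context (R : realType) (M : metricType R).
Hypothesis SM : stewart M.
Hypothesis GM : geodesic_space M.
Implicit Types (s t : ray M) (U : set (bordification M)).

(** Seen from t 0, every point y that is reached from t 0 through the vicinity
    of s N with a bounded detour lies in almost the same direction as the ray t
    asymptotic to s. It is what frees neighbourhoods in the cone topology from
    the base points of the cones. *)
Lemma cone_stable s t (K E r e : R) : 0 <= r -> 0 < e ->
  (forall u, 0 <= u -> mdist (t u) (s u) <= K) ->
  exists N0, forall N, N0 <= N -> forall y' y v,
    mdist y' (s N) <= 1 -> mdist y' y <= mdist (t 0) y - N + E ->
    on_segment (t 0) y v r -> mdist v (t r) < e.
Proof.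
move=> r0 e0 tK; set p := t 0; set D := mdist p (s 0).
have D0 : 0 <= D := mdist_ge0 _ _.
have K0 : 0 <= K by rewrite (le_trans _ (tK 0 (lexx _)))// mdist_ge0.
(* E1 bounds two detours, that through y' on the way from p to y and that
   through y' on the way from p to t N. *)
pose E1 := `|E| + K + D + 2; have E10 : 0 <= E1 by rewrite !addr_ge0.
exists (D + 2 + r + `|E| + 2 * r ^+ 2 * E1 / (e / 2) ^+ 2) => N hN y' y v yN yE hv.
have q0 : 0 <= 2 * r ^+ 2 * E1 / (e / 2) ^+ 2.
  by rewrite divr_ge0 ?sqr_ge0// mulr_ge0// pmulr_rge0// sqr_ge0.
have E0 := normr_ge0 E; have Ele := ler_norm E.
have N0 : 0 <= N by lra.
have a1 : N - D - 1 <= mdist p y'.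
  have t1 := metric_triangle (s 0) p (s N); rewrite ray_mdist0// in t1.
  have t2 := metric_triangle p y' (s N).
  by rewrite (metric_sym (s 0)) -/D in t1; lra.
have a2 : mdist p y' <= N + D + 1.
  have t1 := metric_triangle p (s 0) (s N); rewrite ray_mdist0// in t1.
  have t2 := metric_triangle p (s N) y'; rewrite (metric_sym (s N)) in t2.
  by rewrite -/D in t1; lra.
have [c cg] := GM p y'.
have hw : on_segment p y' (c r) r.
  by apply: geodesic_on_segment => //; rewrite r0; lra.
have ht : on_segment p (t N) (t r) r.
  by apply: ray_on_segment; rewrite r0; lra.
have b0 : 0 < mdist p y by have := mdist_ge0 y' y; lra.
have b0' : 0 < mdist p (t N) by rewrite ray_mdist0//; lra.
have x1 : mdist y' y <= mdist p y - mdist p y' + E1 by rewrite /E1; lra.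
have x2 : mdist y' (t N) <= mdist p (t N) - mdist p y' + E1.
  rewrite ray_mdist0//; have := metric_triangle y' (s N) (t N).
  by rewrite (metric_sym (s N)); have := tK N N0; rewrite /E1; lra.
have F1 := fellow_travel_excess SM hw hv b0 x1.
have F2 := fellow_travel_excess SM hw ht b0' x2.
have dsm (d : R) : 0 <= d -> d ^+ 2 * mdist p y' <= 2 * r ^+ 2 * E1 -> d < e / 2.
  move=> d0 H; rewrite -ltr_sqr ?nnegrE ?divr_ge0 ?(ltW e0)//.
  have P : 0 < mdist p y' by lra.
  rewrite -(ltr_pM2r P); apply: le_lt_trans H _.
  by rewrite [ltRHS]mulrC -ltr_pdivrMr ?exprn_gt0 ?divr_gt0//; lra.
have s1 := dsm _ (mdist_ge0 _ _) F1; have s2 := dsm _ (mdist_ge0 _ _) F2.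
have := metric_triangle v (c r) (t r); rewrite (metric_sym v (c r)); lra.
Qed.

Lemma nbhs_cone_filter (F : set_system (bordification M)) z :
  Filter F -> (forall W, cone_subbase W -> W z -> F W) ->
  forall U, nbhs z U -> F U.
Proof.
move=> FF H U; rewrite nbhsE => -[V [Vo Vz] VU].
apply: filterS VU _; case: Vo => D' D'sub; rewrite predeqE => VE.
have /VE[B D'B Bz] := Vz.
have FB : F B.
  have := D'sub _ D'B => -[/= A Asub BE].
  rewrite -BE; apply: filter_bigI => W WA /=.
  by apply: H; [exact/set_mem/Asub|move: Bz; rewrite -BE; exact].
by apply: filterS FB => w Bw; apply/VE; exists B.
Qed.

(** A family of points converges to the end of s as soon as passing through
    s N costs a detour bounded independently of N. *)
Lemma nbhs_ray_end_orbit s (I : Type) (F : set_system I) (y : I -> M) (E : R) :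
  Filter F ->
  (forall N, 0 <= N -> \forall i \near F,
     mdist (s N) (y i) <= mdist (s 0) (y i) - N + E) ->
  forall U, nbhs (inr (ray_end s) : bordification M) U ->
  \forall i \near F, U (inl (y i)).
Proof.
move=> FF H U sU; apply: (@nbhs_cone_filter ((inl \o y) @ F) _ _ _ U sU).
move=> W [[x [r [_ ->]]] [] //|[s' [r [e [r0 e0 ->]]]]].
move=> [t [ts t0 tre]].
have [K tK] := (ray_endP _ _).1 ts.
have D0 := mdist_ge0 (t 0) (s 0).
have [N0 hN0] := @cone_stable s t K (E + mdist (t 0) (s 0)) r
  (e - mdist (t r) (s' r)) (ltW r0) ltac:(by rewrite subr_gt0) tK.
pose N := Num.max N0 0; have hN := hN0 N ltac:(by rewrite le_max lexx).
have NN : 0 <= N by rewrite le_max lexx orbT.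
have NN' : 0 <= N + `|E| + r + 2 * mdist (t 0) (s 0) + 1.
  by rewrite !addr_ge0// ?(ltW r0)// mulr_ge0.
apply: filterS2 (H _ NN) (H _ NN') => i Hi Hi' /=.
have t2 := metric_triangle (s 0) (t 0) (y i); rewrite (metric_sym (s 0) (t 0)) in t2.
have far : r < mdist (t 0) (y i).
  have := mdist_ge0 (s (N + `|E| + r + 2 * mdist (t 0) (s 0) + 1)) (y i).
  by have := ler_norm E; lra.
split; first by rewrite -t0.
have [c cg] := GM (t 0) (y i); exists c; first by rewrite -t0.
have hv : on_segment (t 0) (y i) (c r) r.
  by apply: geodesic_on_segment => //; rewrite (ltW r0) ltW.
have := hN (s N) (y i) _ ltac:(by rewrite mdistxx) ltac:(lra) hv.
by have := metric_triangle (c r) (t r) (s' r); lra.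
Qed.

Lemma nbhs_ray_end_rays s U : nbhs (inr (ray_end s) : bordification M) U ->
  exists N0, forall N, N0 <= N -> forall s', movable s' -> s' 0 = s 0 ->
    mdist (s' N) (s N) <= 1 -> U (inr (ray_end s')).
Proof.
pose F : set_system (bordification M) := [set U | exists N0, forall N, N0 <= N ->
  forall s', movable s' -> s' 0 = s 0 ->
    mdist (s' N) (s N) <= 1 -> U (inr (ray_end s'))].
have FF : Filter F.
  split; first by exists 0.
    move=> P Q [N1 h1] [N2 h2]; exists (Num.max N1 N2) => N.
    by rewrite ge_max => /andP[hN1 hN2] s' m e d; split; [apply: h1 hN1 _ _ _ _|apply: h2 hN2 _ _ _ _].
  move=> P Q PQ [N1 h1]; exists N1 => N hN s' m e d.
  by apply: PQ; apply: h1 hN _ _ _ _.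
apply: (@nbhs_cone_filter F) => W [[x [r [_ ->]]] [] //|[s1 [r [e [r0 e0 ->]]]]].
move=> [t [ts t0 tre]].
have [K tK] := (ray_endP _ _).1 ts.
have [N0 hN0] := @cone_stable s t K (2 * mdist (t 0) (s 0)) r
  (e - mdist (t r) (s1 r)) (ltW r0) ltac:(by rewrite subr_gt0) tK.
exists (Num.max N0 r) => N; rewrite ge_max => /andP[N0N rN] s' ms s'0 s'N.
have N00 := le_trans (ltW r0) rN.
have [t' [t'0 t'b]] := ms (t 0).
exists t'; split; last 1 first.
- have hv : on_segment (t 0) (t' N) (t' r) r.
    by rewrite -t'0; apply: ray_on_segment; rewrite (ltW r0).
  have h : mdist (s' N) (t' N) <= mdist (t 0) (t' N) - N + 2 * mdist (t 0) (s 0).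
    rewrite -{1}t'0 ray_mdist0// subrr add0r metric_sym -s'0; exact: t'b.
  have := hN0 N N0N _ _ _ s'N h hv.
  by have := metric_triangle (t' r) (t r) (s1 r); lra.
- by apply/ray_endP; exists (2 * mdist (t 0) (s' 0)) => u u0; exact: t'b.
- by rewrite t'0.
Qed.

End cone_topology.

(** * Measures on the Stone space of a set *)

Section stone_space.
Context (I : Type).

Definition stone : Type := {p : set_system I | UltraFilter p}.

Definition stone_pure (i : I) : stone :=
  exist _ (principal_filter i) (principal_filter_ultra i).

Lemma stone_ultra (p : stone) : UltraFilter (sval p).
Proof. exact: (svalP p). Qed.

End stone_space.

(** The point i0 only serves to make the type pointed. *)
Definition stone_at (I : Type) (i0 : I) : Type := stone I.

Section stone_algebra.
Context (I : Type) (i0 : I).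
Local Notation S := (stone_at i0).

HB.instance Definition _ := gen_eqMixin S.
HB.instance Definition _ := gen_choiceMixin S.
HB.instance Definition _ := isPointed.Build S (stone_pure i0).

Definition basic_clopen (A : set I) : set S := [set p | sval p A].

Lemma basic_clopenC A : basic_clopen (~` A) = ~` basic_clopen A.
Proof.
rewrite predeqE => p; have pU := stone_ultra p; split => [nA pA|nA].
  apply: (@filter_not_empty _ (sval p)); rewrite -(setICr A).
  exact: filterI.
by have [//|] := in_ultra_setVsetC A pU.
Qed.

Lemma basic_clopenI A B : basic_clopen (A `&` B) = basic_clopen A `&` basic_clopen B.
Proof.
rewrite predeqE => p; have pU := stone_ultra p; split => [pAB|[pA pB]].
  by split; apply: (filterS _ pAB) => i [].
exact: filterI.
Qed.

Lemma basic_clopenU A B : basic_clopen (A `|` B) = basic_clopen A `|` basic_clopen B.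
Proof. by rewrite -[A `|` B]setCK basic_clopenC setCU basic_clopenI !basic_clopenC -setCU setCK. Qed.

Lemma basic_clopen0 : basic_clopen set0 = set0.
Proof.
rewrite predeqE => p; split => // p0; have pU := stone_ultra p.
exact: (@filter_not_empty _ (sval p)).
Qed.

Lemma basic_clopenT : basic_clopen setT = setT.
Proof. by rewrite -setC0 basic_clopenC basic_clopen0 setC0. Qed.

Definition basic_clopens : set (set S) := range basic_clopen.

Lemma basic_clopens0 : basic_clopens set0.
Proof. by exists set0 => //; exact: basic_clopen0. Qed.

Lemma basic_clopensU : setU_closed basic_clopens.
Proof. by move=> _ _ [A _ <-] [B _ <-]; exists (A `|` B) => //; exact: basic_clopenU. Qed.

Lemma basic_clopensC : setC_closed basic_clopens.
Proof. by move=> _ [A _ <-]; exists (~` A) => //; exact: basic_clopenC. Qed.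

Lemma stone_display : measure_display. Proof. exact. Qed.

HB.instance Definition _ := @isAlgebraOfSets.Build stone_display S
  basic_clopens basic_clopens0 basic_clopensU basic_clopensC.

(** If no finite union of the B n covered A, the complements would generate a
    proper filter, and an ultrafilter containing it would be a point of the
    left-hand side outside the right-hand side. *)
Lemma basic_clopen_compact (A : set I) (B : nat -> set I) :
  basic_clopen A `<=` \bigcup_n basic_clopen (B n) ->
  exists n, A `<=` \big[setU/set0]_(k < n) B k.
Proof.
move=> AB; apply: contrapT => nfin.
have H n : (A `\` \big[setU/set0]_(k < n) B k) !=set0.
  apply: contrapT => /set0P/negP/negPn/eqP; rewrite setD_eq0 => h.
  by apply: nfin; exists n.
pose F : set_system I := filter_from setT (fun n => A `\` \big[setU/set0]_(k < n) B k).
have FF : ProperFilter F.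
  apply: filter_from_proper => [|n _]; last exact: H.
  apply: filter_from_filter; first by exists 0%N.
  move=> m n _ _; exists (maxn m n) => // i [Ai Bi]; split; split=> // h; apply: Bi.
    move: h; rewrite -!bigcup_mkord => -[k km Bk]; exists k => //=.
    by rewrite leq_max km.
  move: h; rewrite -!bigcup_mkord => -[k km Bk]; exists k => //=.
  by rewrite leq_max km orbT.
have [p [pU Fp]] := ultraFilterLemma FF.
have pA : basic_clopen A (exist _ p pU).
  by apply: Fp; exists 0%N => // i [].
have [n _ pB] := AB _ pA.
have : basic_clopen (~` B n) (exist _ p pU).
  apply: Fp; exists n.+1 => // i [_ h] Bi; apply: h.
  by rewrite -bigcup_mkord; exists n => /=.
by rewrite basic_clopenC; exact.
Qed.

Definition stone_trace (B : set S) : set I := [set i | B (stone_pure i)].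

Lemma stone_traceK A : stone_trace (basic_clopen A) = A.
Proof.
by rewrite predeqE => i; split=> [/principal_filterP|Ai]//; exact/principal_filterP.
Qed.

End stone_algebra.
Arguments basic_clopen {I} i0 A.

Record finadd (R : realType) (I : Type) := FinAdd {
  finadd_fun :> set I -> R ;
  finadd_ge0 : forall A, 0 <= finadd_fun A ;
  finaddU : forall A B, A `&` B = set0 ->
    finadd_fun (A `|` B) = finadd_fun A + finadd_fun B }.

Section finadd.
Context (R : realType) (I : Type) (m : finadd R I).

Lemma finadd0 : m set0 = 0.
Proof. by have := finaddU m (set0I (@set0 I)); rewrite setU0 => h; lra. Qed.

Lemma finaddD A B : m A = m (A `&` B) + m (A `\` B).
Proof.
rewrite -finaddU; first by rewrite setUIDK.
by rewrite setDE setIACA setICr setI0.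
Qed.

Lemma finadd_le A B : A `<=` B -> m A <= m B.
Proof.
move=> AB; rewrite (finaddD B A) setIidr// lerDl; exact: finadd_ge0.
Qed.

Lemma finadd_bigcup (B : nat -> set I) n :
  m (\big[setU/set0]_(k < n) B k) <= \sum_(k < n) m (B k).
Proof.
elim: n => [|n IH]; first by rewrite !big_ord0 finadd0.
rewrite !big_ord_recr/= (finaddD _ (\big[setU/set0]_(k < n) B k)).
apply: lerD; first by apply: le_trans IH; apply: finadd_le => x [].
by apply: finadd_le => x [[]].
Qed.

End finadd.

Section stone_measure.
Context (R : realType) (I : Type) (i0 : I) (m : finadd R I).
Local Notation S := (stone_at i0).

(** A finitely additive function on the subsets of I becomes a premeasure on
    the algebra of clopen sets: by compactness, a countable partition of a
    clopen set into clopen sets has finitely many nonempty pieces. *)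
Definition stone_content (B : set S) : \bar R := (m (stone_trace B))%:E.

Let stone_content_ge0 (B : set S) : (0 <= stone_content B)%E.
Proof. by rewrite lee_fin finadd_ge0. Qed.

Let stone_content_additive : measure_function.semi_additive stone_content.
Proof.
move=> F n _ tF _; rewrite /stone_content.
elim: n => [|n IH]; first by rewrite !big_ord0 finadd0.
rewrite !big_ord_recr/= -IH -EFinD -finaddU//.
rewrite predeqE => i; split=> // -[+ Fn]; rewrite /stone_trace/= -bigcup_mkord.
move=> [k /= kn Fk]; have kE : k = n by apply: tF => //; exists (stone_pure i).
by rewrite kE ltnn in kn.
Qed.

HB.instance Definition _ := isContent.Build _ S R stone_content
  stone_content_ge0 stone_content_additive.

Let stone_content_sigma : measurable_subset_sigma_subadditive stone_content.
Proof.
move=> A F mF [A' _ <-].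
have /choice[F' F'E] : forall n, exists A, F n = basic_clopen i0 A.
  by move=> n; have [B _ <-] := mF n; exists B.
move=> AF; have [n An] : exists n, A' `<=` \big[setU/set0]_(k < n) F' k.
  apply: (@basic_clopen_compact _ i0) => p /AF[k _ Fk]; exists k => //.
  by rewrite -F'E.
apply: (@le_trans _ _ (\sum_(0 <= k < n) stone_content (F k))%E); last first.
  by apply: nneseries_lim_ge => k _ _; exact: stone_content_ge0.
rewrite big_mkord (eq_bigr (fun k : 'I_n => (m (F' k))%:E)); last first.
  by move=> k _; rewrite F'E /stone_content stone_traceK.
rewrite sumEFin lee_fin stone_traceK.
by apply: le_trans (finadd_bigcup _ _ _); exact: finadd_le.
Qed.

HB.instance Definition _ := Content_SigmaSubAdditive_isMeasure.Build _ R S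
  stone_content stone_content_sigma.

Definition stone_borel := g_sigma_algebraType (@measurable _ S).
HB.instance Definition _ := Measurable.on stone_borel.

Definition stone_measure : set stone_borel -> \bar R :=
  measure_extension stone_content.
HB.instance Definition _ := Measure.on stone_measure.

Lemma measurable_clopen A : measurable (basic_clopen i0 A : set stone_borel).
Proof. by apply: sub_sigma_algebra; exists A. Qed.

Lemma stone_measure_clopen A : stone_measure (basic_clopen i0 A) = (m A)%:E.
Proof.
rewrite /stone_measure /measure_extension/= measurable_mu_extE; last by exists A.
by rewrite /= /stone_content stone_traceK.
Qed.

Lemma stone_measure_lty : (stone_measure setT < +oo)%E.
Proof. by rewrite -(basic_clopenT i0) stone_measure_clopen ltry. Qed.

Let stone_measure_fin : fin_num_fun stone_measure.
Proof.
move=> A mA; rewrite ge0_fin_numE//.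
apply: (@le_lt_trans _ _ (stone_measure setT)).
  by apply: le_measure; rewrite ?inE.
exact: stone_measure_lty.
Qed.

HB.instance Definition _ := @Measure_isFinite.Build _ _ _ stone_measure
  stone_measure_fin.

End stone_measure.
Arguments stone_measure {R I} i0 m.

Section stone_functions.
Context (R : realType) (I : Type) (i0 : I).
Local Notation S := (stone_borel i0).

Lemma stone_measure_unique (m1 m2 : {measure set S -> \bar R}) :
  (m1 setT < +oo)%E ->
  (forall A, m1 (basic_clopen i0 A) = m2 (basic_clopen i0 A)) ->
  forall E, measurable E -> m1 E = m2 E.
Proof.
move=> m1T m12 E mE.
apply: (@measure_unique _ R S (@measurable _ (stone_at i0)) (fun=> setT) _ _ _ _ m1 m2) => //.
- by move=> _ _ [A _ <-] [B _ <-]; rewrite -basic_clopenI; exists (A `&` B).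
- by rewrite bigcup_const.
- by move=> _ [A _ <-].
Qed.

Definition stone_ext (F : I -> R) (p : S) : R := lim (F @ sval p).

Lemma stone_ext_cvg (F : I -> R) (K : R) : (forall i, `|F i| <= K) ->
  forall p : S, F @ sval p --> stone_ext F p.
Proof.
move=> FK p; have pU := stone_ultra p.
have [l Fl] : exists l : R, F @ sval p --> l.
  have cK := @segment_compact R (- K) K.
  apply: (ultra_cvg_compact pU cK).
  by apply: nearW => i /=; rewrite in_itv/= -ler_norml.
by rewrite /stone_ext (cvg_lim _ Fl).
Qed.

Lemma stone_ext_bounds (F : I -> R) (K a b : R) (A : set I) (p : S) :
  (forall i, `|F i| <= K) -> (forall i, A i -> a <= F i <= b) ->
  basic_clopen i0 A p -> a <= stone_ext F p <= b.
Proof.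
move=> FK Fab pA; have Fc := @stone_ext_cvg _ _ FK p; have pU := stone_ultra p.
apply/andP; split.
  apply: (cvgr_to_ge Fc).
  by apply: filterS pA => i /Fab/andP[].
apply: (cvgr_to_le Fc).
by apply: filterS pA => i /Fab/andP[].
Qed.

Lemma stone_ext_measurable (F : I -> R) (K : R) :
  (forall i, `|F i| <= K) -> measurable_fun setT (stone_ext F).
Proof.
move=> FK; apply: (measurability (@RGenOInfty.G R)).
  exact: RGenOInfty.measurableE.
move=> _ [_ [a ->] <-]; rewrite setTI.
suff -> : stone_ext F @^-1` `]a, +oo[ =
    \bigcup_n basic_clopen i0 [set i | a + n.+1%:R^-1 <= F i].
  by apply: bigcup_measurable => n _; exact: measurable_clopen.
rewrite predeqE => p; split=> /= [|[n _]].
  rewrite in_itv/= andbT => ap.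
  have pU := stone_ultra p; have e0 : 0 < (stone_ext F p - a) / 2.
    by rewrite divr_gt0// subr_gt0.
  have [n /ltW nle] : exists n, n.+1%:R^-1 < (stone_ext F p - a) / 2.
    by have [n _ /(_ _ (leqnn n))] := near_infty_natSinv_lt (PosNum e0); exists n.
  exists n => //; have /cvgrPdist_le/(_ _ e0) := @stone_ext_cvg _ _ FK p.
  by apply: filterS => i /=; rewrite ler_norml => /andP[h1 h2]; move: nle; move: (n.+1%:R^-1 : R) => z; lra.
move=> pn; rewrite in_itv/= andbT.
have Fab i : [set i | a + n.+1%:R^-1 <= F i] i -> a + n.+1%:R^-1 <= F i <= K.
  by move=> /= ->; rewrite (le_trans (ler_norm _) (FK i)).
have /andP[+ _] := stone_ext_bounds FK Fab pn.
by apply: lt_le_trans; rewrite ltrDl.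
Qed.

End stone_functions.

(** * Densities and images of measures on the Stone space *)

Section weighted_measure.
Local Open Scope ereal_scope.
Context d (T : measurableType d) (R : realType).
Variables (mu : {measure set T -> \bar R}) (f : T -> \bar R).
Hypotheses (f0 : forall x, 0 <= f x) (mf : measurable_fun setT f).

Definition weighted (A : set T) : \bar R := \int[mu]_(x in A) f x.

Let weighted0 : weighted set0 = 0.
Proof. by rewrite /weighted integral_set0. Qed.

Let weighted_ge0 A : 0 <= weighted A.
Proof. by apply: integral_ge0 => x _; exact: f0. Qed.

Let weighted_sigma_additive : semi_sigma_additive weighted.
Proof.
move=> F mF tF mUF; rewrite /weighted ge0_integral_bigcup//; last first.
  exact: measurable_funTS.
by apply: is_cvg_nneseries => n _ _; exact: weighted_ge0.
Qed.

HB.instance Definition _ := isMeasure.Build _ _ _ weighted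
  weighted0 weighted_ge0 weighted_sigma_additive.

Definition weighted_measure : {measure set T -> \bar R} := weighted.

End weighted_measure.

Section pushforward.
Context d d' (T : measurableType d) (T' : measurableType d') (R : realType).
Variables (mu : {finite_measure set T -> \bar R}) (f : T -> T').
Hypothesis mf : measurable_fun setT f.

Definition push_measure : {measure set T' -> \bar R} :=
  measure_function_pushforward__canonical__measure_function_Measure mu mf.

Let push_fin : fin_num_fun push_measure.
Proof.
move=> A mA; apply: fin_num_measure.
by rewrite -[X in measurable X]setTI; exact: mf.
Qed.

Definition push_fun (A : set T') : \bar R := pushforward mu f A.
HB.instance Definition _ := isMeasure.Build _ _ _ push_fun
  (measure0 push_measure) (measure_ge0 push_measure)
  (@measure_semi_sigma_additive _ _ _ push_measure).
HB.instance Definition _ := @Measure_isFinite.Build _ _ _ push_fun push_fin.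

Definition push_finite_measure : {finite_measure set T' -> \bar R} := push_fun.

End pushforward.

Section integral_monotone_in_measure.
Import HBNNSimple.
Local Open Scope ereal_scope.
Context d (T : measurableType d) (R : realType).

(** Approximating from below by simple functions moves the inequality from sets
    to integrals. *)
Lemma integral_le_measure (m1 m2 : {measure set T -> \bar R}) (C : R)
    (f : T -> \bar R) :
  (0 <= C)%R -> (forall E, measurable E -> m1 E <= C%:E * m2 E) ->
  measurable_fun setT f -> (forall x, 0 <= f x) ->
  \int[m1]_x f x <= C%:E * \int[m2]_x f x.
Proof.
move=> C0 m12 mf f0.
rewrite -(@ge0_integral_mscale _ _ _ m2 _ measurableT (NngNum C0))//.
rewrite !ge0_integralTE//; apply: ge_ereal_sup => _ [h hf <-].
apply: le_trans; last by apply: ereal_sup_ubound; exists h; [exact: hf|reflexivity].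
rewrite !sintegralE; apply: lee_fsum => [|r [x _ <-]]; first exact: fimfunP.
by apply: lee_wpmul2l; [rewrite lee_fin|exact: m12].
Qed.

End integral_monotone_in_measure.

Section finadd_strips.
Context (R : realType) (I : Type).

(** The hypotheses say that l1 and l2 both have density F with respect to m.
    Cutting a set into strips on which F varies by at most e shows that they
    differ by at most e * m. *)
Lemma finadd_density_unique (m l1 l2 : finadd R I) (F : I -> R) (K : R) :
  (forall i, 0 <= F i <= K) ->
  (forall A a b, 0 <= a -> (forall i, A i -> a <= F i <= b) ->
     a * m A <= l1 A <= b * m A) ->
  (forall A a b, 0 <= a -> (forall i, A i -> a <= F i <= b) ->
     a * m A <= l2 A <= b * m A) ->
  forall A, l1 A = l2 A.
Proof.
move=> FK H1 H2 A.
have key (e : R) (k : nat) : 0 < e -> forall B, (forall i, B i -> F i < k%:R * e) ->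
    `|l1 B - l2 B| <= e * m B.
  move=> e0; elim: k => [|k IH] B hB.
    have -> : B = set0.
      rewrite predeqE => i; split=> // /hB; rewrite mul0r ltNge.
      by have /andP[->] := FK i.
    by rewrite !finadd0 subrr normr0 mulr0.
  rewrite (finaddD l1 B [set i | F i < k%:R * e]) (finaddD l2 B [set i | F i < k%:R * e]).
  rewrite (finaddD m B [set i | F i < k%:R * e]).
  have := IH (B `&` [set i | F i < k%:R * e]) ltac:(by move=> i []).
  have ke0 : 0 <= k%:R * e by rewrite mulr_ge0// ltW.
  have st : forall i, (B `\` [set i | F i < k%:R * e]) i -> k%:R * e <= F i <= k.+1%:R * e.
    by move=> i [/hB/ltW-> /negP/=]; rewrite -leNgt => ->.
  have /andP[a1 a2] := H1 _ _ _ ke0 st; have /andP[b1 b2] := H2 _ _ _ ke0 st.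
  move: a1 a2 b1 b2; set B1 := B `&` _; set B2 := B `\` _.
  rewrite -natr1 !mulrDl mul1r => a1 a2 b1 b2.
  rewrite !ler_norml => /andP[c1 c2]; apply/andP; split; lra.
apply/eqP; rewrite -subr_eq0 -normr_le0; apply/ler_addgt0Pl => e e0.
have M0 := finadd_ge0 m A.
have e1 : 0 < e / (m A + 1) by rewrite divr_gt0//; lra.
pose k := (Num.truncn (K / (e / (m A + 1)))).+1.
apply: le_trans (key _ k e1 A _) _; last first.
  rewrite addr0 mulrAC ler_pdivrMr; last by lra.
  by rewrite ler_pM2l//; lra.
move=> i _; apply: le_lt_trans (_ : K < _); first by case/andP: (FK i).
rewrite -ltr_pdivrMr//.
by rewrite truncnS_gt.
Qed.

End finadd_strips.

Section stone_density.
Context (R : realType) (I : Type) (i0 : I).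
Local Notation S := (stone_borel i0).

Lemma stone_ext_emeasurable (F : I -> R) (K : R) : (forall i, 0 <= F i <= K) ->
  measurable_fun setT (fun p : S => (stone_ext F p)%:E).
Proof.
move=> FK; apply/measurable_EFinP; apply: (@stone_ext_measurable _ _ _ _ K) => i.
by case/andP: (FK i) => F0 ?; rewrite ger0_norm.
Qed.

Lemma stone_ext_ge0 (F : I -> R) (K : R) (p : S) : (forall i, 0 <= F i <= K) ->
  0 <= stone_ext F p <= K.
Proof.
move=> FK; have FK' i : `|F i| <= K.
  by case/andP: (FK i) => F0 ?; rewrite ger0_norm.
by apply: (@stone_ext_bounds _ _ _ F K 0 K setT p FK') => //; rewrite basic_clopenT.
Qed.

(** A density between finitely additive functions extends to the measures on
    the Stone space, where it becomes the continuous extension of F: the measure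
    defined by the integral satisfies the same strip inequalities on clopen
    sets, and clopen sets determine a finite measure. *)
Lemma stone_density (m m' : finadd R I) (F : I -> R) (K : R) :
  (forall i, 0 <= F i <= K) ->
  (forall A a b, 0 <= a -> (forall i, A i -> a <= F i <= b) ->
     a * m A <= m' A <= b * m A) ->
  forall E, measurable E ->
    stone_measure i0 m' E = (\int[stone_measure i0 m]_(p in E) (stone_ext F p)%:E)%E.
Proof.
move=> FK H.
have FK' i : `|F i| <= K.
  by case/andP: (FK i) => F0 ?; rewrite ger0_norm.
have mF := stone_ext_emeasurable FK.
have F0 (p : S) : (0 <= (stone_ext F p)%:E)%E.
  by rewrite lee_fin; case/andP: (stone_ext_ge0 p FK).
pose nu := weighted_measure (stone_measure i0 m) F0 mF.
have bnd A a b : 0 <= a -> (forall i, A i -> a <= F i <= b) ->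
    ((a * m A)%:E <= nu (basic_clopen i0 A) <= (b * m A)%:E)%E.
  move=> a0 Fab; have mA : measurable (basic_clopen i0 A : set S) by exact: measurable_clopen.
  have cst (c : R) : ((c * m A)%:E = \int[stone_measure i0 m]_(p in basic_clopen i0 A) cst c%:E p)%E.
    by rewrite integral_cst//= stone_measure_clopen -EFinM.
  have [A0|/set0P[i Ai]] := eqVneq A set0.
    by rewrite A0 basic_clopen0 measure0 finadd0 !mulr0 lexx.
  have b0 : 0 <= b by have /andP[h1 h2] := Fab i Ai; rewrite (le_trans a0)// (le_trans h1).
  apply/andP; split; rewrite cst; apply: ge0_le_integral => //=.
  - exact: measurable_funTS.
  - by move=> p pA; rewrite lee_fin; case/andP: (stone_ext_bounds FK' Fab pA).
  - exact: measurable_funTS.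
  - by move=> p pA; rewrite lee_fin; case/andP: (stone_ext_bounds FK' Fab pA).
have fin A : (nu (basic_clopen i0 A) \is a fin_num).
  have /andP[_ h] := bnd A 0 K (lexx _) (fun i _ => FK i).
  by rewrite ge0_fin_numE//; apply: le_lt_trans h _; exact: ltry.
pose l (A : set I) := fine (nu (basic_clopen i0 A)).
have l0 A : 0 <= l A by rewrite fine_ge0.
have lU A B : A `&` B = set0 -> l (A `|` B) = l A + l B.
  move=> AB; rewrite /l -(fineD (fin A) (fin B)) basic_clopenU; congr fine.
  apply: measureU; [exact: measurable_clopen|exact: measurable_clopen|].
  by rewrite -basic_clopenI AB basic_clopen0.
have lE := @finadd_density_unique R I m m' (FinAdd l0 lU) F K FK H.
have m'l : forall A, m' A = l A.
  apply: lE => A a b a0 /(bnd _ _ _ a0) /=.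
  by rewrite -(fineK (fin A)) !lee_fin.
move=> E mE.
apply: (@stone_measure_unique _ _ _ (stone_measure i0 m') nu) => //.
  exact: stone_measure_lty.
move=> A; rewrite -[RHS](fineK (fin A)) -/(l A) -m'l; exact: stone_measure_clopen.
Qed.

Definition stone_map_fun (f : I -> I) (p : stone I) : stone I :=
  exist _ (f @ sval p) (@ultra_fmap _ _ f (sval p) (stone_ultra p)).

Definition stone_map (f : I -> I) : S -> S := stone_map_fun f.

Lemma stone_map_clopen f A : stone_map f @^-1` basic_clopen i0 A = basic_clopen i0 (f @^-1` A).
Proof. by []. Qed.

Lemma stone_map_measurable f : measurable_fun setT (stone_map f).
Proof.
apply: (@measurability _ _ S S setT (stone_map f) (@measurable _ (stone_at i0))) => //.
move=> _ [_ [A _ <-] <-]; rewrite setTI stone_map_clopen.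
exact: measurable_clopen.
Qed.

Lemma stone_measure_map (m m' : finadd R I) f :
  (forall A, m' A = m (f @^-1` A)) -> forall E, measurable E ->
  stone_measure i0 m' E = stone_measure i0 m (stone_map f @^-1` E).
Proof.
move=> mm' E mE.
apply: (@stone_measure_unique _ _ _ (stone_measure i0 m')
  (push_measure (stone_measure i0 m) (stone_map_measurable f))) => //.
  exact: stone_measure_lty.
move=> A; transitivity ((m' A)%:E); first exact: stone_measure_clopen.
by rewrite mm'; apply/esym; exact: stone_measure_clopen.
Qed.

End stone_density.

(** * Patterson's construction along an ultrafilter *)

Section real_sums.
Context (R : realType) (T : choiceType).
Implicit Types (A B : set T) (u v : T -> R).

Definition rsum A u : R := fine (\esum_(i in A) (u i)%:E).

Definition rsummable A u := (\esum_(i in A) (u i)%:E < +oo)%E.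

Lemma rsumE A u : (forall i, 0 <= u i) -> rsummable A u ->
  (rsum A u)%:E = \esum_(i in A) (u i)%:E.
Proof.
move=> u0 h; rewrite fineK// ge0_fin_numE//.
by apply: esum_ge0 => i _; rewrite lee_fin.
Qed.

Lemma rsum_ge0 A u : (forall i, 0 <= u i) -> 0 <= rsum A u.
Proof. by move=> u0; apply/fine_ge0/esum_ge0 => i _; rewrite lee_fin. Qed.

Lemma le_esum_subset A B u : (forall i, 0 <= u i) -> A `<=` B ->
  (\esum_(i in A) (u i)%:E <= \esum_(i in B) (u i)%:E)%E.
Proof.
move=> u0 AB; rewrite [leRHS](esumID A B); last by move=> i _; rewrite lee_fin.
rewrite (setIidr AB) leeDl//.
by apply: esum_ge0 => i _; rewrite lee_fin.
Qed.

Lemma rsummableS A B u : (forall i, 0 <= u i) -> A `<=` B ->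
  rsummable B u -> rsummable A u.
Proof. by move=> u0 AB; apply: le_lt_trans; exact: le_esum_subset. Qed.

Lemma rsum_scale A u v (c : R) : 0 <= c -> (forall i, 0 <= u i) ->
  (forall i, 0 <= v i) -> (forall i, A i -> v i <= c * u i) ->
  rsummable A u -> rsummable A v /\ rsum A v <= c * rsum A u.
Proof.
move=> c0 u0 v0 vu su.
have h : (\esum_(i in A) (v i)%:E <= (c * rsum A u)%:E)%E.
  apply: ge_ereal_sup => _ [X [finX XA] <-].
  apply: (@le_trans _ _ (\sum_(i \in X) (c * u i)%:E)%E).
    by apply: lee_fsum => // i /XA Ai; rewrite lee_fin vu.
  rewrite fsumEFin// -mulr_fsumr lee_fin ler_wpM2l//.
  rewrite -lee_fin -fsumEFin// rsumE//.
  by apply: esum_ge; exists X.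
split; first by apply: le_lt_trans h _; exact: ltry.
rewrite -lee_fin rsumE//; apply: le_lt_trans h _; exact: ltry.
Qed.

Lemma rsumU A B u : (forall i, 0 <= u i) -> A `&` B = set0 ->
  rsummable (A `|` B) u -> rsum (A `|` B) u = rsum A u + rsum B u.
Proof.
move=> u0 AB s; apply: EFin_inj.
have sA : rsummable A u by apply: rsummableS s => // i; left.
have sB : rsummable B u by apply: rsummableS s => // i; right.
rewrite EFinD !rsumE// (esumID A (A `|` B)); last by move=> i _; rewrite lee_fin.
congr (_ + _)%E; first by rewrite setUK.
congr (esum _ _); rewrite setIUl setICr set0U -setDE.
by apply/seteqP; split=> [i []//|i Bi]; split=> // Ai; have : set0 i by rewrite -AB.
Qed.

Lemma rsum_ge_finite A X u : (forall i, 0 <= u i) -> rsummable A u ->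
  finite_set X -> X `<=` A -> \sum_(i \in X) u i <= rsum A u.
Proof.
move=> u0 s finX XA; rewrite -lee_fin rsumE// -fsumEFin//.
by apply: esum_ge; exists X.
Qed.

Lemma rsummable_finite A u : finite_set A -> (forall i, 0 <= u i) -> rsummable A u.
Proof.
move=> finA u0; rewrite /rsummable esum_fset//; last by move=> i _; rewrite lee_fin.
by rewrite fsumEFin// ltry.
Qed.

End real_sums.

(** The data are a set G on which D measures displacement, and potentials P x
    that exceed D by b at the base point o. By conv and dive the series of D has
    critical exponent delta, and this divergence is already caused by elements
    for which b is small relative to D. *)
Section patterson.
Context (R : realType) (Gam : choiceType) (G : set Gam) (X : Type) (o : X).
Variables (P : X -> Gam -> R) (D b : Gam -> R) (C : X -> R) (delta : R).
Hypotheses (delta0 : 0 < delta) (D0 : forall g, 0 <= D g).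
Hypothesis b01 : forall g, 0 <= b g.
Hypothesis PoE : forall g, P o g = D g + b g.
Hypothesis PC : forall x g, `|P x g - P o g| <= C x.
Hypothesis conv : forall s, delta < s ->
  rsummable G (fun g => expR (- (s * D g))).
Hypothesis dive : forall s eta : R, 0 <= s < delta -> 0 < eta ->
  \esum_(g in [set g | G g /\ b g <= eta * D g]) (expR (- (s * D g)))%:E = +oo%E.

Definition step (k : nat) : R := delta / k.+2%:R.

(** The exponent delta * t is lowered by step k * t up to time T, so that the
    total mass can be made large, and its slope is raised by the same amount
    after T, so that this mass is finite. As the slope stays within step k of
    delta, ratios of weights tend to those of exp (- delta t) when k grows. This
    replaces the slowly varying factor by which Patterson makes a Dirichlet
    series diverge at its critical exponent. *)
Definition tent (k : nat) (T t : R) : R :=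
  expR (- (delta * t) + step k * Num.min t (2 * T - t)).

Lemma step_gt0 k : 0 < step k. Proof. by rewrite divr_gt0. Qed.

Lemma step_lt k : step k < delta.
Proof. by rewrite ltr_pdivrMr// ltr_pMr// ltr1n. Qed.

Lemma tent_le k T t : tent k T t <= expR (2 * T * step k) * expR (- ((delta + step k) * t)).
Proof.
rewrite -expRD ler_expR; have e0 := step_gt0 k.
have : step k * Num.min t (2 * T - t) <= step k * (2 * T - t).
  by rewrite ler_pM2l// ge_min lexx orbT.
by lra.
Qed.

Lemma tent_le2 k T t : tent k T t <= expR (- ((delta - step k) * t)).
Proof.
rewrite ler_expR; have e0 := step_gt0 k.
have : step k * Num.min t (2 * T - t) <= step k * t.
  by rewrite ler_pM2l// ge_min lexx.
by lra.
Qed.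

Lemma tent_early k T t : t <= T -> tent k T t = expR (- ((delta - step k) * t)).
Proof.
move=> tT; rewrite /tent; congr expR.
have -> : Num.min t (2 * T - t) = t by apply/min_idPl; lra.
by ring.
Qed.

Lemma tent_ratio k T t t' (c : R) : `|t' - t| <= c ->
  expR (- (delta * (t' - t)) - step k * c) * tent k T t <= tent k T t' <=
  expR (- (delta * (t' - t)) + step k * c) * tent k T t.
Proof.
rewrite ler_norml => /andP[h1 h2]; rewrite /tent -!expRD !ler_expR.
have e0 := step_gt0 k.
have : step k * (Num.min t (2 * T - t) - c) <= step k * Num.min t' (2 * T - t').
  rewrite ler_pM2l// le_min; apply/andP; split.
    by rewrite lerBlDr ge_min; apply/orP; left; lra.
  by rewrite lerBlDr ge_min; apply/orP; right; lra.
have : step k * (Num.min t' (2 * T - t') - c) <= step k * Num.min t (2 * T - t).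
  rewrite ler_pM2l// le_min; apply/andP; split.
    by rewrite lerBlDr ge_min; apply/orP; left; lra.
  by rewrite lerBlDr ge_min; apply/orP; right; lra.
by lra.
Qed.

Lemma Po_ge g : D g <= P o g. Proof. by rewrite PoE lerDl. Qed.

Lemma tent_summable k T : rsummable G (fun g => tent k T (P o g)).
Proof.
have e0 := step_gt0 k.
have ds : delta < delta + step k by rewrite ltrDl.
have [] := @rsum_scale _ _ G (fun g => expR (- ((delta + step k) * D g)))
  (fun g => tent k T (P o g)) (expR (2 * T * step k)) => //.
- by move=> g; exact: expR_ge0.
- move=> g _; apply: le_trans (tent_le k T _) _.
  rewrite ler_pM2l ?expR_gt0// ler_expR lerN2 ler_pM2l ?Po_ge//.
  by rewrite addr_gt0.
- exact: conv.
Qed.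

(** On the elements with b <= eta D the potential is at most (1 + eta) D, which
    for the chosen eta makes the slope delta - step k count as an exponent
    s < delta for D; a finite part of the divergent series lies below some T. *)
Lemma tent_mass k : exists T, k%:R <= rsum G (fun g => tent k T (P o g)).
Proof.
have e0 := step_gt0 k; have e1 := step_lt k.
pose eta := step k / delta; have eta0 : 0 < eta by rewrite divr_gt0.
pose s := (delta - step k) * (1 + eta).
have eE : eta * delta = step k by rewrite /eta mulfVK// gt_eqF.
have s1 : 0 <= s < delta.
  rewrite /s -eE; apply/andP; split.
    have : 0 <= delta - eta * delta by rewrite eE; lra.
    by move=> h; rewrite mulr_ge0//; lra.
  have -> : (delta - eta * delta) * (1 + eta) = delta - delta * eta ^+ 2 by ring.
  by rewrite ltrBlDr ltrDl mulr_gt0// exprn_gt0.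
have := dive s1 eta0; set A := [set g | _] => dA.
have : ((k%:R)%:E < \esum_(g in A) (expR (- (s * D g)))%:E)%E by rewrite dA ltry.
move=> /ereal_sup_gt[_ [F [finF FA] <-]]; rewrite fsumEFin// lte_fin => kF.
have [T TF] : exists T, forall g, F g -> P o g <= T.
  have /finite_seqP[r rE] := finF.
  exists (\sum_(g <- r) `|P o g|) => g; rewrite rE => gr.
  apply: le_trans (ler_norm _) _; rewrite (big_rem g)//= lerDl.
  by apply: sumr_ge0 => h _; exact: normr_ge0.
exists T; apply: (@le_trans _ _ (\sum_(i \in F) tent k T (P o i))).
  apply: le_trans (ltW kF) _.
  rewrite -lee_fin -!fsumEFin//; apply: lee_fsum => // g Fg.
  rewrite lee_fin tent_early ?TF// ler_expR lerN2 /s.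
  have [_ bg] := FA _ Fg.
  rewrite -mulrA ler_wpM2l ?subr_ge0 ?(ltW e1)//.
  by rewrite PoE mulrDl mul1r lerD2l.
apply: rsum_ge_finite => //.
- by move=> g; exact: expR_ge0.
- exact: tent_summable.
- by move=> g /FA[].
Qed.

Definition cut k : R := sval (cid (tent_mass k)).
Definition mass k : R := rsum G (fun g => tent k (cut k) (P o g)).

Lemma mass_ge k : k%:R <= mass k.
Proof. by rewrite /mass /cut; case: cid. Qed.

Definition weight k x (A : set Gam) : R :=
  rsum (A `&` G) (fun g => tent k (cut k) (P x g)) / mass k.

Let tent0 k T t : 0 <= tent k T t. Proof. exact: expR_ge0. Qed.

Lemma mass_ge0 k : 0 <= mass k.
Proof. exact: le_trans (ler0n _ _) (mass_ge k). Qed.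

Lemma weight_strip k x A (a c : R) : 0 <= a ->
  (forall g, A g -> a <= expR (- (delta * (P x g - P o g))) <= c) ->
  rsummable (A `&` G) (fun g => tent k (cut k) (P x g)) /\
  expR (- (step k * C x)) * a * weight k o A <= weight k x A <=
  expR (step k * C x) * c * weight k o A.
Proof.
move=> a0 H.
have [->|/set0P[g0 Ag0]] := eqVneq A set0.
  rewrite /weight set0I /rsum !esum_set0 /= !mul0r !mulr0 lexx; split=> //.
  by rewrite /rsummable esum_set0 ltry.
have c0 : 0 <= c by have /andP[h1 h2] := H g0 Ag0; rewrite (le_trans a0)// (le_trans h1).
have s0 : rsummable (A `&` G) (fun g => tent k (cut k) (P o g)).
  by apply: (rsummableS _ _ (tent_summable k (cut k))) => // g [].
have ub g : (A `&` G) g -> tent k (cut k) (P x g) <=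
    (expR (step k * C x) * c) * tent k (cut k) (P o g).
  move=> [Ag _]; have /andP[_ h] := tent_ratio k (cut k) (PC x g).
  apply: le_trans h _; rewrite ler_wpM2r// addrC expRD ler_pM2l ?expR_gt0//.
  by case/andP: (H g Ag).
have [s1 u1] := @rsum_scale _ _ _ _ _ _ (mulr_ge0 (expR_ge0 _) c0) (fun=> tent0 _ _ _) (fun=> tent0 _ _ _) ub s0.
split=> //.
have lb g : (A `&` G) g -> (expR (- (step k * C x)) * a) * tent k (cut k) (P o g) <=
    1 * tent k (cut k) (P x g).
  move=> [Ag _]; have /andP[h _] := tent_ratio k (cut k) (PC x g).
  rewrite mul1r; apply: le_trans h; rewrite ler_wpM2r// addrC expRD ler_pM2l ?expR_gt0//.
  by case/andP: (H g Ag).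
have ea0 : 0 <= expR (- (step k * C x)) * a by rewrite mulr_ge0// expR_ge0.
have M0 : 0 <= (mass k)^-1 by rewrite invr_ge0 mass_ge0.
have l3 : (expR (- (step k * C x)) * a) * rsum (A `&` G) (fun g => tent k (cut k) (P o g)) <=
   rsum (A `&` G) (fun g => tent k (cut k) (P x g)).
  have [ea|ne0] := eqVneq (expR (- (step k * C x)) * a) 0.
    by rewrite ea mul0r rsum_ge0.
  have pos : 0 < expR (- (step k * C x)) * a by rewrite lt_neqAle eq_sym ne0.
  rewrite mulrC -ler_pdivlMr// [leRHS]mulrC.
  have lb' g : (A `&` G) g -> tent k (cut k) (P o g) <=
      (expR (- (step k * C x)) * a)^-1 * tent k (cut k) (P x g).
    by move=> /lb; rewrite mul1r mulrC -ler_pdivlMr// [leRHS]mulrC.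
  have ei : 0 <= (expR (- (step k * C x)) * a)^-1 by rewrite invr_ge0.
  by have [] := @rsum_scale _ _ _ _ _ _ ei (fun=> tent0 _ _ _) (fun=> tent0 _ _ _) lb' s1.
by rewrite /weight !mulrA !ler_wpM2r.
Qed.

Let infinite_filter : ProperFilter (\oo : set_system nat) := eventually_filter.

(** Limits along a nonprincipal ultrafilter exist for all sets A at once, so
    the limit is a finitely additive function of A. *)
Definition generic_filter : set_system nat :=
  sval (cid (ultraFilterLemma infinite_filter)).

Lemma generic_ultra : UltraFilter generic_filter.
Proof. by rewrite /generic_filter; case: cid => ? []. Qed.

Lemma generic_infinity : \oo `<=` generic_filter.
Proof. by rewrite /generic_filter; case: cid => ? []. Qed.

Lemma weight_bounds k x A : 0 <= weight k x A <= expR (2 * delta * `|C x|).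
Proof.
have e0 := step_gt0 k; have e1 := step_lt k; have M0 := mass_ge0 k.
apply/andP; split; first by rewrite divr_ge0// rsum_ge0.
have Cx g : P x g - P o g >= - `|C x|.
  by have := PC x g; rewrite ler_norml => /andP[h _]; have := ler_norm (C x); lra.
have [_ /andP[_ h]] := @weight_strip k x A 0 (expR (delta * `|C x|)) (lexx _)
  ltac:(by move=> g _; rewrite expR_ge0/= ler_expR -mulrN ler_pM2l//; have := Cx g; lra).
apply: le_trans h _; rewrite -expRD.
have w1 : weight k o A <= 1.
  have [m0|m0] := eqVneq (mass k) 0; first by rewrite /weight m0 invr0 mulr0.
  rewrite ler_pdivrMr ?mul1r; last by rewrite lt_neqAle eq_sym m0.
  have [] := @rsum_scale _ _ (A `&` G) (fun g => tent k (cut k) (P o g))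
      (fun g => tent k (cut k) (P o g)) 1 => //.
  - by move=> g _; rewrite mul1r.
  - by apply: (rsummableS _ _ (tent_summable k (cut k))) => // g [].
  move=> s _; rewrite -lee_fin !rsumE//; last exact: tent_summable.
  by apply: le_esum_subset => // g [].
apply: (@le_trans _ _ (expR (step k * C x + delta * `|C x|))).
  by rewrite ler_piMr// expR_ge0.
rewrite ler_expR.
have : step k * C x <= delta * `|C x|.
  by apply: le_trans (ler_norm _) _; rewrite normrM gtr0_norm// ler_wpM2r// ltW.
by lra.
Qed.

Definition limit_weight x A : R := lim (weight ^~ x ^~ A @ generic_filter).

Lemma limit_weight_cvg x A : (fun k => weight k x A) @ generic_filter --> limit_weight x A.
Proof.
have U := generic_ultra.
have [l wl] : exists l : R, (fun k => weight k x A) @ generic_filter --> l.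
  apply: (ultra_cvg_compact U (@segment_compact R 0 (expR (2 * delta * `|C x|)))).
  by apply: nearW => k /=; rewrite in_itv/=; exact: weight_bounds.
by rewrite /limit_weight (cvg_lim _ wl).
Qed.
Arguments limit_weight_cvg x A : clear implicits.

Lemma generic_near (Q : nat -> Prop) :
  (\forall k \near \oo, Q k) -> \forall k \near generic_filter, Q k.
Proof. exact: generic_infinity. Qed.

Lemma limit_weight_ge0 x A : 0 <= limit_weight x A.
Proof.
have U := generic_ultra; apply: (cvgr_to_ge (limit_weight_cvg x A)).
by apply: nearW => k; case/andP: (weight_bounds k x A).
Qed.

Lemma weight_summable k x A : rsummable (A `&` G) (fun g => tent k (cut k) (P x g)).
Proof.
have [] // := @weight_strip k x A 0 (expR (delta * `|C x|)) (lexx _).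
move=> g _; rewrite expR_ge0/= ler_expR -mulrN ler_pM2l//.
have := PC x g; rewrite ler_norml => /andP[h _]; have := ler_norm (C x); lra.
Qed.

Lemma limit_weightU x A B : A `&` B = set0 ->
  limit_weight x (A `|` B) = limit_weight x A + limit_weight x B.
Proof.
move=> AB; have U := generic_ultra.
have h := cvgD (limit_weight_cvg x A) (limit_weight_cvg x B).
apply/(cvg_unique _ (limit_weight_cvg x (A `|` B))) => //.
have -> : (weight ^~ x ^~ (A `|` B)) = (weight ^~ x ^~ A) \+ (weight ^~ x ^~ B).
  apply/funext => k /=; rewrite /weight setIUl rsumU ?mulrDl//.
    by rewrite setIACA AB set0I.
  by rewrite -setIUl; exact: weight_summable.
exact: h.
Qed.

Definition limit_finadd x : finadd R Gam :=
  FinAdd (limit_weight_ge0 x) (@limit_weightU x).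

Lemma expR_step_cvg (c : R) : (fun k => expR (step k * c)) @ generic_filter --> (1 : R).
Proof.
have U := generic_ultra.
have h : (fun k => step k * c) @ generic_filter --> (0 : R).
  apply: (@cvg_trans _ ((fun k => step k * c) @ \oo)).
    by move=> Q; exact: generic_near.
  have -> : (0 : R) = delta * 0 * c by rewrite mulr0 mul0r.
  apply: cvgMl; apply: cvgMr.
  by rewrite (cvg_shiftS (@harmonic R)); exact: cvg_harmonic.
rewrite -expR0; apply: (cvg_comp _ _ h); exact: continuous_expR.
Qed.

Lemma limit_strip x A (a c : R) : 0 <= a ->
  (forall g, A g -> a <= expR (- (delta * (P x g - P o g))) <= c) ->
  a * limit_weight o A <= limit_weight x A <= c * limit_weight o A.
Proof.
move=> a0 H; have U := generic_ultra.
have co := limit_weight_cvg o A; have cx := limit_weight_cvg x A.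
apply/andP; split.
  have h : (fun k => expR (step k * - C x) * a * weight k o A) @ generic_filter --> a * limit_weight o A.
    have {2}-> : a = 1 * a by rewrite mul1r.
    apply: cvgM co; apply: cvgMl; exact: expR_step_cvg.
  apply: (ler_cvg_to h cx); apply: nearW => k.
  by have [_ /andP[+ _]] := weight_strip k a0 H; rewrite mulrN.
have h : (fun k => expR (step k * C x) * c * weight k o A) @ generic_filter --> c * limit_weight o A.
  have {2}-> : c = 1 * c by rewrite mul1r.
  apply: cvgM co; apply: cvgMl; exact: expR_step_cvg.
apply: (ler_cvg_to cx h); apply: nearW => k.
by have [_ /andP[_ +]] := weight_strip k a0 H.
Qed.

Lemma limit_equivariant x x' (e e' : Gam -> Gam) : cancel e e' -> cancel e' e ->
  (forall g, G (e g) <-> G g) -> (forall g, P x' (e g) = P x g) ->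
  forall A, limit_weight x' A = limit_weight x (e @^-1` A).
Proof.
move=> eK e'K Ge Pe A; rewrite /limit_weight.
suff -> : weight ^~ x' ^~ A = weight ^~ x ^~ (e @^-1` A) by [].
apply/funext => k; rewrite /weight; congr (fine _ / _).
rewrite (@reindex_esum _ _ _ (e @^-1` A `&` G) _ e).
  by apply: eq_esum => g _; rewrite Pe.
split=> [g [Ag Gg]|g h _ _ gh|g [Ag Gg]].
- by split=> //; exact/Ge.
- by rewrite -(eK g) gh eK.
- exists (e' g); last by rewrite e'K.
  by split; rewrite /preimage/= ?e'K//; apply/Ge; rewrite e'K.
Qed.

Lemma limit_weightT : limit_weight o setT = 1.
Proof.
have U := generic_ultra.
apply: (cvg_lim (@norm_hausdorff _ _)) => //; apply: cvg_near_cst.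
apply: generic_near; near=> k; rewrite /weight setTI divff// gt_eqF//.
apply: lt_le_trans (mass_ge k); rewrite ltr0n; near: k.
exact: nbhs_infty_gt.
Unshelve. all: by end_near. Qed.

(** On the elements of G outside this set either D < r, or the potential
    exceeds (1 + eta) D and, for large k, the weights are dominated by a series
    of exponent s > delta for D, which converges. Such masses stay bounded while
    the total mass tends to infinity. *)
Lemma limit_escape (r eta : R) : 0 < eta ->
  limit_weight o (~` [set g | [/\ G g, r <= D g & b g <= eta * D g]]) = 0.
Proof.
move=> eta0; set A := ~` _; have U := generic_ultra.
apply/eqP; rewrite eq_le limit_weight_ge0 andbT; apply/ler_addgt0Pl => e e0.
rewrite addr0.
pose s := delta * (1 + eta / 2).
have s0 : 0 < s by rewrite mulr_gt0// addr_gt0// divr_gt0.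
have ds : delta < s by rewrite ltr_pMr// ltrDl divr_gt0.
pose u g := expR (- (s * D g)).
pose c := expR (s * `|r|).
have c1 : 1 <= c by rewrite -expR0 ler_expR mulr_ge0// ltW.
apply: (cvgr_to_le (limit_weight_cvg o A)); apply: generic_near; near=> k.
have e1 := step_gt0 k; have e2 := step_lt k.
have ke : step k * (1 + eta) <= delta * (eta / 2).
  rewrite /step mulrAC ler_pdivrMr//.
  have : 2 * (1 + eta) / eta <= k.+2%:R.
    apply: (@le_trans _ _ k%:R); last by rewrite ler_nat -addn2 leq_addr.
    near: k; exact: nbhs_infty_ger.
  rewrite ler_pdivrMr// => h.
  have -> : delta * (eta / 2) * k.+2%:R = delta * ((k.+2%:R * eta) / 2) by ring.
  by rewrite ler_pM2l//; lra.
have ub g : (A `&` G) g -> tent k (cut k) (P o g) <= c * u g.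
  move=> [Ag Gg]; apply: le_trans (tent_le2 k _ _) _.
  have [Dr|rD] := ltP (D g) r.
    apply: (@le_trans _ _ 1).
      rewrite -expR0 ler_expR oppr_le0 mulr_ge0 ?subr_ge0 ?(ltW e2)//.
      exact: le_trans (D0 g) (Po_ge g).
    rewrite -expRD -expR0 ler_expR -mulrN -mulrDr mulr_ge0 ?(ltW s0)//.
    by have := ler_norm r; lra.
  have bg : eta * D g < b g.
    by rewrite ltNge; apply/negP => h; apply: Ag.
  apply: (@le_trans _ _ (u g)); last by rewrite ler_peMl// expR_ge0.
  rewrite ler_expR lerN2.
  apply: (@le_trans _ _ ((delta - step k) * ((1 + eta) * D g))).
    rewrite mulrA ler_wpM2r// /s.
    have -> : (delta - step k) * (1 + eta) = delta * (1 + eta) - step k * (1 + eta) by ring.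
    by lra.
  rewrite ler_wpM2l ?subr_ge0 ?(ltW e2)// PoE; lra.
have u0 g : 0 <= u g by exact: expR_ge0.
have su : rsummable (A `&` G) u by apply: (rsummableS _ _ (conv ds)) => // g [].
have [_ h] := rsum_scale (le_trans ler01 c1) u0 (fun=> tent0 _ _ _) ub su.
have hG : rsum (A `&` G) u <= rsum G u.
  rewrite -lee_fin !rsumE//; last exact: conv.
  by apply: le_esum_subset => // g [].
have k0 : (0 : R) < k%:R by rewrite ltr0n; near: k; exact: nbhs_infty_gt.
have m0 : 0 < mass k := lt_le_trans k0 (mass_ge k).
rewrite /weight ler_pdivrMr//; apply: le_trans h _.
apply: (@le_trans _ _ (c * rsum G u)).
  by rewrite ler_wpM2l// (le_trans ler01).
apply: (@le_trans _ _ (e * k%:R)); last by rewrite ler_pM2l// mass_ge.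
rewrite [leRHS]mulrC -ler_pdivrMr//; near: k; exact: nbhs_infty_ger.
Unshelve. all: by end_near. Qed.

(** The last property serves for translations e of a group; the weights satisfy
    it exactly, before any limit. *)
Lemma patterson_family : exists m : X -> finadd R Gam,
  [/\ m o setT = 1,
      forall r eta : R, 0 < eta ->
        m o (~` [set g | [/\ G g, r <= D g & b g <= eta * D g]]) = 0,
      forall x A (a c : R), 0 <= a ->
        (forall g, A g -> a <= expR (- (delta * (P x g - P o g))) <= c) ->
        a * m o A <= m x A <= c * m o A &
      forall x x' (e e' : Gam -> Gam), cancel e e' -> cancel e' e ->
        (forall g, G (e g) <-> G g) -> (forall g, P x' (e g) = P x g) ->
        forall A, m x' A = m x (e @^-1` A)].
Proof.
exists limit_finadd; split.
- exact: limit_weightT.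
- exact: limit_escape.
- exact: limit_strip.
- exact: limit_equivariant.
Qed.

End patterson.

(** * The boundary of a factor *)

Section slope_boundary.
Context (R : realType) (Y Z X : metricType R) (S : l2_splitting Y Z X).
Hypotheses (sY : stewart Y) (sZ : stewart Z).
Hypotheses (gY : geodesic_space Y) (gZ : geodesic_space Z).
Hypothesis pY : proper_space Y.

Let sX : stewart X := stewart_split S sY sZ.
Let gX : geodesic_space X := geodesic_split S gY gZ.

Lemma lift_mdist (y y' : Y) (z : Z) :
  mdist (pair_of S y z) (pair_of S y' z) = mdist y y'.
Proof.
apply/eqP; rewrite -(eqrXn2 (isT : (0 < 2)%N)) ?mdist_ge0// (mdist_split S).
by rewrite !prY_pair !prZ_pair mdistxx expr0n addr0.
Qed.

Lemma lift_ray_mdist (s : ray Y) (z : Z) (u v : R) : 0 <= u -> 0 <= v ->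
  mdist (pair_of S (s u) z) (pair_of S (s v) z) = `|u - v|.
Proof. by move=> u0 v0; rewrite lift_mdist ray_mdist. Qed.

Definition lift (s : ray Y) (z : Z) : ray X :=
  @Ray R X (fun t => pair_of S (s t) z) (@lift_ray_mdist s z).

Lemma lift_asymptotic (s t : ray Y) (z w : Z) :
  ray_end (lift s z) = ray_end (lift t w) <-> ray_end s = ray_end t.
Proof.
rewrite !ray_endP; split=> -[K sK].
  exists K => u u0; apply: le_trans (sK u u0).
  by apply: le_trans (mdist_prY S _ _); rewrite /= !prY_pair.
exists (K + mdist z w) => u u0; apply: le_trans (mdist_le_add S _ _) _.
by rewrite /= !prY_pair !prZ_pair lerD2r sK.
Qed.

Lemma lift_movable (s : ray Y) (z : Z) : movable (lift s z).
Proof.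
move=> p; have [t [t0 tb]] := ray_movable pY sY gY s (prY S p).
exists (lift t (prZ S p)); split; first by rewrite /= t0 pair_pr.
move=> u u0; apply: (@le_trans _ _ (Num.sqrt ((2 * mdist p (lift s z 0)) ^+ 2))); last first.
  by rewrite sqrtr_sqr ger0_norm// mulr_ge0// mdist_ge0.
rewrite -[leLHS](ger0_norm (mdist_ge0 _ _)) -sqrtr_sqr ler_sqrt ?sqr_ge0//.
rewrite exprMn !(mdist_split S) /= !prY_pair !prZ_pair.
have := tb u u0; rewrite -ler_sqr ?nnegrE ?mulr_ge0 ?mdist_ge0// exprMn.
by have := sqr_ge0 (mdist (prZ S p) z); lra.
Qed.

Definition slope_set : set (bdry X) :=
  [set xi | exists s z, xi = ray_end (lift s z)].

Lemma slope_set_based (xi : bdry X) (o : X) : slope_set xi ->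
  exists s : ray Y, s 0 = prY S o /\ xi = ray_end (lift s (prZ S o)).
Proof.
move=> [s [z ->]]; have [t [t0 tb]] := ray_movable pY sY gY s (prY S o).
exists t; split=> //; apply/lift_asymptotic/ray_endP.
by exists (2 * mdist (prY S o) (s 0)) => u u0; rewrite metric_sym; exact: tb.
Qed.

Lemma open_cone_nbhd (s : ray X) (r e : R) : 0 < r -> 0 < e ->
  open [set xi : bdry X | cone_nbhd s r e (inr xi)].
Proof.
move=> r0 e0; exists (cone_nbhd s r e) => //.
exists [set cone_nbhd s r e]; last by rewrite bigcup_set1.
by move=> _ ->; apply: finI_from1; right; exists s, r, e.
Qed.

Lemma cone_nbhd_refl (s : ray X) (r e : R) : 0 < e -> cone_nbhd s r e (inr (ray_end s)).
Proof. by move=> e0; exists s; rewrite mdistxx. Qed.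

(** A ray whose Z-component moves is, at some time, at a definite distance
    from the Y-slice through its origin, which contains every ray of
    vanishing slope with the same origin. *)
Lemma closed_slope_set : closed slope_set.
Proof.
rewrite -openC openE => xi nxi.
suff [U [Uo Ux UA]] : exists U : set (bdry X), [/\ open U, U xi & U `<=` ~` slope_set].
  by apply: filterS UA _; exact: open_nbhs_nbhs.
set s := bdry_ray xi; set p := s 0.
have [[r [r0 rp]]|cst] := pselect (exists r : R, 0 <= r /\ prZ S (s r) <> prZ S p); last first.
  exfalso; apply: nxi.
  have sz r : 0 <= r -> prZ S (s r) = prZ S p.
    by move=> r0; apply: contrapT => h; apply: cst; exists r.
  have rd u v : 0 <= u -> 0 <= v -> mdist (prY S (s u)) (prY S (s v)) = `|u - v|.
    move=> u0 v0; rewrite -(ray_mdist s)//; apply/eqP.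
    rewrite -(eqrXn2 (isT : (0 < 2)%N)) ?mdist_ge0// [eqbRHS](mdist_split S).
    by rewrite !sz// mdistxx expr0n addr0.
  exists (@Ray R Y (fun t => prY S (s t)) rd), (prZ S p).
  rewrite -(bdry_rayK xi); apply/ray_endP; exists 0 => u u0 /=.
  by rewrite -/s -(sz u u0) pair_pr mdistxx.
have {}r0 : 0 < r.
  by rewrite lt_neqAle r0 andbT; apply/eqP => h; apply: rp; rewrite -h.
pose e := mdist (prZ S (s r)) (prZ S p).
have e0 : 0 < e by rewrite mdist_gt0; exact/eqP.
exists [set xi : bdry X | cone_nbhd s r e (inr xi)]; split.
- exact: open_cone_nbhd.
- by rewrite /= -(bdry_rayK xi); exact: cone_nbhd_refl.
- move=> xi' [t [tx t0 td]] /slope_set_based - /(_ p)[t' [t'0 x'E]].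
  have E : ray_end t = ray_end (lift t' (prZ S p)) by rewrite tx.
  have t00 : t 0 = lift t' (prZ S p) 0 by rewrite t0 /= t'0 pair_pr.
  have tr := asymptotic_ray_unique sX t00 E (ltW r0).
  have : mdist (prZ S (t r)) (prZ S (s r)) < e := le_lt_trans (mdist_prZ S _ _) td.
  by rewrite tr /= prZ_pair metric_sym ltxx.
Qed.

(** The Radon-Nikodym derivative at x, as a function on the boundary. *)
Definition conformal (delta : R) (o x : X) (xi : bdry X) : R :=
  if pselect (slope_set xi) is left h then
    expR (delta * busemann_ray (sval (cid (slope_set_based o h))) (prY S x))
  else 0.

Lemma busemann_ray_eq (s t : ray Y) y : (forall u, 0 <= u -> s u = t u) ->
  busemann_ray s y = busemann_ray t y.
Proof.
move=> st; rewrite /busemann_ray; congr (sup _).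
by apply/seteqP; split=> _ [N N0 <-]; exists N; rewrite ?st.
Qed.

(** The ray that is chosen in the definition issues from the Y-component of o,
    and there is only one such ray with a given end. *)
Lemma conformalE delta o x (s : ray Y) (z : Z) : s 0 = prY S o ->
  conformal delta o x (ray_end (lift s z)) =
  expR (delta * busemann_ray s (prY S x)).
Proof.
move=> s0; rewrite /conformal; case: pselect => [h|[]]; last by exists s, z.
case: cid => t /= [t0 /lift_asymptotic ts]; congr (expR (_ * _)).
apply: busemann_ray_eq => u u0; apply/esym.
by apply: asymptotic_ray_unique => //; rewrite s0.
Qed.

Lemma conformal_ge0 delta o x xi : 0 <= conformal delta o x xi.
Proof. by rewrite /conformal; case: pselect => // h; rewrite expR_ge0. Qed.

Lemma busemann_ray_lip (s : ray Y) y y' :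
  busemann_ray s y <= busemann_ray s y' + mdist y y'.
Proof.
apply/ler_addgt0Pl => e e0.
have [N1 h1] := excess_small (mdist (s 0) y) e0.
have [N2 h2] := excess_small (mdist (s 0) y') e0.
pose N := Num.max N1 N2.
have [D1 x1] := h1 N ltac:(by rewrite le_max lexx).
have [D2 x2] := h2 N ltac:(by rewrite le_max lexx orbT).
have /andP[a1 a2] := busemann_ray_approx sY D1.
have /andP[b1 b2] := busemann_ray_approx sY D2.
by have := metric_triangle y' y (s N); rewrite (metric_sym y' y); lra.
Qed.

Lemma conformal_lip delta o x x' xi : 0 < delta ->
  conformal delta o x xi <= expR (delta * mdist x x') * conformal delta o x' xi.
Proof.
move=> d0; have [[s [z ->]]|n] := pselect (slope_set xi); last first.
  by rewrite /conformal; case: pselect => // _; rewrite mulr0.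
have [t [t0 ->]] := slope_set_based o (ex_intro _ s (ex_intro _ z erefl)).
rewrite !conformalE// -expRD ler_expR -mulrDr ler_pM2l//.
have := busemann_ray_lip t (prY S x) (prY S x').
by have := mdist_prY S x x'; lra.
Qed.

(** Lower semicontinuity on the slope set. A cone neighbourhood controls the
    ray at one time N, and this determines the Busemann function at x up to the
    error of busemann_ray_approx. *)
Lemma conformal_near delta o x xi (e : R) : 0 < delta -> 0 < e -> slope_set xi ->
  exists U : set (bdry X), [/\ open U, U xi & forall xi', slope_set xi' -> U xi' ->
    expR (- e) * conformal delta o x xi <= conformal delta o x xi'].
Proof.
move=> d0 e0 /(slope_set_based o)[s [s0 ->]].
have e3 : 0 < e / delta / 3 by rewrite !divr_gt0.
have [N0 h0] := excess_small (mdist (s 0) (prY S x)) e3.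
pose N := Num.max N0 1.
have [D1 x1] := h0 N ltac:(by rewrite le_max lexx).
have N1 : 0 < N by rewrite lt_max ltr01 orbT.
exists [set xi : bdry X | cone_nbhd (lift s (prZ S o)) N (e / delta / 3) (inr xi)].
split; [exact: open_cone_nbhd|exact: cone_nbhd_refl|].
move=> _ /(slope_set_based o)[t [t0 ->]] [t' [t'E t'0 td]].
have t'00 : t' 0 = lift t (prZ S o) 0 by rewrite t'0 /= s0 t0.
have E := asymptotic_ray_unique sX t'00 t'E (ltW N1).
have d : mdist (t N) (s N) < e / delta / 3 by move: td; rewrite E lift_mdist.
rewrite !conformalE// -expRD ler_expR.
have D2 : mdist (t 0) (prY S x) < N by rewrite t0 -s0.
have /andP[a1 a2] := busemann_ray_approx sY D1.
have /andP[b1 b2] := busemann_ray_approx sY D2.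
rewrite t0 -s0 in b2.
have := metric_triangle (prY S x) (s N) (t N); rewrite (metric_sym (s N)).
have ee : e = delta * (e / delta) by rewrite mulrC mulfVK// gt_eqF.
rewrite {1}ee -mulrN -mulrDr ler_pM2l// => tri.
by lra.
Qed.

End slope_boundary.

(** * From orbit masses to a conformal density *)

Lemma negligible_fin_bigcup d (T : measurableType d) (R : realType)
    (mu : {measure set T -> \bar R}) (I : choiceType) (D : set I) (F : I -> set T) :
  finite_set D -> (forall i, D i -> mu.-negligible (F i)) ->
  mu.-negligible (\bigcup_(i in D) F i).
Proof.
move=> /finite_seqP[r ->] H; rewrite bigcup_seq big_seq_cond.
elim/big_ind : _ => [|A B|i]; first exact: negligible_set0.
  exact: negligibleU.
by rewrite andbT => ir; exact: H.
Qed.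

Section dynamics.
Context (R : realType) (Y Z X : metricType R) (S : l2_splitting Y Z X).
Hypotheses (sY : stewart Y) (sZ : stewart Z).
Hypotheses (gY : geodesic_space Y) (gZ : geodesic_space Z).
Hypothesis pY : proper_space Y.
Context (Gam : groupType).
Variables (aX : Gam -> isom X) (aY : Gam -> isom Y) (aZ : Gam -> isom Z).
Hypotheses (aXY : forall g x, prY S (aX g x) = aY g (prY S x))
  (aXZ : forall g x, prZ S (aX g x) = aZ g (prZ S x))
  (aXM : forall g h x, aX (g * h)%g x = aX g (aX h x)).
Variables (G : set Gam) (o : X).
Hypothesis finG : forall r, finite_set [set g | G g /\ mdist o (aX g o) <= r].
Hypothesis GM : forall g h, G g -> G h -> G (g * h)%g.

Let sX : stewart X := stewart_split S sY sZ.
Let gX : geodesic_space X := geodesic_split S gY gZ.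
Local Notation oY := (prY S o).
Local Notation oZ := (prZ S o).
Local Notation Om := (stone_borel (1%g : Gam)).
Local Notation basic_clopen := (basic_clopen (1%g : Gam)).

Definition orbitY (g : Gam) : Y := prY S (aX g o).
Definition disp (g : Gam) : R := mdist o (aX g o).
Definition dispY (g : Gam) : R := mdist oY (orbitY g).

Definition conical (r eta : R) : set Gam :=
  [set g | [/\ G g, r <= disp g & disp g - dispY g <= eta * disp g]].

Definition harm (n : nat) : R := n.+1%:R^-1.

Lemma harm_gt0 n : 0 < harm n. Proof. by rewrite invr_gt0. Qed.

Lemma harm_small (e : R) : 0 < e -> exists n, harm n <= e.
Proof.
move=> e0.
have [n _ /(_ _ (leqnn n)) h] := near_infty_natSinv_lt (PosNum e0).
by exists n; exact: ltW.
Qed.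

Lemma nat_above (r : R) : exists n : nat, r <= n%:R.
Proof.
exists (Num.bound `|r|); apply: le_trans (ler_norm _) (ltW _).
exact: archi_boundP.
Qed.

(** The ultrafilters along which the orbit escapes to infinity with slope
    tending to 0. *)
Definition conical_limits : set Om :=
  \bigcap_n basic_clopen (conical n%:R (harm n)).

Lemma conical_sub r r' eta eta' : r' <= r -> eta <= eta' ->
  conical r eta `<=` conical r' eta'.
Proof.
move=> rr ee g [Gg rd de]; split=> //; first exact: le_trans rd.
by apply: le_trans de _; rewrite ler_wpM2r// mdist_ge0.
Qed.

Lemma conical_limitsP (p : Om) : conical_limits p ->
  forall r eta, 0 < eta -> sval p (conical r eta).
Proof.
move=> pc r eta eta0; have pU := stone_ultra p.
have [n1 h1] := harm_small eta0; have [n2 h2] := nat_above r.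
have : basic_clopen (conical (maxn n1 n2)%:R (harm (maxn n1 n2))) p by apply: pc.
apply: filterS; apply: conical_sub.
  by apply: le_trans h2 _; rewrite ler_nat leq_maxr.
by apply: le_trans h1; rewrite lef_pV2 ?posrE// ler_nat ltnS leq_maxl.
Qed.

Lemma measurable_conical_limits : measurable conical_limits.
Proof. by apply: bigcapT_measurable => n; exact: measurable_clopen. Qed.

Lemma dispY_le g : dispY g <= disp g. Proof. exact: mdist_prY. Qed.

Lemma dispY_far (p : Om) r : conical_limits p -> \forall g \near sval p, r <= dispY g.
Proof.
move=> pc; have pU := stone_ultra p.
have h2 : (0 : R) < 1 / 2 by lra.
apply: filterS (conical_limitsP pc (2 * `|r|) h2) => g [_ h1 h3].
by have := ler_norm r; have := normr_ge0 r; lra.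
Qed.

Definition geo (y : Y) : R -> Y := sval (cid (gY oY y)).
Lemma geoP y : is_geodesic (geo y) oY y.
Proof. by rewrite /geo; case: cid. Qed.

Definition is_limit_ray (p : Om) (s : ray Y) := s 0 = oY /\
  forall t, 0 <= t -> (fun g => geo (orbitY g) t) @ sval p --> s t.

Lemma limit_ray_ex (p : Om) : conical_limits p -> exists s, is_limit_ray p s.
Proof.
move=> pc; have pU := stone_ultra p.
have [//|s [s0 sl]] := geodesics_subconverge pY pU (fun g => geoP (orbitY g)).
  by move=> N; exact: dispY_far.
by exists s.
Qed.

Variable xi0 : bdry X.

(** The value xi0 outside the conical limits is arbitrary: these have full
    measure. *)
Definition limit_pt (p : Om) : bdry X :=
  if pselect (conical_limits p) is left h
  then ray_end (lift S (sval (cid (limit_ray_ex h))) oZ) else xi0.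

Lemma limit_ptP p : conical_limits p ->
  exists s, is_limit_ray p s /\ limit_pt p = ray_end (lift S s oZ).
Proof.
rewrite /limit_pt => pc; case: pselect => // h.
by case: cid => s sl /=; exists s.
Qed.

Lemma limit_pt_out p : ~ conical_limits p -> limit_pt p = xi0.
Proof. by rewrite /limit_pt; case: pselect. Qed.

Lemma limit_pt_slope p : conical_limits p -> slope_set S (limit_pt p).
Proof. by move=> /limit_ptP[s [_ ->]]; exists s, oZ. Qed.

Definition shadow (g0 : Gam) (N : R) : set Gam :=
  [set g | mdist (geo (orbitY g) N) (geo (orbitY g0) N) <= 1 / 4].

(** Countably many shadows suffice to generate the topology around the limit
    points; this is what makes the limit point map measurable and its
    image measure carried by its support. *)
Lemma shadow_base (p : Om) (U : set (bdry X)) : conical_limits p ->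
  open U -> U (limit_pt p) -> exists (g0 : Gam) (n : nat),
  [/\ G g0, basic_clopen (shadow g0 n%:R) p &
      forall p', conical_limits p' -> basic_clopen (shadow g0 n%:R) p' -> U (limit_pt p')].
Proof.
move=> pc [V Vo <-] /=; have [s [[s0 sl] ->]] := limit_ptP pc => Vs.
have pU := stone_ultra p.
have [N0 hN0] := nbhs_ray_end_rays sX gX (open_nbhs_nbhs (conj Vo Vs)).
have [n nN0] := nat_above N0.
have e8 : (0 : R) < 1 / 8 by lra.
have near8 : \forall g \near sval p, mdist (geo (orbitY g) n%:R) (s n%:R) < 1 / 8.
  exact: (cvg_mdist (sl n%:R (ler0n _ _))).
have [g0 [g0d [g0G _ _]]] := filter_ex (filterI near8 (conical_limitsP pc 0 e8)).
exists g0, n; split=> //.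
  apply: filterS near8 => g gd.
  have := metric_triangle (geo (orbitY g) n%:R) (s n%:R) (geo (orbitY g0) n%:R).
  by rewrite (metric_sym (s _)); move: g0d; rewrite /shadow /=; lra.
move=> p' p'c p'sh; have [s' [[s'0 s'l] ->]] := limit_ptP p'c.
have p'U := stone_ultra p'.
apply: (hN0 n%:R nN0); first exact: lift_movable.
  by rewrite /= s0 s'0.
rewrite /= lift_mdist.
have c1 : (fun=> s n%:R) @ sval p' --> s n%:R by exact: cvg_cst.
apply: (cvg_mdist_le (s'l n%:R (ler0n _ _)) c1).
apply: filterS p'sh => g; rewrite /shadow/= => h.
have := metric_triangle (geo (orbitY g) n%:R) (geo (orbitY g0) n%:R) (s n%:R).
by move: g0d; rewrite /=; lra.
Qed.

Lemma bigcup_shadows_measurable (Q : Gam -> nat -> Prop) :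
  measurable (\bigcup_n \bigcup_k \bigcup_(g in [set g | (G g /\ disp g <= k%:R) /\ Q g n])
    basic_clopen (shadow g n%:R) : set Om).
Proof.
apply: bigcupT_measurable => n; apply: bigcupT_measurable => k.
apply: fin_bigcup_measurable => [|g _]; last exact: measurable_clopen.
by apply: sub_finite_set (finG k%:R) => g [].
Qed.

Lemma bigcup_shadowsP (Q : Gam -> nat -> Prop) p :
  (\bigcup_n \bigcup_k \bigcup_(g in [set g | (G g /\ disp g <= k%:R) /\ Q g n])
    basic_clopen (shadow g n%:R)) p <->
  exists g n, [/\ G g, Q g n & basic_clopen (shadow g n%:R) p].
Proof.
split=> [[n _ [k _ [g [[Gg _] Qg] pg]]]|[g [n [Gg Qg pg]]]]; first by exists g, n.
have [k gk] := nat_above (disp g).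
by exists n => //; exists k => //; exists g.
Qed.

Local Notation B := (borel_bdry xi0).

Definition limit_map : Om -> B := limit_pt.

(** Within the conical limits the preimage of an open set is the union of those
    shadows that it contains, a countable union since balls contain finitely
    many elements of G. *)
Lemma limit_map_measurable : measurable_fun setT limit_map.
Proof.
apply: (@measurability _ _ Om B setT limit_map (@open (bdry_at xi0))) => //.
move=> _ [U Uo <-]; rewrite setTI.
pose Q g n := forall p', conical_limits p' -> basic_clopen (shadow g n%:R) p' -> U (limit_pt p').
have -> : limit_map @^-1` U =
  (conical_limits `&` \bigcup_n \bigcup_k \bigcup_(g in [set g | (G g /\ disp g <= k%:R) /\ Q g n])
    basic_clopen (shadow g n%:R)) `|` (~` conical_limits `&` [set p | U xi0]).
  apply/seteqP; split=> [p Up|p [[pc /bigcup_shadowsP[g [n [_ Qg pg]]]]|[pc]]].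
  - have [pc|pc] := pselect (conical_limits p); last first.
      by right; split=> //=; move: Up; rewrite /preimage/= /limit_map limit_pt_out.
    left; split=> //; apply/bigcup_shadowsP.
    by have [g0 [n [Gg pg Qg]]] := shadow_base pc Uo Up; exists g0, n.
  - exact: Qg.
  - by rewrite /preimage/= /limit_map limit_pt_out.
apply: measurableU.
  apply: measurableI; first exact: measurable_conical_limits.
  exact: bigcup_shadows_measurable.
apply: measurableI; first by apply: measurableC; exact: measurable_conical_limits.
have [Ux|Ux] := pselect (U xi0).
  by rewrite (_ : [set p | U xi0] = setT)//; apply/seteqP; split.
by rewrite (_ : [set p | U xi0] = set0)//; apply/seteqP; split.
Qed.

(** The point c at time N on the geodesic of the Y-slice towards the orbit
    point is near s N, so it suffices that the detour through c be bounded. This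
    holds because the slope tends to 0: once (N + 1) (D - D_Y) is at most D / 2,
    the distance from c to the orbit point is at most D - N + 1. *)
Lemma orbit_tends (p : Om) (U : set (bordification X)) : conical_limits p ->
  nbhs (inr (limit_pt p) : bordification X) U ->
  \forall g \near sval p, U (inl (aX g o)).
Proof.
move=> pc; have [s [[s0 sl] ->]] := limit_ptP pc; have pU := stone_ultra p.
apply: (nbhs_ray_end_orbit sX gX (E := 2)) => N N0.
have N2 : 0 < (N + 1)^-1 / 2 by rewrite divr_gt0// invr_gt0; lra.
have close : \forall g \near sval p, mdist (geo (orbitY g) N) (s N) < 1.
  exact: (cvg_mdist (sl N N0)).
apply: filterS3 (dispY_far N pc) close (conical_limitsP pc (2 * N) N2).
move=> g Nd gs [_ d2N db].
have o0 : lift S s oZ 0 = o by rewrite /= s0 pair_pr.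
rewrite o0; set c := geo (orbitY g) N.
have [_ _ cd] : on_segment oY (orbitY g) c N.
  by apply: geodesic_on_segment; [exact: geoP|rewrite N0].
have t1 := metric_triangle (pair_of S (s N) oZ) (pair_of S c oZ) (aX g o).
rewrite lift_mdist (metric_sym (s N)) in t1.
apply: le_trans t1 _; rewrite -/(disp g).
suff : mdist (pair_of S c oZ) (aX g o) <= disp g - N + 1 by lra.
have sq : mdist (pair_of S c oZ) (aX g o) ^+ 2 =
    (dispY g - N) ^+ 2 + mdist oZ (prZ S (aX g o)) ^+ 2.
  by rewrite (mdist_split S) prY_pair prZ_pair -/(orbitY g) cd.
have dsq : disp g ^+ 2 = dispY g ^+ 2 + mdist oZ (prZ S (aX g o)) ^+ 2.
  by rewrite /disp (mdist_split S).
rewrite -ler_sqr ?nnegrE ?mdist_ge0//; last by lra.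
have h : (N + 1) * (2 * (disp g - dispY g)) <= disp g.
  have : (N + 1) * (2 * (disp g - dispY g)) <= (N + 1) * (2 * ((N + 1)^-1 / 2 * disp g)).
    by rewrite ler_pM2l; [lra|lra].
  have -> : (N + 1) * (2 * ((N + 1)^-1 / 2 * disp g)) = disp g.
    by field; rewrite gt_eqF//; lra.
  by [].
have := dispY_le g; nra.
Qed.

Lemma shift_conical (p : Om) g : G g -> conical_limits p ->
  conical_limits (stone_map (fun h => (g * h)%g) p).
Proof.
move=> Gg pc n _; have pU := stone_ultra p.
have e0 := harm_gt0 n; set eta := harm n in e0 *.
pose D := disp g; have D0 : 0 <= D := mdist_ge0 _ _.
have e4 : 0 < eta / 4 by rewrite divr_gt0.
have r0 : 0 <= (2 * D + eta * D) * 2 / eta.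
  by apply: divr_ge0; [have := mulr_ge0 (ltW e0) D0; lra|exact: ltW].
apply: filterS (conical_limitsP pc (n%:R + D + (2 * D + eta * D) * 2 / eta) e4).
move=> h [Gh hd hb]; rewrite /preimage/=.
have e1 : disp (g * h)%g = mdist o (aX g (aX h o)) by rewrite /disp aXM.
have d1 := isom_mdist (aX g) o (aX h o).
have y1 : mdist (prY S (aX g o)) (orbitY (g * h)%g) = dispY h.
  by rewrite /dispY /orbitY aXM !aXY isom_mdist.
have t1 := metric_triangle o (aX g o) (aX g (aX h o)).
have t2 := metric_triangle (aX g o) o (aX g (aX h o)).
have t3 := metric_triangle (prY S (aX g o)) oY (orbitY (g * h)%g).
have t4 := mdist_prY S (aX g o) o.
rewrite (metric_sym (aX g o) o) in t2 t4.
rewrite d1 -e1 -/(disp g) -/(disp h) -/D in t1 t2.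
rewrite y1 -/(dispY (g * h)%g) in t3; rewrite -/(disp g) -/D in t4.
have hq : 2 * (2 * D + eta * D) <= eta * disp h.
  have : (2 * D + eta * D) * 2 / eta <= disp h.
    by have := ler0n R n; lra.
  by rewrite ler_pdivrMr//; lra.
split; [exact: GM|by lra|].
have : eta * (disp h - D) <= eta * disp (g * h)%g by rewrite ler_pM2l//; lra.
by have := mulr_ge0 (ltW e0) D0; lra.
Qed.

(** Up to bounded distance, the geodesics from the Y-component of o to those of
    the points g h o are the images under g of the geodesics to those of the
    points h o; this persists in the limit. *)
Lemma limit_pt_equivariant (p : Om) g : G g -> conical_limits p ->
  limit_pt (stone_map (fun h => (g * h)%g) p) = bdry_act (aX g) (limit_pt p).
Proof.
move=> Gg pc; have pU := stone_ultra p.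
have [s [[s0 sl] ->]] := limit_ptP pc.
have [t [[t0 tl] ->]] := limit_ptP (shift_conical Gg pc).
rewrite /bdry_act; set rho := bdry_ray _.
have [K rK] := (ray_endP rho (lift S s oZ)).1 (bdry_rayK _).
apply/ray_endP; exists (2 * mdist oY (aY g oY) + mdist oZ (aZ g oZ) + K) => u u0.
have t1 := metric_triangle (lift S t oZ u) (aX g (lift S s oZ u)) (ray_isom (aX g) rho u).
apply: le_trans t1 _; apply: lerD; last first.
  by rewrite /= isom_mdist metric_sym; exact: rK.
apply: le_trans (mdist_le_add S _ _) _.
rewrite aXY aXZ /= !prY_pair !prZ_pair lerD2r.
have gs : (fun h => aY g (geo (orbitY h) u)) @ sval p --> aY g (s u).
  apply/metricType_numDomainType.cvgrPdist_lt => e e0.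
  have : \forall h \near sval p, mdist (geo (orbitY h) u) (s u) < e by exact: (cvg_mdist (sl u u0)).
  by apply: filterS => h; rewrite isom_mdist metric_sym.
have tl' : (fun h => geo (orbitY (g * h)%g) u) @ sval p --> t u by exact: (tl u u0).
apply: (cvg_mdist_le tl' gs).
have gc : conical_limits (stone_map (fun h => (g * h)%g) p) by exact: shift_conical.
have nb : \forall h \near sval p, u <= dispY (g * h)%g by exact: (dispY_far u gc).
apply: filterS2 (dispY_far u pc) nb => h uh ugh.
have E : orbitY (g * h)%g = aY g (orbitY h) by rewrite /orbitY aXM aXY.
have cg : is_geodesic (aY g \o geo (orbitY h)) (aY g oY) (orbitY (g * h)%g).
  have [c0 cL cd] := geoP (orbitY h); rewrite E.
  split; rewrite /= ?isom_mdist ?c0 ?cL// => v w hv hw.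
  by rewrite isom_mdist cd.
apply: (fellow_travel_end (c' := aY g \o geo (orbitY h)) sY (geoP _) cg).
  by rewrite u0.
by rewrite E isom_mdist.
Qed.

Variable delta : R.
Hypothesis delta0 : 0 < delta.

(** At the points of the Y-slice through x the potential is the distance, and
    it exceeds the distance elsewhere. The surplus d - d_Y penalizes positive
    slopes, which singles out the slope 0 even if the exponent is also maximal
    at other angles. *)
Definition pot (x : X) (g : Gam) : R :=
  2 * mdist x (aX g o) - mdist (prY S x) (orbitY g).

Lemma pot_lip x g : `|pot x g - pot o g| <= 3 * mdist x o.
Proof.
have t1 := metric_triangle x o (aX g o); have t2 := metric_triangle o x (aX g o).
have t3 := metric_triangle (prY S x) oY (orbitY g).
have t4 := metric_triangle oY (prY S x) (orbitY g).
have t5 := mdist_prY S x o.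
rewrite (metric_sym o x) in t2; rewrite (metric_sym oY (prY S x)) in t4.
by rewrite /pot ler_norml; apply/andP; split; lra.
Qed.

Definition ratio (x : X) (g : Gam) : R := expR (- (delta * (pot x g - pot o g))).

Lemma ratio_bound x g : expR (- (delta * (3 * mdist x o))) <= ratio x g <=
  expR (delta * (3 * mdist x o)).
Proof.
rewrite /ratio !ler_expR -!mulrN !ler_pM2l//.
by have := pot_lip x g; rewrite ler_norml => /andP[h1 h2]; apply/andP; split; lra.
Qed.

(** Here d and d' are the distances of two base points to the same orbit point,
    with components a, z and a', z'. As the gradient of d - a is of the order of
    the slope z / d, moving the base point by K changes d - a by a multiple of
    K t, where t bounds the slope. *)
Lemma defect_small (a a' z z' d d' K t : R) :
  0 <= a -> 0 <= a' -> 0 <= z -> 0 <= z' -> 0 < d -> 0 <= d' -> 0 < t -> t <= 1 ->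
  d ^+ 2 = a ^+ 2 + z ^+ 2 -> d' ^+ 2 = a' ^+ 2 + z' ^+ 2 ->
  `|a - a'| <= K -> `|z - z'| <= K -> `|d - d'| <= K -> a <= d -> a' <= d' ->
  d - a <= t ^+ 2 / 2 * d -> K <= t * d ->
  `|(d - d') - (a - a')| <= 6 * K * t.
Proof.
move=> a0 a'0 z0 z'0 d0 d'0 t0 t1 dE d'E aK zK dK ad ad' dt Kt.
have K0 : 0 <= K := le_trans (normr_ge0 _) aK.
have td0 : 0 <= t * d by rewrite mulr_ge0// ltW.
have ztd : z <= t * d.
  rewrite -ler_sqr ?nnegrE//.
  have -> : z ^+ 2 = (d - a) * (d + a)
    by have -> : (d - a) * (d + a) = d ^+ 2 - a ^+ 2; [ring|rewrite dE; ring].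
  apply: (@le_trans _ _ ((t ^+ 2 / 2 * d) * (2 * d))).
    by apply: ler_pM; lra.
  by rewrite le_eqVlt; apply/orP; left; apply/eqP; field.
have tt : t ^+ 2 * d <= t * d.
  by rewrite ler_pM2r// expr2 ler_piMr// ltW.
have dd0 : 0 < d + d' by lra.
rewrite -(ler_pM2r dd0) -{1}(gtr0_norm dd0) -normrM.
(* Multiplied by d + d' the difference can be read off from d^2 - d'^2, where
   the contributions of the two factors separate. *)
have -> : ((d - d') - (a - a')) * (d + d') =
   (a - a') * ((a + a') - (d + d')) + (z - z') * (z + z').
  have -> : ((d - d') - (a - a')) * (d + d') = (d ^+ 2 - d' ^+ 2) - (a - a') * (d + d') by ring.
  by rewrite dE d'E; ring.
apply: le_trans (ler_normD _ _) _; rewrite !normrM.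
move: dK zK aK; rewrite (ler_norml (d - d')) => /andP[k1 k2] zK aK.
have zK' := zK; move: zK'; rewrite ler_norml => /andP[k3 k4].
have aK' := aK; move: aK'; rewrite ler_norml => /andP[k5 k6].
have b1 : `|a - a'| * `|(a + a') - (d + d')| <= K * (3 * (t * d)).
  apply: ler_pM => //; rewrite ler_norml; apply/andP; split; lra.
have b2 : `|z - z'| * `|z + z'| <= K * (3 * (t * d)).
  apply: ler_pM => //; rewrite ler_norml; apply/andP; split; lra.
apply: le_trans (lerD b1 b2) _.
have -> : K * (3 * (t * d)) + K * (3 * (t * d)) = 6 * K * t * d by ring.
rewrite ler_wpM2l//; last by lra.
by rewrite !mulr_ge0// ltW.
Qed.

(** Write the potential as d_Y + 2 (d - d_Y). The first term gives the Busemann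
    function of the Y-factor, and the change of the second one tends to 0 with
    the slope, by defect_small. *)
Lemma pot_cvg (p : Om) (s : ray Y) x : conical_limits p -> is_limit_ray p s ->
  (fun g => pot o g - pot x g) @ sval p --> busemann_ray s (prY S x).
Proof.
move=> pc [s0 sl]; have pU := stone_ultra p.
apply/cvgrPdist_lt => e e0.
have e8 : 0 < e / 8 by rewrite divr_gt0.
pose K := mdist o x; have K0 : 0 <= K := mdist_ge0 _ _.
pose t := Num.min 1 (e / (48 * (K + 1))).
have K1 : 0 < 48 * (K + 1) by lra.
have t0 : 0 < t by rewrite lt_min ltr01 divr_gt0.
have t1 : t <= 1 by rewrite ge_min lexx.
have tK : 6 * K * t <= e / 8.
  have : t <= e / (48 * (K + 1)) by rewrite ge_min lexx orbT.
  rewrite ler_pdivlMr// => h.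
  have : 6 * K * t * 8 <= t * (48 * (K + 1)).
    have -> : 6 * K * t * 8 = t * (48 * K) by ring.
    by rewrite ler_pM2l//; lra.
  by lra.
have tt : 0 < t ^+ 2 / 2 by rewrite divr_gt0// exprn_gt0.
have [N /(_ _ (lexx _))[DN xN]] := excess_small (mdist (s 0) (prY S x)) e8.
have N0 : 0 <= N by apply: ltW; apply: le_lt_trans DN; exact: mdist_ge0.
have close : \forall g \near sval p, mdist (geo (orbitY g) N) (s N) < e / 8.
  exact: (cvg_mdist (sl N N0)).
apply: filterS3 (dispY_far N pc) close (conical_limitsP pc (K / t + 1) tt).
move=> g Nd gs [_ dr db].
have seg : on_segment oY (orbitY g) (geo (orbitY g) N) N.
  by apply: geodesic_on_segment; [exact: geoP|rewrite N0].
have /andP[a1 a2] := busemann_ray_approx sY DN.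
rewrite s0 in DN xN a2.
have /andP[b1 b2] := busemann_excess sY seg DN.
have u1 := metric_triangle (prY S x) (s N) (geo (orbitY g) N).
have u2 := metric_triangle (prY S x) (geo (orbitY g) N) (s N).
rewrite (metric_sym (s N)) in u1.
have Kt0 : 0 <= K / t by rewrite divr_ge0// ltW.
have d0 : 0 < disp g by lra.
have Kt : K <= t * disp g.
  by rewrite mulrC -ler_pdivrMr//; lra.
have t3 := metric_triangle x o (aX g o); have t4 := metric_triangle o x (aX g o).
have t5 := metric_triangle (prY S x) oY (orbitY g).
have t6 := metric_triangle oY (prY S x) (orbitY g).
have t7 := metric_triangle (prZ S x) oZ (prZ S (aX g o)).
have t8 := metric_triangle oZ (prZ S x) (prZ S (aX g o)).
have t9 := mdist_prY S o x; have t10 := mdist_prZ S o x.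
rewrite (metric_sym x o) in t3; rewrite (metric_sym (prY S x) oY) in t5.
rewrite (metric_sym (prZ S x) oZ) in t7.
have W := @defect_small (dispY g) (mdist (prY S x) (orbitY g))
  (mdist oZ (prZ S (aX g o))) (mdist (prZ S x) (prZ S (aX g o)))
  (disp g) (mdist x (aX g o)) K t (mdist_ge0 _ _) (mdist_ge0 _ _)
  (mdist_ge0 _ _) (mdist_ge0 _ _) d0 (mdist_ge0 _ _) t0 t1
  (mdist_split S _ _) (mdist_split S _ _)
  ltac:(by rewrite ler_norml /dispY /K; lra) ltac:(by rewrite ler_norml /K; lra)
  ltac:(by rewrite ler_norml /disp /K; lra) (dispY_le g) (mdist_prY S _ _) db Kt.
move: W; rewrite ler_norml => /andP[w1 w2].
move: b1 b2 w1 w2; rewrite /pot -/(disp g) -/(dispY g) => b1 b2 w1 w2.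
by rewrite ltr_norml; apply/andP; split; lra.
Qed.

Lemma ratio_limit (p : Om) x : conical_limits p ->
  stone_ext (ratio x) p = conformal S sY gY pY delta o x (limit_pt p).
Proof.
move=> pc; have pU := stone_ultra p.
have [s [sl ->]] := limit_ptP pc.
rewrite conformalE//; last by case: sl.
apply/cvg_lim => //; have h := @pot_cvg p s x pc sl.
have h2 : (fun g => delta * (pot o g - pot x g)) @ sval p --> delta * busemann_ray s (prY S x).
  exact: cvgMr.
have -> : ratio x = expR \o (fun g => delta * (pot o g - pot x g)).
  by apply/funext => g; rewrite /ratio /= -mulrN opprB.
by apply: (cvg_comp _ _ h2); exact: continuous_expR.
Qed.

Variable m : X -> finadd R Gam.
Hypotheses (mT : m o setT = 1)
  (mesc : forall r eta, 0 < eta -> m o (~` conical r eta) = 0)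
  (mstrip : forall x A (a c : R), 0 <= a ->
     (forall g, A g -> a <= ratio x g <= c) -> a * m o A <= m x A <= c * m o A)
  (mequiv : forall g, G g -> forall x A,
     m (aX g x) A = m x ((fun h => g * h)%g @^-1` A)).

Definition stoneM (x : X) : {finite_measure set Om -> \bar R} :=
  stone_measure (1%g : Gam) (m x).

Lemma stoneM_clopen x A : stoneM x (basic_clopen A) = (m x A)%:E.
Proof. exact: stone_measure_clopen. Qed.

Lemma stoneM_out x : (stoneM x).-negligible (~` conical_limits).
Proof.
rewrite /conical_limits setC_bigcap; apply: negligible_bigcup => n.
rewrite -basic_clopenC; exists (basic_clopen (~` conical n%:R (harm n))); split=> //.
  exact: measurable_clopen.
apply: (etrans (stoneM_clopen x _)); congr EFin; apply/eqP; rewrite eq_le finadd_ge0 andbT.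
have /andP[_ h] := @mstrip x (~` conical n%:R (harm n)) 0 (expR (delta * (3 * mdist x o)))
  (lexx _) ltac:(by move=> g _; rewrite expR_ge0; case/andP: (ratio_bound x g)).
by apply: le_trans h _; rewrite mesc ?mulr0// harm_gt0.
Qed.

Lemma stoneM_conical x : stoneM x conical_limits <> 0%E.
Proof.
move=> C0.
have mC := measurable_conical_limits.
have nT : (stoneM x).-negligible setT.
  rewrite -(setvU conical_limits); apply: negligibleU; first exact: stoneM_out.
  exact/negligibleP.
have nT' : stoneM x (basic_clopen setT) = 0%E.
  by rewrite basic_clopenT; apply: measure_negligible.
have [m0] := etrans (esym (stoneM_clopen x setT)) nT'.
have /andP[h _] := @mstrip x setT (expR (- (delta * (3 * mdist x o)))) (expR (delta * (3 * mdist x o)))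
  (expR_ge0 _) ltac:(by move=> g _; exact: ratio_bound).
by move: h; rewrite mT mulr1 m0 leNgt expR_gt0.
Qed.

Lemma ratio_le x g : 0 <= ratio x g <= expR (delta * (3 * mdist x o)).
Proof. by rewrite expR_ge0; case/andP: (ratio_bound x g). Qed.

Lemma stoneM_density x E : measurable E ->
  stoneM x E = (\int[stoneM o]_(p in E) (stone_ext (ratio x) p)%:E)%E.
Proof.
move=> mE; apply: (stone_density (ratio_le x)) => // A a c a0 H.
exact: mstrip.
Qed.

Lemma stoneM_restrict x (A : set Om) : measurable A ->
  stoneM x A = stoneM x (A `&` conical_limits).
Proof.
move=> mA; have mC := measurable_conical_limits.
rewrite -[in LHS](setUIDK A conical_limits) measureU; last 3 first.
- exact: measurableI.
- exact: measurableD.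
- by rewrite setDE setIACA setICr setI0.
rewrite [X in (_ + X)%E](_ : _ = 0%E) ?adde0//.
apply: measure_negligible; first exact: measurableD.
by apply: negligibleS (stoneM_out x) => p [].
Qed.

Definition conformal_density (x : X) : {finite_measure set B -> \bar R} :=
  push_finite_measure (stoneM x) limit_map_measurable.

Local Notation nu := conformal_density.

Definition support (mu : set B -> \bar R) : set (bdry X) :=
  [set a | forall U : set (bdry X), open U -> U a -> (0 < mu U)%E].

Lemma conformal_densityE x (E : set B) :
  nu x E = stoneM x (limit_map @^-1` E).
Proof. by []. Qed.

Lemma measurable_open_bdry (U : set (bdry X)) : open U -> measurable (U : set B).
Proof. by move=> Uo; exact: sub_sigma_algebra. Qed.

Lemma limit_map_preimage (E : set B) : measurable E -> measurable (limit_map @^-1` E).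
Proof. by move=> mE; rewrite -[X in measurable X]setTI; exact: limit_map_measurable. Qed.

Lemma conformal_density_equivariant g x (E : set B) : G g -> measurable E ->
  nu (aX g x) E =
  nu x ((bdry_act (aX g) : B -> B) @^-1` E).
Proof.
move=> Gg mE; rewrite !conformal_densityE.
have mS := limit_map_preimage mE; have mC := measurable_conical_limits.
set f := fun h : Gam => (g * h)%g.
have mA : measurable (stone_map f @^-1` (limit_map @^-1` E) : set Om).
  by rewrite -[X in measurable X]setTI; exact: stone_map_measurable.
have E1 : stoneM (aX g x) (limit_map @^-1` E) =
    stoneM x (stone_map f @^-1` (limit_map @^-1` E)).
  exact: (stone_measure_map (mequiv Gg x) mS).
rewrite {}E1; set A := stone_map f @^-1` _ in mA *.
set A' := limit_map @^-1` (_ @^-1` _).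
have AC : A `&` conical_limits = A' `&` conical_limits.
  apply/seteqP; split=> p [Ap pc]; split=> //; move: Ap; rewrite /A /A' /preimage/= /limit_map.
    by rewrite limit_pt_equivariant.
  by rewrite limit_pt_equivariant.
have mA' : measurable A'.
  have -> : A' = (A `&` conical_limits) `|`
      (~` conical_limits `&` [set p | E (bdry_act (aX g) xi0)]).
    rewrite AC -[LHS](setUIDK A' conical_limits); congr (_ `|` _).
    apply/seteqP; split=> p [h1 h2]; split=> //.
      by move: h1; rewrite /A' /preimage/= /limit_map limit_pt_out.
    by rewrite /A' /preimage/= /limit_map limit_pt_out.
  apply: measurableU; first exact: measurableI.
  apply: measurableI; first exact: measurableC.
  have [Ux|Ux] := pselect (E (bdry_act (aX g) xi0)).
    by rewrite (_ : [set p | _] = setT)//; apply/seteqP; split.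
  by rewrite (_ : [set p | _] = set0)//; apply/seteqP; split.
rewrite (stoneM_restrict x mA) AC.
by apply/esym; exact: (stoneM_restrict x mA').
Qed.

(** Otherwise every conical limit would lie in the preimage of a null open set,
    hence in one of countably many null shadows, and the conical limits would be
    a null set. *)
Lemma supp_nonempty x : support (nu x) !=set0.
Proof.
apply: contrapT => /set0P/negP/negPn/eqP s0.
have H a : exists U : set (bdry X), [/\ open U, U a & nu x U = 0%E].
  apply: contrapT => h; have : support (nu x) a.
    move=> U Uo Ua; rewrite lt_neqAle measure_ge0 andbT eq_sym.
    by apply/eqP => U0; apply: h; exists U.
  by rewrite s0.
pose Q g n := (stoneM x).-negligible (basic_clopen (shadow g n%:R) `&` conical_limits).
apply: (stoneM_conical (x := x)); apply: measure_negligible.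
  exact: measurable_conical_limits.
suff : (stoneM x).-negligible (\bigcup_n \bigcup_k
    \bigcup_(g in [set g | (G g /\ disp g <= k%:R) /\ Q g n])
      (basic_clopen (shadow g n%:R) `&` conical_limits)).
  apply: negligibleS => p pc; have [U [Uo Ua U0]] := H (limit_pt p).
  have [g [n [Gg pg gU]]] := shadow_base pc Uo Ua.
  have [k gk] := nat_above (disp g).
  exists n => //; exists k => //; exists g => //; split=> //.
  exists (limit_map @^-1` U); split.
  - exact: limit_map_preimage (measurable_open_bdry Uo).
  - exact: U0.
  - by move=> p' [p'g p'c]; exact: gU.
apply: negligible_bigcup => n; apply: negligible_bigcup => k.
apply: negligible_fin_bigcup => [|g []//].
by apply: sub_finite_set (finG k%:R) => g [].
Qed.

Lemma nu_null_outside x (U : set (bdry X)) : open U ->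
  U `&` slope_set S = set0 -> nu x U = 0%E.
Proof.
move=> Uo US; rewrite conformal_densityE; apply: measure_negligible.
  exact: limit_map_preimage (measurable_open_bdry Uo).
apply: negligibleS (stoneM_out x) => p /= Up pc.
have : (U `&` slope_set S) (limit_pt p) by split=> //; exact: limit_pt_slope.
by rewrite US.
Qed.

(** The image measure is carried by the slope set, which is closed. *)
Lemma supp_slope x : support (nu x) `<=` slope_set S.
Proof.
move=> a sa; apply: contrapT => na.
have := sa (~` slope_set S) _ na.
rewrite openC => /(_ (closed_slope_set sY sZ gY pY)).
by rewrite nu_null_outside ?ltxx// ?setICl// openC; exact: closed_slope_set.
Qed.

Lemma supp_limit x : support (nu x) `<=`
  [set xi | limit_point [set (inl (aX g o) : bordification X) | g in G] (inr xi)].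
Proof.
move=> a sa U; rewrite nbhsE => -[V [Vo Va] VU].
have Wo : open ([set xi | V (inr xi)] : set (bdry X)) by exists V.
have := sa _ Wo Va; rewrite conformal_densityE => V0.
have [p [Vp pc]] : exists p, V (inr (limit_pt p)) /\ conical_limits p.
  apply: contrapT => h.
  suff Z0 : stoneM x (limit_map @^-1` [set xi | V (inr xi)]) = 0%E.
    by move: V0; rewrite Z0 ltxx.
  apply: measure_negligible.
    exact: limit_map_preimage (measurable_open_bdry Wo).
  by apply: negligibleS (stoneM_out x) => p Vp pc; apply: h; exists p.
have pU := stone_ultra p.
have tV : \forall g \near sval p, V (inl (aX g o)).
  exact: orbit_tends pc (open_nbhs_nbhs (conj Vo Vp)).
have [g [Vg [Gg _ _]]] := @filter_ex _ _ _ _ (filterI tV (conical_limitsP pc 0 ltr01)).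
by exists (inl (aX g o)); split; [apply/eqP|exists g|exact: VU].
Qed.

Local Notation dnu x :=
  (fun a : B => (conformal S sY gY pY delta o x a)%:E).

Lemma conformal_measurable x : measurable_fun setT
  (fun a : B => conformal S sY gY pY delta o x a).
Proof.
set h := (fun a : B => _).
apply: (@measurability _ _ B _ setT h (@RGenOInfty.G R)).
  exact: RGenOInfty.measurableE.
move=> _ [_ [a ->] <-]; rewrite setTI.
have [a0|a0] := ltP a 0.
  rewrite (_ : h @^-1` _ = setT)//; apply/seteqP; split=> // xi _.
  by rewrite /preimage/= in_itv/= andbT (lt_le_trans a0)// conformal_ge0.
pose W : set (bdry X) := [set xi | exists U : set (bdry X), [/\ open U, U xi &
  forall xi', slope_set S xi' -> U xi' -> a < conformal S sY gY pY delta o x xi']].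
have Wo : open W.
  rewrite openE => xi [U [Uo Ux HU]]; rewrite /interior nbhsE.
  by exists U => // xi' Ux'; exists U.
have -> : h @^-1` `]a, +oo[ = (W : set B) `&` slope_set S.
  apply/seteqP; split=> [xi|xi [[U [Uo Ux HU]] sx]]; last first.
    by rewrite /preimage/= in_itv/= andbT HU.
  rewrite /preimage/= in_itv/= andbT => ax.
  have sx : slope_set S xi.
    apply: contrapT => n; move: ax; rewrite /h /conformal.
    by case: pselect => //= _; rewrite ltNge a0.
  split=> //; set c := h xi in ax.
  have c0 : 0 < c := le_lt_trans a0 ax.
  have e0 : 0 < (c - a) / (2 * c) by rewrite divr_gt0 ?subr_gt0// mulr_gt0.
  have [U [Uo Ux HU]] := conformal_near sY sZ gY pY o x delta0 e0 sx.
  exists U; split=> // xi' sx' Ux'; apply: lt_le_trans (HU _ sx' Ux').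
  have := expR_ge1Dx (- ((c - a) / (2 * c))).
  rewrite -/c -(ler_pM2r c0); apply: lt_le_trans.
  have -> : (1 + - ((c - a) / (2 * c))) * c = (c + a) / 2.
    by field; rewrite gt_eqF.
  by lra.
apply: measurableI; first exact: measurable_open_bdry.
rewrite -[slope_set S]setCK; apply: measurableC; apply: measurable_open_bdry.
by rewrite openC; exact: closed_slope_set.
Qed.

Lemma dnu_measurable x : measurable_fun setT (dnu x).
Proof. by apply/measurable_EFinP; exact: (@conformal_measurable x). Qed.

Lemma dnu_ge0 x a : (0 <= dnu x a)%E.
Proof. by rewrite lee_fin conformal_ge0. Qed.

(** On the Stone space the density is the extension of the ratio of weights; by
    ratio_limit it factors through the limit point map. *)
Lemma conformal_density_integral x (E : set B) : measurable E ->
  nu x E = (\int[nu o]_(a in E) dnu x a)%E.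
Proof.
move=> mE; have mS := limit_map_preimage mE.
rewrite conformal_densityE stoneM_density//.
transitivity (\int[stoneM o]_(p in limit_map @^-1` E) (dnu x \o limit_map) p)%E.
  apply: ge0_ae_eq_integral => //.
  - apply: measurable_funTS; exact: stone_ext_emeasurable (ratio_le x).
  - apply: measurable_funTS; apply: measurableT_comp; first exact: dnu_measurable.
    exact: limit_map_measurable.
  - by move=> p _; rewrite lee_fin; case/andP: (stone_ext_ge0 p (ratio_le x)).
  - by move=> p _; exact: dnu_ge0.
  - apply: negligibleS (stoneM_out o) => p /= np pc; apply: np => _.
    by rewrite ratio_limit.
apply/esym; apply: (@ge0_integral_pushforward _ _ Om B R limit_map
  limit_map_measurable (stoneM o) E (dnu x) mE).
- apply: measurable_funTS; exact: dnu_measurable.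
- by move=> a _; exact: dnu_ge0.
Qed.

Lemma conformal_density_dominates x : nu x `<< nu o.
Proof.
apply/null_content_dominatesP => E mE E0.
rewrite conformal_density_integral//; apply: null_set_integral => //.
by apply: measurable_funTS; exact: dnu_measurable.
Qed.

Lemma conformal_density_RN x :
  ae_eq (nu o) setT ('d (charge_of_finite_measure (nu x)) '/d (nu o)) (dnu x).
Proof.
apply: integral_ae_eq => //.
- by apply: Radon_Nikodym_integrable; exact: conformal_density_dominates.
- exact: dnu_measurable.
- move=> E _ mE; rewrite -conformal_density_integral//.
  by rewrite -Radon_Nikodym_integral//; exact: conformal_density_dominates.
Qed.

Lemma conformal_density_lip x y (E : set B) : measurable E ->
  (nu x E <= (expR (delta * mdist x y))%:E * nu y E)%E.
Proof.
move=> mE; rewrite !(conformal_density_integral _ mE).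
have mD z : measurable_fun E (dnu z) by apply: measurable_funTS; exact: dnu_measurable.
have d0 z a : E a -> (0 <= dnu z a)%E by move=> _; exact: dnu_ge0.
have e0 : (0 <= (expR (delta * mdist x y))%:E)%E by rewrite lee_fin expR_ge0.
rewrite -(ge0_integralZl (nu o) mE (mD y) (d0 y) e0).
apply: ge0_le_integral => //.
- exact: d0.
- by apply: emeasurable_funM.
- by move=> a _; rewrite -EFinM lee_fin conformal_lip.
Qed.

End dynamics.

(** * Weak-* continuity of comparable measures *)

Section weak_continuity.
Context (R : realType) (X : metricType R).

Lemma comparable_continuous (a : X -> R) (c : R) : (forall x, 0 <= a x) ->
  (forall x y, a x <= expR (c * mdist x y) * a y) -> continuous a.
Proof.
move=> a0 H x.
have d0 : (fun y => mdist x y) @ x --> (0 : R).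
  apply/cvgrPdist_lt => e e0.
  have : \forall y \near x, mdist x y < e.
    by apply: (@metricType_numDomainType.cvgr_dist_lt _ _ _ _ _ id) => //; exact: cvg_id.
  by apply: filterS => y; rewrite sub0r normrN ger0_norm// mdist_ge0.
have up : (fun y => expR (c * mdist x y) * a x) @ x --> a x.
  have {2}-> : a x = expR (c * 0) * a x by rewrite mulr0 expR0 mul1r.
  apply: cvgMl; have h : (fun y => c * mdist x y) @ x --> c * 0 by exact: cvgMr.
  by apply: (cvg_comp _ _ h); exact: continuous_expR.
have lo : (fun y => expR (- c * mdist x y) * a x) @ x --> a x.
  have {2}-> : a x = expR (- c * 0) * a x by rewrite mulr0 expR0 mul1r.
  apply: cvgMl; have h : (fun y => - c * mdist x y) @ x --> - c * 0 by exact: cvgMr.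
  by apply: (cvg_comp _ _ h); exact: continuous_expR.
apply: (squeeze_cvgr _ lo up); apply: nearW => y; apply/andP; split.
  have := H x y; rewrite mulNr expRN -ler_pdivrMl ?expR_gt0//.
have := H y x; by rewrite metric_sym.
Qed.

(** The positive and the negative parts have comparable integrals, each finite
    at all points or infinite at all points; an infinite one makes the
    real-valued integral constantly 0. *)
Lemma Rintegral_continuous d (T : measurableType d)
    (nu : X -> {measure set T -> \bar R}) (c : R) (f : T -> R) :
  (forall x y E, measurable E ->
     (nu x E <= (expR (c * mdist x y))%:E * nu y E)%E) ->
  measurable_fun setT f ->
  continuous (fun x => \int[nu x]_a f a).
Proof.
move=> H mf.
pose I g (x : X) := (\int[nu x]_a g a)%E.
have HI (g : T -> \bar R) : measurable_fun setT g -> (forall a, 0 <= g a)%E ->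
    forall x y, (I g x <= (expR (c * mdist x y))%:E * I g y)%E.
  by move=> mg g0 x y; apply: integral_le_measure; [exact: expR_ge0|exact: H|exact: mg|exact: g0].
have fin (g : T -> \bar R) : measurable_fun setT g -> (forall a, 0 <= g a)%E ->
    forall x y, (I g y \is a fin_num) -> (I g x \is a fin_num).
  move=> mg g0 x y fy; have Ix0 : (0 <= I g x)%E by exact: integral_ge0.
  rewrite ge0_fin_numE//; apply: le_lt_trans (HI g mg g0 x y) _.
  by rewrite -(fineK fy) -EFinM ltry.
have cont (g : T -> \bar R) : measurable_fun setT g -> (forall a, 0 <= g a)%E ->
    (forall x, I g x \is a fin_num) -> continuous (fun x => fine (I g x)).
  move=> mg g0 fg; apply: (@comparable_continuous _ c) => [x|x y].
    by apply: fine_ge0; exact: integral_ge0.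
  by rewrite -lee_fin EFinM !fineK//; exact: HI.
pose F a := (f a)%:E.
have mF : measurable_fun setT F by exact/measurable_EFinP.
have mp : measurable_fun setT (F^\+)%E by exact: measurable_funepos.
have mn : measurable_fun setT (F^\-)%E by exact: measurable_funeneg.
have p0 a : (0 <= (F^\+) a)%E by exact: funepos_ge0.
have n0 a : (0 <= (F^\-) a)%E by exact: funeneg_ge0.
have E x : \int[nu x]_a f a = fine (I (F^\+)%E x - I (F^\-)%E x)%E.
  by rewrite /Rintegral integralE.
have -> : (fun x => \int[nu x]_a f a) = (fun x => fine (I (F^\+)%E x - I (F^\-)%E x)%E).
  by apply/funext.
move=> x.
have [fp|fp] := boolP (I (F^\+)%E x \is a fin_num); last first.
  have fpy y : I (F^\+)%E y = +oo%E.
    apply/eqP; rewrite -leye_eq leNgt; apply/negP => h.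
    move/negP: fp; apply; apply: (fin _ mp p0 x y).
    by rewrite ge0_fin_numE//; exact: integral_ge0.
  have -> : (fun x => fine (I (F^\+)%E x - I (F^\-)%E x)%E) = (fun=> 0).
    by apply/funext => y; rewrite fpy; case: (I _ y).
  exact: cvg_cst.
have [fn|fn] := boolP (I (F^\-)%E x \is a fin_num); last first.
  have fny y : I (F^\-)%E y = +oo%E.
    apply/eqP; rewrite -leye_eq leNgt; apply/negP => h.
    move/negP: fn; apply; apply: (fin _ mn n0 x y).
    by rewrite ge0_fin_numE//; exact: integral_ge0.
  have -> : (fun x => fine (I (F^\+)%E x - I (F^\-)%E x)%E) = (fun=> 0).
    by apply/funext => y; rewrite fny; case: (I _ y).
  exact: cvg_cst.
have fpa y : I (F^\+)%E y \is a fin_num by exact: fin mp p0 _ _ fp.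
have fna y : I (F^\-)%E y \is a fin_num by exact: fin mn n0 _ _ fn.
have -> : (fun x => fine (I (F^\+)%E x - I (F^\-)%E x)%E) =
   (fun x => fine (I (F^\+)%E x) - fine (I (F^\-)%E x)).
  by apply/funext => y; rewrite fineB.
by apply: cvgB; apply: cont.
Qed.

Lemma weak_star_continuous (M : metricType R) (xi : bdry M)
    (nu : X -> weak_star xi) (c : R) :
  (forall x y (E : set (borel_bdry xi)), measurable E ->
     ((nu x : {finite_measure set borel_bdry xi -> \bar R}) E <=
       (expR (c * mdist x y))%:E *
       (nu y : {finite_measure set borel_bdry xi -> \bar R}) E)%E) ->
  continuous nu.
Proof.
move=> H; apply: continuous_comp_initial => x.
apply/cvg_sup => f.
rewrite cvg_image; last by rewrite eqEsubset; split=> v // _; exists (cst v).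
have mf : measurable_fun setT (f : borel_bdry xi -> R).
  apply: (measurability (@RGenOInfty.G R)); first exact: RGenOInfty.measurableE.
  move=> _ [_ [a ->] <-]; rewrite setTI; apply: sub_sigma_algebra.
  have /continuousP fc : continuous (f : bdry_at xi -> R) by exact: cts_fun.
  by apply: fc; exact: interval_open.
have hc := @Rintegral_continuous _ (borel_bdry xi) nu c f H mf x.
move=> W /= hW; have h := hc W hW.
exists ((fun g => g f) @^-1` W) => //.
by rewrite eqEsubset; split => [j [? + <-//]|j Wj]; exists (fun _ => j).
Qed.

End weak_continuity.

(** * Existence of the density from the growth of the orbit *)

Section existence.
Context (R : realType) (Y Z X : metricType R) (S : l2_splitting Y Z X).
Hypotheses (sY : stewart Y) (sZ : stewart Z).
Hypotheses (gY : geodesic_space Y) (gZ : geodesic_space Z).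
Hypothesis pY : proper_space Y.
Context (Gam : groupType).
Variables (aX : Gam -> isom X) (aY : Gam -> isom Y) (aZ : Gam -> isom Z).
Hypotheses (aXY : forall g x, prY S (aX g x) = aY g (prY S x))
  (aXZ : forall g x, prZ S (aX g x) = aZ g (prZ S x))
  (aXM : forall g h x, aX (g * h)%g x = aX g (aX h x)).
Variables (G : set Gam) (o : X) (delta : R).
Hypothesis finG : forall r, finite_set [set g | G g /\ mdist o (aX g o) <= r].
Hypotheses (GM : forall g h, G g -> G h -> G (g * h)%g)
  (GV : forall g, G g -> G g^-1%g).
Hypothesis delta0 : 0 < delta.
Local Notation D := (disp aX o).
Local Notation DY := (dispY S aX o).
Hypothesis conv : forall s, delta < s -> rsummable G (fun g => expR (- (s * D g))).
Hypothesis dive : forall s eta : R, 0 <= s < delta -> 0 < eta ->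
  \esum_(g in [set g | G g /\ D g - DY g <= eta * D g]) (expR (- (s * D g)))%:E = +oo%E.

Lemma conformal_busemann (x : X) (s : ray Y) (z : Z) :
  conformal S sY gY pY delta o x (ray_end (lift S s z)) =
  expR (delta * busemann (ray_end s) (prY S o) (prY S x)).
Proof.
have [t [t0 tb]] := ray_movable pY sY gY s (prY S o).
have E : ray_end s = ray_end t.
  apply/ray_endP; exists (2 * mdist (prY S o) (s 0)) => u u0.
  by rewrite metric_sym; exact: tb.
have -> : ray_end (lift S s z) = ray_end (lift S t z) by apply/lift_asymptotic.
by rewrite conformalE// E -t0 busemann_rayE.
Qed.

(** The densities are the images of the limit masses of the Patterson
    construction for the potential pot. Since pot is invariant under the
    diagonal action, a translation by g moves the masses seen from x to those
    seen from g x without any change of weights. *)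
Theorem slope_density_exists : exists (xi : bdry X)
    (nu : X -> {finite_measure set (borel_bdry xi) -> \bar R}),
  [/\ forall x, support (nu x) !=set0,
      forall x, support (nu x) `<=` slope_set S `&`
        [set xi | limit_point [set (inl (aX g o) : bordification X) | g in G] (inr xi)],
      forall g x (E : set (borel_bdry xi)), G g -> measurable E ->
        nu (aX g x) E = nu x ((bdry_act (aX g) : borel_bdry xi -> borel_bdry xi) @^-1` E) &
      (forall x, nu x `<< nu o) /\
      (forall x, {ae nu o, forall a : borel_bdry xi, forall (s : ray Y) (z : Z),
         a = ray_end (lift S s z) ->
         ('d (charge_of_finite_measure (nu x)) '/d (nu o)) a =
           (expR (delta * busemann (ray_end s) (prY S o) (prY S x)))%:E}) /\
      forall x y (E : set (borel_bdry xi)), measurable E ->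
        (nu x E <= (expR (delta * mdist x y))%:E * nu y E)%E].
Proof.
have [|||||||m [mT mesc mstrip meq]] := @patterson_family R Gam G X o
  (pot S aX o) D (fun g => D g - DY g) (fun x => 3 * mdist x o) delta.
- exact: delta0.
- by move=> g; exact: mdist_ge0.
- by move=> g; rewrite subr_ge0 dispY_le.
- by move=> g; rewrite /pot -/(disp aX o g) -/(dispY S aX o g); ring.
- by move=> x g; exact: pot_lip.
- exact: conv.
- exact: dive.
have mequiv g : G g -> forall x A, m (aX g x) A = m x ((fun h => g * h)%g @^-1` A).
  move=> Gg x A; apply: (meq x (aX g x) (fun h => g * h)%g (fun h => g^-1 * h)%g).
  - exact: mulKg.
  - exact: mulVKg.
  - move=> h; split=> [Ggh|]; last exact: GM.
    by rewrite -(mulKg g h); apply: GM => //; exact: GV.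
  - by move=> h; rewrite /pot /orbitY aXM !aXY !isom_mdist.
have strip x A a c : 0 <= a -> (forall g, A g -> a <= ratio S aX o delta x g <= c) ->
  a * m o A <= m x A <= c * m o A by exact: mstrip.
have [p pc] : exists p, conical_limits S aX G o p.
  apply: contrapT => np.
  apply: (stoneM_conical delta0 mT mesc strip (x := o)).
  rewrite (_ : conical_limits S aX G o = set0) ?measure0//.
  by apply/seteqP; split=> // p pc; apply: np; exists p.
have [s _] := limit_ray_ex gY pY pc.
pose xi := ray_end (lift S s (prZ S o)).
exists xi, (conformal_density S sY sZ gY gZ pY finG xi m); split.
- by move=> x; exact: (supp_nonempty sY sZ gY gZ pY finG xi delta0 mT mesc strip x).
- move=> x a ax; split; first exact: (supp_slope delta0 mesc strip ax).
  exact: (supp_limit delta0 mesc strip ax).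
- move=> g x E Gg mE.
  exact: (conformal_density_equivariant sY sZ gY gZ pY aXY aXZ aXM finG GM delta0 mesc strip mequiv x Gg mE).
have RN x := conformal_density_RN sY sZ gY gZ pY finG xi delta0 mesc strip x.
split; first by move=> x; exact: (conformal_density_dominates delta0 mesc strip x).
split; last first.
  by move=> x y E mE; exact: (conformal_density_lip sY sZ gY gZ pY finG delta0 mesc strip).
move=> x; move: (RN x); apply: filterS => a /(_ Logic.I) E s' z aE.
by rewrite E aE conformal_busemann.
Qed.

End existence.

(** * Exponents of growth and orbital series *)

Section more_sums.
Context (R : realType) (T : choiceType).
Implicit Types (A B : set T) (u : T -> R).

Lemma rsummableUl A B u : (forall i, 0 <= u i) ->
  rsummable A u -> rsummable B u -> rsummable (A `|` B) u.
Proof.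
move=> u0 sA sB; rewrite /rsummable (esumID A); last by move=> i _; rewrite lee_fin.
apply: lte_add_pinfty.
  by rewrite setUK.
by apply: (rsummableS u0 _ sB) => i [[]].
Qed.

Lemma rsummable_bigcup_seq (I : choiceType) (D : seq I) (F : I -> set T) u :
  (forall i, 0 <= u i) -> (forall i, i \in D -> rsummable (F i) u) ->
  rsummable (\bigcup_(i in [set` D]) F i) u.
Proof.
move=> u0 H.
rewrite bigcup_seq big_seq; elim/big_ind : _ => [|A B|i /H//].
  by rewrite /rsummable esum_set0 ltry.
exact: rsummableUl.
Qed.

Lemma rsummable_geometric (F : nat -> set T) u (C q : R) :
  (forall i, 0 <= u i) -> 0 <= C -> 0 <= q < 1 -> trivIset setT F ->
  (forall n, \esum_(i in F n) (u i)%:E <= (C * q ^+ n)%:E)%E ->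
  rsummable (\bigcup_n F n) u.
Proof.
move=> u0 C0 /andP[q0 q1] tF H; rewrite /rsummable.
rewrite nneseries_sum_bigcup//.
apply: (@le_lt_trans _ _ (C / (1 - q))%:E); last exact: ltry.
apply: lime_le.
  by apply: is_cvg_nneseries => n _ _; apply: esum_ge0 => i _; rewrite lee_fin.
apply: nearW => n; apply: (@le_trans _ _ (\sum_(0 <= i < n) (C * q ^+ i)%:E)%E).
  by apply: lee_sum.
rewrite sumEFin lee_fin.
have := @geometric_seriesE R C q (negbT (lt_eqF q1)).
move=> /(congr1 (fun f => f n)); rewrite /series/= => ->.
have q1' : 0 < 1 - q by rewrite subr_gt0.
by rewrite ler_pM2r ?invr_gt0// ler_piMr// gerBl exprn_ge0.
Qed.

End more_sums.

Section limsup.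
Context (R : realType).
Implicit Types (u : nat -> \bar R) (f : R -> \bar R).

Lemma limn_esup_lt u (s : \bar R) : (limn_esup u < s)%E ->
  \forall n \near \oo, (u n < s)%E.
Proof.
rewrite /limn_esup limf_esupE => /ereal_inf_lt[_ [V Vn <-] Vs].
apply: filterS Vn => n Vn; apply: le_lt_trans Vs.
by apply: ereal_sup_ubound; exists n.
Qed.

Lemma limn_esup_gt u (s : \bar R) : (s < limn_esup u)%E ->
  forall N : nat, exists2 n : nat, (N <= n)%N & (s < u n)%E.
Proof.
rewrite /limn_esup limf_esupE => su N.
have : (s < ereal_sup [set u n | n in [set n | (N <= n)%N]])%E.
  apply: lt_le_trans su _; apply: ereal_inf_lbound.
  by exists [set n | (N <= n)%N] => //; exists N.
by move=> /ereal_sup_gt[_ [n Nn <-] sn]; exists n.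
Qed.

Lemma limf_einf_right_lt f (s : \bar R) : (limf_einf f (0 : R)^'+ < s)%E ->
  exists2 e : R, 0 < e & (f e < s)%E.
Proof.
rewrite limf_einfE => h.
have : (ereal_inf (f @` [set e : R | (0 < e)%R]) < s)%E.
  apply: le_lt_trans h; apply: ereal_sup_ubound.
  exists [set e : R | (0 < e)%R] => //.
  exact: nbhs_right_gt.
by move=> /ereal_inf_lt[_ [e e0 <-] es]; exists e.
Qed.

Lemma limf_einf_right_le f (e : R) : 0 < e ->
  (forall e1 e2 : R, (e1 <= e2)%R -> (f e1 <= f e2)%E) ->
  (limf_einf f (0 : R)^'+ <= f e)%E.
Proof.
move=> e0 fm; rewrite limf_einfE; apply: ge_ereal_sup => _ [V V0 <-].
have : \forall x \near (0 : R)^'+, V x /\ x < e.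
  by near=> x; split; near: x => //; exact: nbhs_right_lt.
move=> /(@filter_ex _ _ (at_right_proper_filter _))[x [Vx xe]].
by apply: (@le_trans _ _ (f x)); [apply: ereal_inf_lbound; exists x|apply: fm; exact: ltW].
Unshelve. all: by end_near. Qed.

End limsup.

Section counting.
Context (R : realType) (X1 X2 : metricType R).
Local Notation X := (l2prod X1 X2).
Variables (o : X) (G : set (isom X1 * isom X2)).
Hypothesis aG : acts_properly G.
Local Notation D g := (mdist o (prod_isom g o)).
Local Notation A := (annulus G).

Lemma finite_ball (r : R) : finite_set [set g | G g /\ D g <= r].
Proof.
apply: (sub_finite_set _ (@aG o (Num.max r 1) _)); last by rewrite lt_max ltr01 orbT.
by move=> g [Gg gr]; split=> //; rewrite le_max gr.
Qed.

Lemma finite_annulus eps theta n : finite_set (A eps theta o n).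
Proof.
apply: (sub_finite_set _ (finite_ball n%:R)) => g [Gg _ /andP[_ /ltW gn] _].
by split.
Qed.

Definition card_annulus eps theta n : nat := #|` fset_set (A eps theta o n)|.

Lemma counting_annulus eps theta n :
  counting (A eps theta o n) = ((card_annulus eps theta n)%:R)%:E :> \bar R.
Proof. by rewrite /counting asboolT//; exact: finite_annulus. Qed.

Let growth eps theta n : \bar R :=
  (lne (counting (A eps theta o n)) * (n%:R^-1)%:E)%E.

Lemma growth_lt eps theta n (s : R) : (0 < n)%N -> (growth eps theta n < s%:E)%E ->
  (card_annulus eps theta n)%:R <= expR (s * n%:R).
Proof.
rewrite /growth counting_annulus => n0.
have n0' : (0 : R) < n%:R by rewrite ltr0n.
case: (card_annulus eps theta n) => [|c]; first by rewrite expR_ge0.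
rewrite lne_EFin ?ltr0n// -EFinM lte_fin ltr_pdivrMr// => h.
by rewrite -[leLHS](@lnK R) ?posrE ?ltr0n// ler_expR ltW.
Qed.

Lemma growth_gt eps theta n (s : R) : (0 < n)%N -> (s%:E < growth eps theta n)%E ->
  expR (s * n%:R) <= (card_annulus eps theta n)%:R.
Proof.
rewrite /growth counting_annulus => n0.
have n0' : (0 : R) < n%:R by rewrite ltr0n.
case: (card_annulus eps theta n) => [|c].
  by rewrite le0_lneNy// gt0_mulNye ?lte_fin ?invr_gt0.
rewrite lne_EFin ?ltr0n// -EFinM lte_fin ltr_pdivlMr// => h.
by rewrite -[leRHS](@lnK R) ?posrE ?ltr0n// ler_expR ltW.
Qed.

Lemma le_annulus eps1 eps2 theta n : eps1 <= eps2 ->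
  A eps1 theta o n `<=` A eps2 theta o n.
Proof. by move=> e12 g [Gg g1 gn gt]; split=> //; exact: le_trans e12. Qed.

Lemma le_exponent_eps theta eps1 eps2 : eps1 <= eps2 ->
  (exponent_eps G o eps1 theta <= exponent_eps G o eps2 theta)%E.
Proof.
move=> e12; rewrite /exponent_eps /limn_esup !limf_esupE.
apply: le_ereal_inf_tmp => _ [V Vn <-].
apply: (@le_trans _ _ (ereal_sup [set growth eps1 theta n | n in V])).
  by apply: ereal_inf_lbound; exists V.
apply: ge_ereal_sup => _ [n Vn' <-].
apply: (@le_trans _ _ (growth eps2 theta n)); last by apply: ereal_sup_ubound; exists n.
rewrite /growth lee_wpmul2r ?lee_fin ?invr_ge0//.
rewrite lee_lne ?in_itv/= ?leey ?andbT ?counting_annulus ?lee_fin ?ler0n//.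
rewrite ler_nat; apply: fsubset_leq_card.
by rewrite -fset_set_sub; [exact: le_annulus|exact: finite_annulus|exact: finite_annulus].
Qed.

Lemma exponent_le theta eps : 0 < eps ->
  (exponent G o theta <= exponent_eps G o eps theta)%E.
Proof. by move=> e0; apply: limf_einf_right_le => // e1 e2; exact: le_exponent_eps. Qed.

Lemma exponent_lt theta s : (exponent G o theta < s)%E ->
  exists2 eps : R, 0 < eps & (exponent_eps G o eps theta < s)%E.
Proof. exact: limf_einf_right_lt. Qed.

Lemma trivIset_annulus eps theta : trivIset setT (A eps theta o).
Proof.
move=> i j _ _ [g [[_ _ /andP[h1 h2] _] [_ _ /andP[h3 h4] _]]].
apply/eqP; rewrite eqn_leq; apply/andP; split.
  by rewrite -ltnS -(ltr_nat R) -natr1; lra.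
by rewrite -ltnS -(ltr_nat R) -natr1; lra.
Qed.

(** For s' < s the shell of radius n contributes at most a multiple of
    exp ((s' - s) n). *)
Lemma sector_summable eps theta (s s' : R) : 0 <= s -> s' < s ->
  (exponent_eps G o eps theta < s'%:E)%E ->
  rsummable [set g | G g /\ `|slope g o - theta| <= eps] (fun g => expR (- (s * D g))).
Proof.
move=> s0 ss /limn_esup_lt[N _ HN].
have e0 g : 0 <= expR (- (s * D g)) by exact: expR_ge0.
pose F k := A eps theta o (k + N.+1).
apply: (@rsummableS _ _ _ ([set g | G g /\ D g <= N.+1%:R] `|` \bigcup_k F k)) => //.
  move=> g [Gg gt]; have [|gN] := leP (D g) N.+1%:R; first by left.
  right; pose n := (Num.truncn (D g)).+1.
  have /andP[n1 n2] : n%:R - 1 <= D g < n%:R.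
    have := truncn_itv (mdist_ge0 o (prod_isom g o)).
    by rewrite /n -natr1 addrK.
  have nN : (N.+1 <= n)%N by rewrite -(ler_nat R) ltW// (lt_trans gN).
  exists (n - N.+1)%N => //; rewrite /F subnK//; split=> //.
    apply/eqP => E; move: gN; rewrite E mdistxx ltNge.
    by rewrite ler0n.
  by rewrite n1.
apply: rsummableUl => //; first by apply: rsummable_finite => //; exact: finite_ball.
apply: (@rsummable_geometric _ _ F _ (expR s * expR ((s' - s) * N.+1%:R)) (expR (s' - s))) => //.
- by rewrite expR_ge0/= expR_lt1 subr_lt0.
- move=> i j _ _ h; apply: (@addIn N.+1).
  exact: (trivIset_annulus (eps := eps) (theta := theta) (i := i + N.+1) (j := j + N.+1)).
move=> k; set n := (k + N.+1)%N.
have finF : finite_set (F k) by exact: finite_annulus.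
have cn : (card_annulus eps theta n)%:R <= expR (s' * n%:R).
  by apply: growth_lt; [rewrite /n addnS|apply: HN; rewrite /= /n addnS ltnW// ltnS leq_addl].
rewrite esum_fset// fsumEFin// lee_fin.
apply: (@le_trans _ _ (\sum_(i \in F k) expR (- (s * (n%:R - 1))))).
  rewrite -lee_fin -!fsumEFin//; apply: lee_fsum => // g [_ _ /andP[h _] _].
  by rewrite lee_fin ler_expR lerN2 ler_wpM2l.
rewrite fsbig_finite//= big_const_seq count_predT iter_addr_0 -[leLHS]mulr_natl.
apply: (@le_trans _ _ (expR (s' * n%:R) * expR (- (s * (n%:R - 1))))).
  by rewrite ler_wpM2r// expR_ge0.
rewrite -expRM_natl -!expRD ler_expR /n natrD.
by rewrite le_eqVlt; apply/orP; left; apply/eqP; ring.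
Qed.

Lemma slope_itv g : 0 <= slope g o <= pi / 2.
Proof.
have p0 := pi_gt0 R.
rewrite /slope; case: ifP => [_|/negbT d0]; first by apply/andP; split; lra.
rewrite (ltW (atan_ltpi2 _)) andbT -(@atan0 R) le_atan//.
by rewrite divr_ge0// mdist_ge0.
Qed.

(** Around every angle there is a sector in which the count of orbit points has
    exponent less than s; by compactness finitely many sectors exhaust G. *)
Lemma orbit_summable (delta s : R) : 0 <= delta ->
  (forall theta, 0 <= theta <= pi / 2 -> (exponent G o theta <= delta%:E)%E) ->
  delta < s -> rsummable G (fun g => expR (- (s * D g))).
Proof.
move=> delta0 H ds; pose s' := (delta + s) / 2.
have [ds' s's] : delta < s' /\ s' < s by rewrite /s'; split; lra.
have := @segment_compact R 0 (pi / 2); rewrite compact_cover.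
move=> /(_ (R * R)%type [set c | 0 < c.2 /\ (exponent_eps G o c.2 c.1 < s'%:E)%E]
  (fun c => ball c.1 c.2)) [].
- by move=> c [c0 _]; exact: ball_open.
- move=> theta; rewrite /= in_itv/= => /H h.
  have [eps e0 es] : exists2 eps : R, 0 < eps & (exponent_eps G o eps theta < s'%:E)%E.
    by apply: exponent_lt; apply: le_lt_trans h _; rewrite lte_fin.
  by exists (theta, eps) => //; exact: ballxx.
move=> I ID cov.
have e0 g : 0 <= expR (- (s * D g)) by exact: expR_ge0.
apply: (@rsummableS _ _ _ (\bigcup_(c in [set` I])
  [set g | G g /\ `|slope g o - c.1| <= c.2])) => //.
  move=> g Gg; have [|c cI gc] := cov (slope g o); first by rewrite /= in_itv/= slope_itv.
  by exists c => //; split=> //; rewrite distrC ltW.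
apply: rsummable_bigcup_seq => // c cI.
have /set_mem[c0 cs] := ID _ cI.
by apply: sector_summable s's cs; lra.
Qed.

(** Single shells already have unbounded sums, because infinitely many of them
    contain more than exp (s' n) points for some s' > s. *)
Lemma sector_diverges (delta eps theta s : R) : 0 <= s < delta -> 0 < eps ->
  (delta%:E <= exponent G o theta)%E ->
  \esum_(g in [set g | G g /\ `|slope g o - theta| <= eps])
    (expR (- (s * D g)))%:E = +oo%E.
Proof.
move=> /andP[s0 sd] eps0 H; pose s' := (s + delta) / 2.
have [ss s'd] : s < s' /\ s' < delta by rewrite /s'; split; lra.
apply/eqyP => r r0.
have sE : (s'%:E < exponent_eps G o eps theta)%E.
  apply: lt_le_trans (exponent_le theta eps0).
  by apply: lt_le_trans H; rewrite lte_fin.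
have ds0 : 0 < s' - s by rewrite subr_gt0.
have [n Nn /growth_gt] := limn_esup_gt sE (Num.bound (r / (s' - s))).+1.
move=> /(_ (leq_trans (ltn0Sn _) Nn)) cn.
have rn : r <= (s' - s) * n%:R.
  rewrite mulrC -ler_pdivrMr//.
  have /archi_boundP/ltW := divr_ge0 (ltW r0) (ltW ds0).
  by move=> /le_trans; apply; rewrite ler_nat ltnW.
apply: (@le_trans _ _ (\sum_(g \in A eps theta o n) (expR (- (s * D g)))%:E)%E); last first.
  apply: esum_ge; exists (A eps theta o n) => //; split; first exact: finite_annulus.
  by move=> g [].
have finA := finite_annulus eps theta n.
rewrite fsumEFin// lee_fin.
apply: (@le_trans _ _ (\sum_(g \in A eps theta o n) expR (- (s * n%:R)))); last first.
  rewrite -lee_fin -!fsumEFin//; apply: lee_fsum => // g [_ _ /andP[_ h] _].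
  by rewrite lee_fin ler_expR lerN2 ler_wpM2l// ltW.
rewrite fsbig_finite//= big_const_seq count_predT iter_addr_0 -[leRHS]mulr_natl.
apply: (@le_trans _ _ (expR (s' * n%:R) * expR (- (s * n%:R)))); last first.
  by rewrite ler_wpM2r// expR_ge0.
rewrite -expRD; apply: le_trans (expR_ge1Dx _).
by lra.
Qed.

End counting.

Section slopes.
Context (R : realType) (X1 X2 : metricType R) (o : l2prod X1 X2).
Implicit Type g : isom X1 * isom X2.
Local Notation D g := (mdist o (prod_isom g o)).

Lemma mdist_cos_slope g : mdist o.1 (g.1 o.1) = D g * cos (slope g o).
Proof.
rewrite /slope; case: ifP => [/eqP ->|/negbT d1]; first by rewrite cos_pihalf mulr0.
have d1p : 0 < mdist o.1 (g.1 o.1) by rewrite lt_neqAle eq_sym d1 mdist_ge0.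
rewrite cos_atan l2distE /=; set a := mdist o.1 _ in d1 d1p *; set b := mdist o.2 _.
have -> : a ^+ 2 + b ^+ 2 = a ^+ 2 * (1 + (b / a) ^+ 2) by field.
rewrite sqrtrM ?sqr_ge0// sqrtr_sqr gtr0_norm// mulfK// gt_eqF// sqrtr_gt0.
by rewrite ltr_pwDl// sqr_ge0.
Qed.

Lemma mdist_sin_slope g : mdist o.2 (g.2 o.2) = D g * sin (slope g o).
Proof.
have := mdist_cos_slope g; rewrite /slope; case: ifP => [/eqP d0 _|/negbT d1].
  by rewrite sin_pihalf mulr1 l2distE /= d0 expr0n add0r sqrtr_sqr ger0_norm// mdist_ge0.
set t := atan _ => E.
have c0 : cos t != 0 by apply: contraNneq d1 => c0; rewrite E c0 mulr0.
have -> : sin t = tan t * cos t by rewrite /tan mulfVK.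
by rewrite mulrCA -E /t atanK mulfVK.
Qed.

Lemma slope_near (f : R -> R) theta eta : continuous f -> f theta = 1 -> 0 < eta ->
  exists2 eps : R, 0 < eps &
    forall g, `|slope g o - theta| <= eps -> D g - D g * f (slope g o) <= eta * D g.
Proof.
move=> cf f1 eta0; have /cvgrPdist_le/(_ _ eta0)/nbhs_ballP[e /= e0 he] := cf theta.
exists (e / 2); first by rewrite divr_gt0.
move=> g gt; rewrite -[X in X - _]mulr1 -mulrBr mulrC ler_wpM2r ?mdist_ge0//.
apply: le_trans (ler_norm _) _; rewrite -f1; apply: he => /=.
by rewrite /ball/= distrC (le_lt_trans gt)// ltr_pdivrMr// ltr_pMr// ltr1n.
Qed.

End slopes.

(** * The two factors of a product *)

Section product.
Context (R : realType) (X1 X2 : metricType R).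
Local Notation X := (l2prod X1 X2).

Lemma mdist_l2prod_sqr (x y : X) :
  mdist x y ^+ 2 = mdist x.1 y.1 ^+ 2 + mdist x.2 y.2 ^+ 2.
Proof. by rewrite l2distE sqr_sqrtr// addr_ge0 ?sqr_ge0. Qed.

Definition left_splitting : l2_splitting X1 X2 X.
Proof.
refine (@L2Splitting R X1 X2 X fst snd (fun y z => (y, z)) _ _ _ _) => //.
- by case.
- exact: mdist_l2prod_sqr.
Defined.

Definition right_splitting : l2_splitting X2 X1 X.
Proof.
refine (@L2Splitting R X2 X1 X snd fst (fun y z => (z, y)) _ _ _ _) => //.
- by case.
- by move=> x y; rewrite mdist_l2prod_sqr addrC.
Defined.

Lemma slope_set_left : slope_set left_splitting = bdry_slope (0 : R).
Proof.
have raysE s x2 : lift left_splitting s x2 = ray_left s x2.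
  by congr Ray; exact: Prop_irrelevance.
apply/seteqP; split=> [_ [s [z ->]]|xi].
  by left; split=> //; exists s, z; rewrite raysE.
move=> [[_ [s [x2 ->]]]|[/esym/eqP]]; first by exists s, x2; rewrite raysE.
by rewrite gt_eqF// divr_gt0 ?pi_gt0.
Qed.

Lemma slope_set_right : slope_set right_splitting = bdry_slope (pi / 2 : R).
Proof.
have raysE x1 s : lift right_splitting s x1 = ray_right x1 s.
  by congr Ray; exact: Prop_irrelevance.
apply/seteqP; split=> [_ [s [z ->]]|xi].
  by right; split=> //; exists z, s; rewrite raysE.
move=> [[/eqP + _]|[_ [x1 [s ->]]]]; last by exists s, x1; rewrite raysE.
by rewrite gt_eqF// divr_gt0 ?pi_gt0.
Qed.

Variables (o : X) (G : set (isom X1 * isom X2)).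
Hypotheses (hX1 : hadamard X1) (hX2 : hadamard X2).
Hypotheses (hG : group_closed [in G]) (aG : acts_properly G).
Hypothesis hpos : (0 < exponent G o (pi / 4))%E.

Lemma max_exponentE theta : exponent_max_at G o theta ->
  exists2 delta : R, 0 < delta & exponent G o theta = delta%:E /\
    forall t, 0 <= t <= pi / 2 -> (exponent G o t <= delta%:E)%E.
Proof.
move=> [fn mx]; exists (fine (exponent G o theta)); last by rewrite fineK.
have p0 := pi_gt0 R.
have le_t : (exponent G o (pi / 4) <= exponent G o theta)%E.
  by apply: mx; apply/andP; split; lra.
by apply: fine_gt0; rewrite (lt_le_trans hpos le_t) ltey_eq fn.
Qed.

(** Both cases are treated at once: f is the cosine or the sine of the slope,
    by which the displacement in the factor Y is obtained from the total one. *)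
Lemma orbit_slope_density (Y Z : metricType R) (S : l2_splitting Y Z X)
    (aY : isom X1 * isom X2 -> isom Y) (aZ : isom X1 * isom X2 -> isom Z)
    (f : R -> R) (theta : R) :
  hadamard Y -> hadamard Z -> proper_space Y ->
  (forall g x, prY S (prod_isom g x) = aY g (prY S x)) ->
  (forall g x, prZ S (prod_isom g x) = aZ g (prZ S x)) ->
  continuous f -> f theta = 1 ->
  (forall g, mdist (prY S o) (aY g (prY S o)) =
     mdist o (prod_isom g o) * f (slope g o)) ->
  exponent_max_at G o theta ->
  exists (delta : R) (xi : bdry X)
    (nu : X -> {finite_measure set (borel_bdry xi) -> \bar R}),
  [/\ forall x, support (nu x) !=set0,
      forall x, support (nu x) `<=` limit_set G o `&` slope_set S,
      forall g x (E : set (borel_bdry xi)), G g -> measurable E ->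
        nu (prod_isom g x) E =
        nu x ((bdry_act (prod_isom g) : borel_bdry xi -> borel_bdry xi) @^-1` E) &
      [/\ forall x, nu x `<< nu o,
      (forall x, {ae nu o, forall a : borel_bdry xi, forall (s : ray Y) (z : Z),
         a = ray_end (lift S s z) ->
         ('d (charge_of_finite_measure (nu x)) '/d (nu o)) a =
           (expR (delta * busemann (ray_end s) (prY S o) (prY S x)))%:E}) &
      continuous (nu : X -> weak_star xi)]].
Proof.
move=> [_ cY] [_ cZ] pY aXY aXZ cf f1 dYE mx.
have [delta delta0 [dE le_delta]] := max_exponentE mx.
have [_ G2] := hG; have G1 : G 1%g by case: hG => /set_mem.
have GMV g h : G g -> G h -> G (g * h^-1)%g.
  by move=> Gg Gh; apply/set_mem/G2; exact/mem_set.
have GV g : G g -> G g^-1%g by move=> Gg; rewrite -[g^-1%g]mul1g; exact: GMV.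
have GM g h : G g -> G h -> G (g * h)%g.
  by move=> Gg Gh; rewrite -[h]invgK; apply: GMV => //; exact: GV.
have [||xi [nu [ne su eq [dom [RN lip]]]]] := @slope_density_exists R Y Z X S
  (cat0_stewart cY) (cat0_stewart cZ) cY.1 cZ.1 pY _ (@prod_isom R X1 X2) aY aZ
  aXY aXZ (fun _ _ _ => erefl) G o delta (finite_ball o aG) GM GV delta0.
- by move=> s ds; apply: (orbit_summable aG (ltW delta0) le_delta ds).
- move=> s eta sd eta0.
  have [eps eps0 near_slope] := slope_near o cf f1 eta0.
  apply/eqP; rewrite -leye_eq.
  rewrite -(sector_diverges (o := o) (theta := theta) aG sd eps0) ?dE//.
  apply: le_esum_subset => // g [Gg gt]; split=> //.
  by have := near_slope _ gt; rewrite /dispY /orbitY aXY dYE.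
exists delta, xi, nu; split=> //.
- by move=> x a /su[]; split.
- split=> //; exact: (weak_star_continuous lip).
Qed.

Theorem left_density : proper_space X1 -> exponent_max_at G o 0 ->
  exists b : R * R, has_density G o b 0.
Proof.
move=> pX1 mx; have p0 := pi_gt0 R.
have [|||delta [xi [nu [ne su eq [dom RN cont]]]]] :=
  @orbit_slope_density X1 X2 left_splitting fst snd cos 0 hX1 hX2 pX1 (fun _ _ => erefl) (fun _ _ => erefl) _ _ _ mx.
- exact: continuous_cos.
- exact: cos0.
- by move=> g; exact: mdist_cos_slope.
exists (delta, 0), xi, nu; split=> // x; split=> //.
- split; first exact: ne.
  by move=> a /su; rewrite slope_set_left.
- by move=> g Gg E mE; exact: eq.
- exact: dom.
- move=> _; split=> //; move: (RN x); apply: filterS => a H s x2 aE _.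
  by apply: H; rewrite aE; congr ray_end; congr Ray; exact: Prop_irrelevance.
- by move=> /esym/eqP; rewrite gt_eqF// divr_gt0.
Qed.

Theorem right_density : proper_space X2 -> exponent_max_at G o (pi / 2) ->
  exists b : R * R, has_density G o b (pi / 2).
Proof.
move=> pX2 mx; have p0 := pi_gt0 R.
have [|||delta [xi [nu [ne su eq [dom RN cont]]]]] :=
  @orbit_slope_density X2 X1 right_splitting snd fst sin (pi / 2) hX2 hX1 pX2 (fun _ _ => erefl) (fun _ _ => erefl) _ _ _ mx.
- exact: continuous_sin.
- exact: sin_pihalf.
- by move=> g; exact: mdist_sin_slope.
exists (0, delta), xi, nu; split=> // x; split=> //.
- split; first exact: ne.
  by move=> a /su; rewrite slope_set_right.
- by move=> g Gg E mE; exact: eq.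
- exact: dom.
- by move=> /eqP; rewrite gt_eqF// divr_gt0.
- move=> _; split=> //; move: (RN x); apply: filterS => a H x1 s aE _.
  by apply: H; rewrite aE; congr ray_end; congr Ray; exact: Prop_irrelevance.
Qed.

End product.

Theorem theorem1p13 (R : realType) (X1 X2 : metricType R)
    (hX1 : hadamard X1) (hX2 : hadamard X2)
    (pX1 : proper_space X1) (pX2 : proper_space X2)
    (o : l2prod X1 X2) (G : set (isom X1 * isom X2))
    (hG : group_closed [in G]) (aG : acts_properly G)
    (hrank : exists g h : isom X1 * isom X2, [/\ G g, G h,
       independent_rank_one g.1 h.1 & independent_rank_one g.2 h.2])
    (hpos : forall theta : R, 0 < theta < pi / 2 ->
       (0 < exponent G o theta)%E) :
  (exponent_max_at G o 0 ->
     exists b : R * R, has_density G o b 0) /\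
  (exponent_max_at G o (pi / 2) ->
     exists b : R * R, has_density G o b (pi / 2)).
Proof.
have p0 := pi_gt0 R.
have h4 : (0 < exponent G o (pi / 4))%E by apply: hpos; apply/andP; split; lra.
split; first exact: left_density.
exact: right_density.
Qed.
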